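(* Let $(G,\omega_1)$ and $(H,\omega_2)$ be weighted locally compact groups, $1\le p<\infty$, with $L^p(G,\omega_1)$ and $L^p(H,\omega_2)$ convolution Banach algebras. Let $T:L^p(G,\omega_1)\to L^p(H,\omega_2)$ be a bicontinuous biseparating algebra isomorphism. Then there exists a standard isomorphism $(\gamma,\phi)$ from $(G,\omega_1)$ to $(H,\omega_2)$ such that $T=T_{\gamma,\phi}$.
   Context: A weighted locally compact group is a pair $(G,\omega)$ with $G$ locally compact and $\omega:G\to\mathbb{R}^+$ positive continuous, $\omega(xy)\le\omega(x)\omega(y)$, $\omega(e_G)=1$. $L^p(G,\omega)$ is the space of measurable $f$ with $\|f\|_{p,\omega}=\left(\int_G|f|^p\omega^p\,d\lambda\right)^{1/p}<\infty$. An operator $T$ is disjointness preserving if $f\cdot g=0$ implies $Tf\cdot Tg=0$; biseparating if it is a bijection and $T,T^{-1}$ are disjointness preserving; bicontinuous if $T,T^{-1}$ are bounded. A standard isomorphism $(\gamma,\phi)$ from $(G,\omega_1)$ onto $(H,\omega_2)$ consists of a topological group isomorphism $\phi:G\to H$ and a continuous character $\gamma:G\to\mathbb{C}\setminus\{0\}$ with $0<\inf_{x\in G}|\gamma(x)|\frac{\omega_2(\phi(x))}{\omega_1(x)}$ and $\sup_{x\in G}|\gamma(x)|\frac{\omega_2(\phi(x))}{\omega_1(x)}<\infty$. For such a pair, with Haar measures $\lambda_1,\lambda_2$ on $G,H$, let $c$ be the constant with $c=\lambda_1(E)/\lambda_2(\phi(E))$ for every non-null measurable $E\subset G$, and define $T_{\gamma,\phi}:L^p(G,\omega_1)\to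 L^p(H,\omega_2)$ by $T_{\gamma,\phi}(f)=c\,(\gamma\circ\phi^{-1})\cdot(f\circ\phi^{-1})$. *)

(* Defs.v *)
From HB Require Import structures.
From mathcomp Require Import all_boot all_order all_algebra.
From mathcomp Require Import all_classical all_reals all_analysis.
From mathcomp Require complex.
Import complex.ComplexField.
Set Implicit Arguments.
Unset Strict Implicit.
Unset Printing Implicit Defensive.
Import Order.TTheory GRing.Theory Num.Theory.
Import numFieldNormedType.Exports.
Local Open Scope classical_set_scope.
Local Open Scope ring_scope.

Notation Borel G := (g_sigma_algebraType (@open G)).

Notation C R := (complex.complex R).
Notation cRe := (@complex.Re _).
Notation cIm := (@complex.Im _).

Definition cabs {R : realType} (z : C R) : R := Num.sqrt (cRe z ^+ 2 + cIm z ^+ 2).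

Section Defs.
Variable R : realType.

Definition lc_group (G : ptopologicalType) (mul : G -> G -> G) (inv : G -> G) (e : G) :=
  [/\ associative mul, left_id e mul, right_id e mul &
      (forall x, mul (inv x) x = e /\ mul x (inv x) = e)] /\
  [/\ continuous (fun q : G * G => mul q.1 q.2),
      continuous inv, hausdorff_space G & locally_compact [set: G]].

Definition left_haar (G : ptopologicalType) (mul : G -> G -> G)
    (lam : {measure set (Borel G) -> \bar R}) :=
  [/\ (forall x (A : set (Borel G)), measurable A ->
          lam [set mul x y | y in A] = lam A),
      (forall K : set G, compact K -> (lam K < +oo)%E),
      (forall U : set G, open U -> U !=set0 -> (0 < lam U)%E),
      (forall A : set (Borel G), measurable A ->
          lam A = ereal_inf [set lam U | U in [set U : set G | open U /\ A `<=` U]]) &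
      (forall U : set G, open U ->
          lam U = ereal_sup [set lam K | K in [set K : set G | compact K /\ K `<=` U]])].

Definition weight (G : ptopologicalType) (mul : G -> G -> G) (e : G) (w : G -> R) :=
  [/\ continuous w, (forall x, 0 < w x),
      (forall x y, w (mul x y) <= w x * w y) & w e = 1].

Variable G : ptopologicalType.
Variable lam : {measure set (Borel G) -> \bar R}.

Definition cint (h : G -> C R) : C R :=
  complex.Complex (Rintegral lam setT (fun x : Borel G => cRe (h x)))
                  (Rintegral lam setT (fun x : Borel G => cIm (h x))).

Definition conv (mul : G -> G -> G) (inv : G -> G) (f g : G -> C R) : G -> C R :=
  fun x => cint (fun y => f y * g (mul (inv y) x)).

Definition InLp (w : G -> R) (p : R) (f : G -> C R) :=
  [/\ measurable_fun setT (fun x : Borel G => cRe (f x)),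
      measurable_fun setT (fun x : Borel G => cIm (f x)) &
      (\int[lam]_(x in setT) ((cabs (f x) * w x) `^ p)%:E < +oo)%E].

Definition normLp (w : G -> R) (p : R) (f : G -> C R) : R :=
  (fine (\int[lam]_(x in setT) ((cabs (f x) * w x) `^ p)%:E)) `^ p^-1.

Definition aeq (f g : G -> C R) := ae_eq lam setT f g.

(* L^p(G, w) is a (convolution) Banach algebra (norm submultiplicative up to a
   constant, i.e. for an equivalent norm). *)
Definition Lp_conv_algebra (mul : G -> G -> G) (inv : G -> G) (w : G -> R) (p : R) :=
  exists K : R, forall f g, InLp w p f -> InLp w p g ->
    [/\ {ae lam, forall x, (\int[lam]_(y in setT)
            (cabs (f y) * cabs (g (mul (inv y) x)))%:E < +oo)%E},
        InLp w p (conv mul inv f g) &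
        normLp w p (conv mul inv f g) <= K * normLp w p f * normLp w p g].
End Defs.

(* T induces an algebra isomorphism L^p(G,w1) -> L^p(H,w2)
   (functions are identified when equal a.e.) *)
Definition Lp_alg_iso {R : realType} {G H : ptopologicalType}
    (lam1 : {measure set (Borel G) -> \bar R}) (lam2 : {measure set (Borel H) -> \bar R})
    (mul1 : G -> G -> G) (inv1 : G -> G) (w1 : G -> R)
    (mul2 : H -> H -> H) (inv2 : H -> H) (w2 : H -> R)
    (p : R) (T : (G -> C R) -> (H -> C R)) :=
  [/\ (forall f, InLp lam1 w1 p f -> InLp lam2 w2 p (T f)),
      (forall f g, InLp lam1 w1 p f -> InLp lam1 w1 p g ->
          aeq lam1 f g -> aeq lam2 (T f) (T g)) &
      (forall f g, InLp lam1 w1 p f -> InLp lam1 w1 p g ->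
          aeq lam2 (T (fun x => f x + g x)) (fun y => T f y + T g y))] /\
  [/\ (forall (a : C R) f, InLp lam1 w1 p f ->
          aeq lam2 (T (fun x => a * f x)) (fun y => a * T f y)),
      (forall f g, InLp lam1 w1 p f -> InLp lam1 w1 p g ->
          aeq lam2 (T (conv lam1 mul1 inv1 f g)) (conv lam2 mul2 inv2 (T f) (T g))),
      (forall f g, InLp lam1 w1 p f -> InLp lam1 w1 p g ->
          aeq lam2 (T f) (T g) -> aeq lam1 f g) &
      (forall h, InLp lam2 w2 p h -> exists2 f, InLp lam1 w1 p f & aeq lam2 (T f) h)].

Definition Lp_bicontinuous {R : realType} {G H : ptopologicalType}
    (lam1 : {measure set (Borel G) -> \bar R}) (lam2 : {measure set (Borel H) -> \bar R})
    (mul1 : G -> G -> G) (inv1 : G -> G) (w1 : G -> R)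
    (mul2 : H -> H -> H) (inv2 : H -> H) (w2 : H -> R)
    (p : R) (T : (G -> C R) -> (H -> C R)) :=
  (exists K : R, forall f, InLp lam1 w1 p f ->
      normLp lam2 w2 p (T f) <= K * normLp lam1 w1 p f) /\
  (exists K : R, forall f, InLp lam1 w1 p f ->
      normLp lam1 w1 p f <= K * normLp lam2 w2 p (T f)).

Definition Lp_biseparating {R : realType} {G H : ptopologicalType}
    (lam1 : {measure set (Borel G) -> \bar R}) (lam2 : {measure set (Borel H) -> \bar R})
    (mul1 : G -> G -> G) (inv1 : G -> G) (w1 : G -> R)
    (mul2 : H -> H -> H) (inv2 : H -> H) (w2 : H -> R)
    (p : R) (T : (G -> C R) -> (H -> C R)) :=
  (forall f g, InLp lam1 w1 p f -> InLp lam1 w1 p g ->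
      aeq lam1 (fun x => f x * g x) (fun=> 0) ->
      aeq lam2 (fun y => T f y * T g y) (fun=> 0)) /\
  (forall f g, InLp lam1 w1 p f -> InLp lam1 w1 p g ->
      aeq lam2 (fun y => T f y * T g y) (fun=> 0) ->
      aeq lam1 (fun x => f x * g x) (fun=> 0)).

Definition standard_iso {R : realType} {G H : ptopologicalType}
    (mul1 : G -> G -> G) (w1 : G -> R) (mul2 : H -> H -> H) (w2 : H -> R)
    (gamma : G -> C R) (phi : G -> H) :=
  [/\ (forall x y, phi (mul1 x y) = mul2 (phi x) (phi y)),
      continuous phi &
      (exists2 psi : H -> G, cancel phi psi /\ cancel psi phi & continuous psi)] /\
  [/\ continuous (fun x => (cRe (gamma x), cIm (gamma x)) : R * R),
      (forall x y, gamma (mul1 x y) = gamma x * gamma y),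
      (forall x, gamma x <> 0) &
      exists2 m : R, 0 < m & exists M : R, forall x,
        m <= cabs (gamma x) * w2 (phi x) / w1 x <= M].

Definition is_T_std {R : realType} {G H : ptopologicalType}
    (lam1 : {measure set (Borel G) -> \bar R}) (lam2 : {measure set (Borel H) -> \bar R})
    (mul1 : G -> G -> G) (inv1 : G -> G) (w1 : G -> R)
    (mul2 : H -> H -> H) (inv2 : H -> H) (w2 : H -> R)
    (p : R) (T : (G -> C R) -> (H -> C R))
    (gamma : G -> C R) (phi : G -> H) :=
  exists2 psi : H -> G, cancel phi psi /\ cancel psi phi &
  exists c : R,
    (forall E : set (Borel G), measurable E -> (0 < lam1 E < +oo)%E ->
        lam1 E = (c%:E * lam2 (phi @` E))%E) /\
    (forall f, InLp lam1 w1 p f ->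
        aeq lam2 (T f) (fun y => (complex.Complex c 0) * gamma (psi y) * f (psi y))).

(* Main.v *)
Require Import Defs.
From HB Require Import structures.
From mathcomp Require Import all_boot all_order all_algebra.
From mathcomp Require Import all_classical all_reals all_analysis.
From mathcomp Require complex.
From mathcomp Require Import measurable_realfun ring lra.
Import complex.ComplexField complex.
Import Order.TTheory GRing.Theory Num.Theory.
Local Open Scope classical_set_scope.
Local Open Scope ring_scope.

(* Write [L_x g = g (x^-1 .)]. As a relatively compact Borel set [A] shrinks to a point [x],
   [1_A * g] is [lam A] times [L_x g] up to [o(lam A)], hence [T 1_A * T g] is [lam A] times
   [T (L_x g)] up to [o(lam A)]. Since [T] preserves disjointness in both directions, restricting
   [T 1_A] to a Borel set is again of the form [T 1_A'] with [A'] inside [A]; this forces the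
   supports of the [T 1_A] to shrink to a single point [phi x], and the averages
   [(int T 1_A) / lam A] to converge to some [gamma x]. Passing to the limit gives the law
   [T (L_x g) = gamma x *: L_(phi x) (T g)]. It makes [phi] and [gamma] multiplicative; applied
   to [T^-1] it yields the inverse of [phi]; and testing it on small neighbourhoods of the unit
   bounds [gamma] by the weights.

   To identify [T], take [D], [B] relatively compact and [A] containing [D B^-1]. Then
   [1_A * 1_B] equals [lam1 (B^-1)] on [D], while the law evaluates [T 1_A * T 1_B] at a point
   [phi x] of [phi D] as [gamma x] times a number independent of [D] and [x]. So
   [T 1_D = c gamma(psi .) 1_(phi D)], where [psi] is the inverse of [phi]. Inserting this formula
   for [T 1_B] identifies [c] as the ratio of the Haar measures, and density of simple functions
   concludes. Neither Fubini nor the uniqueness of Haar measure is used. *)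

Set Implicit Arguments.
Unset Strict Implicit.
Unset Printing Implicit Defensive.
Import numFieldNormedType.Exports.

(** The error [o(lam A)] requires a local Young inequality: the norm of [1_A * g] is at most a
    constant times [lam A] times the norm of [g]. The algebra hypothesis alone gives the norm of
    [1_A] in place of [lam A], which is of order [(lam A)^(1/p)] and too large when [p > 1] and
    [lam A] is small. A second obstacle is cancellation: [T 1_A] is complex valued, so a small
    integral of it does not make [T 1_A * 1_Q] small. A third is escape to infinity: the target
    group need not be compact, and a limit point of the supports of the [T 1_A] has to be produced
    by contradiction. Estimates are written for [p]-th powers of norms, for which the triangle
    inequality holds up to the factor [2^p]; tolerances are therefore divided by [2^p * 2], and an
    error [o(lam A)] reads [e * (rl A)^p], with [rl A] the real value of [lam A]. *)

Section ComplexAbs.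
Variable R : realType.
Implicit Types (a b z : C R) (r : R).

(** * Modulus, real part and imaginary part *)

Lemma cabsE z : cabs z = Normc.normc z. Proof. by case: z. Qed.

Lemma cReD a b : cRe (a + b) = cRe a + cRe b. Proof. by case: a b => [? ?] []. Qed.
Lemma cImD a b : cIm (a + b) = cIm a + cIm b. Proof. by case: a b => [? ?] []. Qed.
Lemma cReN a : cRe (- a) = - cRe a. Proof. by case: a. Qed.
Lemma cImN a : cIm (- a) = - cIm a. Proof. by case: a. Qed.
Lemma cReM a b : cRe (a * b) = cRe a * cRe b - cIm a * cIm b.
Proof. by case: a b => [? ?] []. Qed.
Lemma cImM a b : cIm (a * b) = cRe a * cIm b + cIm a * cRe b.
Proof. by case: a b => [? ?] []. Qed.

Lemma complex_eq a b : cRe a = cRe b -> cIm a = cIm b -> a = b.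
Proof. by case: a b => [? ?] [? ?] /= -> ->. Qed.

Definition rc r : C R := complex.Complex r 0.

Lemma rcD r s : rc (r + s) = rc r + rc s.
Proof. by apply: complex_eq; rewrite ?cReD ?cImD //= addr0. Qed.
Lemma rcM r s : rc (r * s) = rc r * rc s.
Proof. by apply: complex_eq; rewrite ?cReM ?cImM /= !(mulr0, mul0r, subr0, addr0). Qed.
Lemma rc0 : rc 0 = 0. Proof. by []. Qed.
Lemma rc1 : rc 1 = 1. Proof. by []. Qed.
Lemma rcN r : rc (- r) = - rc r.
Proof. by apply: complex_eq; rewrite ?cReN ?cImN //= oppr0. Qed.

Lemma cabs_ge0 z : 0 <= cabs z. Proof. exact: sqrtr_ge0. Qed.
Lemma cabs0 : cabs (0 : C R) = 0. Proof. by rewrite cabsE Normc.normc0. Qed.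
Lemma cabs1 : cabs (1 : C R) = 1. Proof. by rewrite cabsE Normc.normc1. Qed.
Lemma cabsM a b : cabs (a * b) = cabs a * cabs b.
Proof. by rewrite !cabsE Normc.normcM. Qed.
Lemma cabsD a b : cabs (a + b) <= cabs a + cabs b.
Proof. by rewrite !cabsE complex.le_normcD. Qed.
Lemma cabsN a : cabs (- a) = cabs a.
Proof. by rewrite !cabsE complex.normcN. Qed.
Lemma cabsB a b : cabs (a - b) <= cabs a + cabs b.
Proof. by rewrite (le_trans (cabsD _ _)) // cabsN. Qed.
Lemma cabs_eq0 z : (cabs z == 0) = (z == 0).
Proof.
apply/eqP/eqP => [|->]; last exact: cabs0.
by rewrite cabsE => /Normc.eq0_normc.
Qed.
Lemma cabs_gt0 z : (0 < cabs z) = (z != 0).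
Proof. by rewrite lt_def cabs_eq0 cabs_ge0 andbT. Qed.
Lemma cabs_rc r : cabs (rc r) = `|r|.
Proof. by rewrite /cabs /= expr0n addr0 sqrtr_sqr. Qed.
Lemma cabs_Re z : `|cRe z| <= cabs z.
Proof. by rewrite -sqrtr_sqr ler_wsqrtr // lerDl sqr_ge0. Qed.
Lemma cabs_Im z : `|cIm z| <= cabs z.
Proof. by rewrite -sqrtr_sqr ler_wsqrtr // lerDr sqr_ge0. Qed.
Lemma cabs_le z : cabs z <= `|cRe z| + `|cIm z|.
Proof.
rewrite -[leRHS]ger0_norm ?addr_ge0 // -sqrtr_sqr ler_wsqrtr //.
rewrite sqrrD !real_normK ?num_real //.
by rewrite lerD2r lerDl mulrn_wge0 ?mulr_ge0.
Qed.

End ComplexAbs.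

(** * Measurable complex functions and complex indicators *)

Section ComplexMeasurable.
Context d (T : measurableType d) (R : realType).
Implicit Types f g : T -> C R.

Definition cmeas f := measurable_fun setT (fun x => cRe (f x)) /\
                      measurable_fun setT (fun x => cIm (f x)).

Lemma cmeas_cst z : cmeas (fun=> z).
Proof. by split; exact: measurable_cst. Qed.

Lemma cmeasD f g : cmeas f -> cmeas g -> cmeas (fun x => f x + g x).
Proof.
move=> [f1 f2] [g1 g2]; split; under eq_fun do rewrite ?cReD ?cImD;
by apply: measurable_funD.
Qed.

Lemma cmeasN f : cmeas f -> cmeas (fun x => - f x).
Proof.
move=> [f1 f2]; split; under eq_fun do rewrite ?cReN ?cImN;
by apply: measurableT_comp.
Qed.

Lemma cmeasB f g : cmeas f -> cmeas g -> cmeas (fun x => f x - g x).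
Proof. by move=> mf mg; apply: cmeasD => //; exact: cmeasN. Qed.

Lemma cmeasM f g : cmeas f -> cmeas g -> cmeas (fun x => f x * g x).
Proof.
move=> [f1 f2] [g1 g2]; split; under eq_fun do rewrite ?cReM ?cImM.
  by apply: measurable_funB; apply: measurable_funM.
by apply: measurable_funD; apply: measurable_funM.
Qed.

Lemma cmeas_rc (u : T -> R) : measurable_fun setT u -> cmeas (fun x => rc (u x)).
Proof. by move=> mu; split => //=; exact: measurable_cst. Qed.

Lemma measurable_cabs f : cmeas f -> measurable_fun setT (fun x => cabs (f x)).
Proof.
move=> [f1 f2]; apply: (measurableT_comp (continuous_measurable_fun (@sqrt_continuous R))).
by apply: measurable_funD; apply: measurable_funX.
Qed.

Definition ind (E : set T) : T -> C R := fun x => rc (\1_E x).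

Lemma cmeas_ind E : measurable E -> cmeas (ind E).
Proof. by move=> mE; apply: cmeas_rc; exact: measurable_indic. Qed.

Lemma indT E x : E x -> ind E x = 1.
Proof. by move=> Ex; rewrite /ind indicE mem_set. Qed.
Lemma indF E x : ~ E x -> ind E x = 0.
Proof. by move=> Ex; rewrite /ind indicE memNset. Qed.

Lemma cabs_ind E x : cabs (ind E x) = \1_E x.
Proof. by rewrite cabs_rc ger0_norm. Qed.

Lemma ind_mul E f x : ind E x * f x = if x \in E then f x else 0.
Proof. by rewrite /ind indicE; case: (x \in E); rewrite ?mul1r ?mul0r. Qed.

Lemma ind_split E F x : ind E x = ind (E `&` F) x + ind (E `\` F) x.
Proof.
rewrite /ind -rcD !indicE in_setI in_setD.
by case: (x \in E); case: (x \in F); rewrite /= ?addr0 ?add0r.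
Qed.

Lemma measurable_eq0 f : cmeas f -> measurable [set x | f x = 0].
Proof.
move=> mf.
have -> : [set x | f x = 0] = (fun x => cabs (f x)) @^-1` [set 0].
  by apply/seteqP; split => x /= => [->|/eqP]; rewrite ?cabs0 // cabs_eq0 => /eqP.
by rewrite -[X in measurable X]setTI; apply: measurable_cabs.
Qed.

Lemma measurable_neq0 f : cmeas f -> measurable [set x | f x <> 0].
Proof. by move=> /measurable_eq0/measurableC. Qed.

End ComplexMeasurable.
Arguments ind {d T R} E x.

(** * Borel sets and continuous maps *)

Section Borel.
Variable R : realType.

Lemma open_Borel (G : ptopologicalType) (U : set G) :
  open U -> measurable (U : set (Borel G)).
Proof. exact: sub_sigma_algebra. Qed.

Lemma closed_Borel (G : ptopologicalType) (U : set G) :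
  closed U -> measurable (U : set (Borel G)).
Proof.
by move=> /closed_openC/open_Borel/measurableC; rewrite setCK.
Qed.

Lemma compact_Borel (G : ptopologicalType) (K : set G) :
  hausdorff_space G -> compact K -> measurable (K : set (Borel G)).
Proof. by move=> hG cK; exact: closed_Borel (compact_closed hG cK). Qed.

Lemma continuous_Borel (G H : ptopologicalType) (f : G -> H) :
  continuous f -> measurable_fun setT (f : Borel G -> Borel H).
Proof.
move=> cf; apply: (@measurability _ _ (Borel G) (Borel H) _ _ (@open H)) => //.
move=> _ [U oU <-]; rewrite setTI; apply: open_Borel.
by apply: open_comp => // x _; exact: cf.
Qed.

Lemma continuous_BorelR (G : ptopologicalType) (f : G -> R) :
  continuous f -> measurable_fun setT (f : Borel G -> R).
Proof.
move=> cf; apply: (measurability _ (RGenOInfty.measurableE R)) => //.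
move=> _ [_ [x ->] <-]; rewrite setTI; apply: open_Borel.
by apply: open_comp => [y _|]; [exact: cf | exact: interval_open].
Qed.

End Borel.

(** * Inequalities for real powers *)

Section Powers.
Variables (R : realType) (p : R).
Hypothesis p1 : 1 <= p.

Let p0 : 0 < p. Proof. exact: lt_le_trans ltr01 p1. Qed.

Lemma le_powR (a b : R) : 0 <= a -> a <= b -> a `^ p <= b `^ p.
Proof.
move=> a0 ab; apply: ge0_ler_powR; rewrite ?nnegrE ?(ltW p0) //.
exact: le_trans ab.
Qed.

(** For [a <= b] the sum is at most [2 * b]. The constant is cruder than the [2^(p-1)] of convexity,
    which does no harm here. *)
Lemma powRD_le (a b : R) : 0 <= a -> 0 <= b ->
  (a + b) `^ p <= 2 `^ p * (a `^ p + b `^ p).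
Proof.
move=> a0 b0; wlog ab : a b a0 b0 / a <= b.
  move=> H; have /orP[|ba] := le_total a b; first exact: H.
  by rewrite addrC [X in _ * X]addrC; exact: H.
apply: (@le_trans _ _ ((2 * b) `^ p)).
  by apply: le_powR; [exact: addr_ge0 | lra].
by rewrite powRM // ler_wpM2l ?powR_ge0 // lerDr powR_ge0.
Qed.

Lemma powR_convex (t a b : R) : 0 <= t <= 1 -> 0 <= a -> 0 <= b ->
  (t * a + (1 - t) * b) `^ p <= t * a `^ p + (1 - t) * b `^ p.
Proof.
move=> /andP[t0 t1] a0 b0.
have tt : t \in `[0, 1] by rewrite in_itv /= t0 t1.
have := @convex_powR R p p1 (Itv01 t0 t1) a b.
rewrite !inE /= !in_itv /= a0 b0 => /(_ isT isT).
by rewrite !convRE /=.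
Qed.

Lemma powR_small (c e : R) : 0 < e -> exists2 d, 0 < d & c * d `^ p <= e.
Proof.
move=> e0; pose m := e / (`|c| + 1).
have m0 : 0 < m by rewrite divr_gt0 // ltr_wpDl.
exists (m `^ p^-1); first exact: powR_gt0.
rewrite -powRrM mulVf ?gt_eqF // powRr1 ?(ltW m0) //.
apply: (@le_trans _ _ ((`|c| + 1) * m)).
  by rewrite ler_wpM2r ?(ltW m0) // (le_trans (ler_norm _)) // lerDl.
by rewrite mulrC divfK // gt_eqF // ltr_wpDl.
Qed.

End Powers.

(* The [p]-th power of the weighted norm; locked because unfolding the integral slows down
   unification. *)
HB.lock Definition Np d (T : measurableType d) (R : realType)
    (mu : {measure set T -> \bar R}) (w : T -> R) (p : R) (f : T -> C R) : \bar R :=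
  (\int[mu]_x ((cabs (f x) * w x) `^ p)%:E)%E.

(** * The weighted [Lp] space through [p]-th powers of norms *)

Section Seminorm.
Context d (T : measurableType d) (R : realType).
Variable mu : {measure set T -> \bar R}.
Variables (w : T -> R) (p : R).
Hypothesis mw : measurable_fun setT w.
Hypothesis w0 : forall x, 0 < w x.
Hypothesis p1 : 1 <= p.
Implicit Types f g : T -> C R.

Let p0 : 0 < p. Proof. exact: lt_le_trans ltr01 p1. Qed.

Let w_ge0 x : 0 <= w x. Proof. exact: ltW. Qed.

Local Notation Np := (Np mu w p).

Lemma NpE f : Np f = (\int[mu]_x ((cabs (f x) * w x) `^ p)%:E)%E.
Proof. by rewrite unlock. Qed.

Definition Lp f := cmeas f /\ (Np f < +oo)%E.

Lemma Np_ge0 f : (0 <= Np f)%E.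
Proof. by rewrite NpE; apply: integral_ge0 => x _; rewrite lee_fin powR_ge0. Qed.

Lemma measurable_Np f : cmeas f ->
  measurable_fun setT (fun x => ((cabs (f x) * w x) `^ p)%:E).
Proof.
move=> mf; apply/measurable_EFinP; apply: (measurableT_comp (measurable_powR p)).
by apply: measurable_funM => //; exact: measurable_cabs.
Qed.
Hint Resolve measurable_Np : core.

Lemma le_Np f g : cmeas f -> cmeas g ->
  {ae mu, forall x, cabs (f x) <= cabs (g x)} -> (Np f <= Np g)%E.
Proof.
move=> mf mg fg; rewrite !NpE; apply: ae_ge0_le_integral => //; try exact: measurable_Np.
- by move=> x _; rewrite lee_fin powR_ge0.
- by move=> x _; rewrite lee_fin powR_ge0.
apply: filterS fg => x fgx _; rewrite lee_fin le_powR // ?mulr_ge0 ?cabs_ge0 ?w_ge0 //.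
by rewrite ler_wpM2r // w_ge0.
Qed.

Lemma eq_Np f g : cmeas f -> cmeas g ->
  {ae mu, forall x, cabs (f x) = cabs (g x)} -> Np f = Np g.
Proof.
move=> mf mg fg; apply/eqP; rewrite eq_le; apply/andP; split; apply: le_Np => //;
by apply: filterS fg => x ->.
Qed.

Lemma NpD f g : cmeas f -> cmeas g ->
  (Np (fun x => f x + g x)%R <= (2 `^ p)%:E * (Np f + Np g))%E.
Proof.
move=> mf mg; rewrite !NpE -ge0_integralD //; try exact: measurable_Np;
  try by move=> x _; rewrite lee_fin powR_ge0.
rewrite -ge0_integralZl_EFin ?powR_ge0 //; last 2 first.
- by move=> x _; rewrite adde_ge0 // lee_fin powR_ge0.
- by apply: emeasurable_funD; exact: measurable_Np.
apply: ge0_le_integral => //.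
- by move=> x _; rewrite lee_fin powR_ge0.
- exact/measurable_Np/cmeasD.
- by apply: measurable_funeM; apply: emeasurable_funD; exact: measurable_Np.
move=> x _; rewrite -EFinD -EFinM lee_fin.
apply: le_trans (powRD_le p1 _ _); rewrite ?mulr_ge0 ?cabs_ge0 ?w_ge0 //.
apply: le_powR => //; first by rewrite ?mulr_ge0 ?cabs_ge0 ?w_ge0.
by rewrite -mulrDl ler_wpM2r ?w_ge0 // cabsD.
Qed.

Lemma NpD_le f g (a b : R) : cmeas f -> cmeas g ->
  (Np f <= a%:E)%E -> (Np g <= b%:E)%E ->
  (Np (fun x => f x + g x)%R <= (2 `^ p * (a + b))%:E)%E.
Proof.
move=> mf mg fa gb; apply: le_trans (NpD mf mg) _.
by rewrite EFinM lee_wpmul2l ?lee_fin ?powR_ge0 // EFinD leeD.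
Qed.

Lemma NpZ (a : C R) f : cmeas f ->
  Np (fun x => a * f x)%R = ((cabs a `^ p)%:E * Np f)%E.
Proof.
move=> mf; rewrite !NpE -ge0_integralZl_EFin ?powR_ge0 //; last 2 first.
- by move=> x _; rewrite lee_fin powR_ge0.
- exact: measurable_Np.
apply: eq_integral => x _; rewrite -EFinM cabsM -mulrA powRM ?cabs_ge0 //.
by rewrite mulr_ge0 ?cabs_ge0 ?w_ge0.
Qed.

Lemma NpN f : Np (fun x => - f x) = Np f.
Proof. by rewrite !NpE; apply: eq_integral => x _; rewrite cabsN. Qed.

Lemma NpC f g : Np (fun x => f x - g x) = Np (fun x => g x - f x).
Proof. by rewrite -NpN; congr Np; apply/funext => x; rewrite opprB. Qed.

Lemma Np_eq0 f : cmeas f -> Np f = 0%E -> {ae mu, forall x, f x = 0}.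
Proof.
move=> mf Nf.
have : ae_eq mu setT (fun x => ((cabs (f x) * w x) `^ p)%:E) (cst 0%E).
  apply/ae_eq_integral_abs => //; first exact: measurable_Np.
  by rewrite -[RHS]Nf NpE; apply: eq_integral => x _; rewrite gee0_abs // lee_fin powR_ge0.
apply: filterS => x /(_ I) /= [] /eqP; rewrite powR_eq0 => /andP[+ _].
by rewrite mulf_eq0 (gt_eqF (w0 x)) orbF cabs_eq0 => /eqP.
Qed.

Lemma ae0_Np f : cmeas f -> {ae mu, forall x, f x = 0} -> Np f = 0%E.
Proof.
move=> mf f0; have -> : Np f = Np (fun=> 0).
  by apply: eq_Np => //; apply: filterS f0 => x ->.
rewrite NpE; under eq_integral do rewrite cabs0 mul0r powR0 ?gt_eqF //.
by rewrite integral0.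
Qed.

Lemma Np_small0 f : cmeas f -> (forall e : R, 0 < e -> (Np f <= e%:E)%E) ->
  {ae mu, forall x, f x = 0}.
Proof.
move=> mf H; apply: Np_eq0 => //; apply/eqP; rewrite eq_le Np_ge0 andbT.
by apply/lee_addgt0Pr => e e0; rewrite add0e H.
Qed.

Lemma Np_small0_on (D : set T) f : measurable D -> cmeas f ->
  (forall e : R, 0 < e -> (Np (fun x => ind D x * f x)%R <= e%:E)%E) ->
  {ae mu, forall x, D x -> f x = 0}.
Proof.
move=> mD mf /Np_small0 H.
have mDf : cmeas (fun x => ind D x * f x) by apply: cmeasM => //; exact: cmeas_ind.
by apply: filterS (H mDf) => x + Dx; rewrite indT // mul1r.
Qed.

(** Unlike in [NpD_le], the bound does not deteriorate. This matters in [majorant], where convex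
    combinations are iterated once per piece of a finite cover whose size is not controlled. *)
Lemma Np_convex (t : R) f g (B : \bar R) : cmeas f -> cmeas g -> 0 <= t <= 1 ->
  (Np f <= B)%E -> (Np g <= B)%E ->
  (Np (fun x => rc t * f x + rc (1 - t) * g x)%R <= B)%E.
Proof.
move=> mf mg t01 fB gB; have /andP[t0 t1] := t01.
have t1' : 0 <= 1 - t by rewrite subr_ge0.
apply: (@le_trans _ _ (t%:E * Np f + (1 - t)%:E * Np g)%E); last first.
  apply: (@le_trans _ _ (t%:E * B + (1 - t)%:E * B)%E).
    by apply: leeD; [apply: lee_wpmul2l fB | apply: lee_wpmul2l gB].
  by rewrite -ge0_muleDl // -EFinD addrC subrK mul1e.
rewrite !NpE -!ge0_integralZl_EFin //; try exact: measurable_Np;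
  try by move=> x _; rewrite lee_fin powR_ge0.
rewrite -ge0_integralD //; first last.
- by apply: measurable_funeM; exact: measurable_Np.
- by move=> x _; rewrite mule_ge0 // lee_fin powR_ge0.
- by apply: measurable_funeM; exact: measurable_Np.
- by move=> x _; rewrite mule_ge0 // lee_fin powR_ge0.
apply: ge0_le_integral => //.
- by move=> x _; rewrite lee_fin powR_ge0.
- by apply: measurable_Np; apply: cmeasD; apply: cmeasM => //; exact: cmeas_cst.
- by apply: emeasurable_funD; apply: measurable_funeM; exact: measurable_Np.
move=> x _; rewrite -!EFinM -EFinD lee_fin.
apply: le_trans (powR_convex p1 t01 _ _); rewrite ?mulr_ge0 ?cabs_ge0 ?w_ge0 //.
apply: le_powR => //; first by rewrite ?mulr_ge0 ?cabs_ge0 ?w_ge0.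
rewrite !mulrA -mulrDl ler_wpM2r ?w_ge0 // (le_trans (cabsD _ _)) //.
by rewrite !cabsM !cabs_rc !ger0_norm.
Qed.

Lemma LpD f g : Lp f -> Lp g -> Lp (fun x => f x + g x).
Proof.
move=> [mf Nf] [mg Ng]; split; first exact: cmeasD.
apply: le_lt_trans (NpD mf mg) _; apply: lte_mul_pinfty => //.
exact: lte_add_pinfty.
Qed.

Lemma LpZ (a : C R) f : Lp f -> Lp (fun x => a * f x).
Proof.
move=> [mf Nf]; split; first by apply: cmeasM => //; exact: cmeas_cst.
by rewrite NpZ //; apply: lte_mul_pinfty => //; rewrite lee_fin powR_ge0.
Qed.

Lemma LpN f : Lp f -> Lp (fun x => - f x).
Proof. by move=> [mf Nf]; split; [exact: cmeasN | rewrite NpN]. Qed.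

Lemma LpB f g : Lp f -> Lp g -> Lp (fun x => f x - g x).
Proof. by move=> Lf Lg; apply: LpD => //; exact: LpN. Qed.

Lemma Lp_le f g : cmeas f -> Lp g -> {ae mu, forall x, cabs (f x) <= cabs (g x)} -> Lp f.
Proof. by move=> mf [mg Ng] fg; split => //; exact: le_lt_trans (le_Np mf mg fg) Ng. Qed.

Lemma le_cabs_ind (E : set T) f x : cabs (ind E x * f x) <= cabs (f x).
Proof. by rewrite ind_mul; case: ifP => // _; rewrite cabs0 cabs_ge0. Qed.

Lemma Lp_indM (E : set T) f : measurable E -> Lp f -> Lp (fun x => ind E x * f x).
Proof.
move=> mE Lf; apply: Lp_le (Lf) _; first by apply: cmeasM Lf.1; exact: cmeas_ind.
by apply: aeW => x; exact: le_cabs_ind.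
Qed.

Lemma le_Np_indM (E : set T) f : measurable E -> cmeas f ->
  (Np (fun x => ind E x * f x)%R <= Np f)%E.
Proof.
move=> mE mf; apply: le_Np => //; first by apply: cmeasM => //; exact: cmeas_ind.
by apply: aeW => x; exact: le_cabs_ind.
Qed.

Lemma Lp0 : Lp (fun=> 0).
Proof.
split; first exact: cmeas_cst.
by rewrite ae0_Np //; exact: aeW.
Qed.

Lemma Lp_fin f : Lp f -> exists2 a : R, 0 <= a & Np f = a%:E.
Proof.
move=> [_ Nf]; exists (fine (Np f)); first by rewrite fine_ge0 ?Np_ge0.
by rewrite fineK // ge0_fin_numE ?Np_ge0.
Qed.

Lemma Np_ind (E : set T) : measurable E ->
  Np (ind E) = (\int[mu]_(x in E) (w x `^ p)%:E)%E.
Proof.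
move=> mE; rewrite NpE [RHS]integral_mkcond; apply: eq_integral => x _.
rewrite cabs_ind patchE indicE; case: (x \in E); rewrite ?mul1r // mul0r powR0 //.
by rewrite gt_eqF.
Qed.

End Seminorm.

(** * Local-to-global induction on compact sets *)

Section CompactInduction.
Variable X : topologicalType.

(** The sets satisfying [P] are directed by inclusion, and [F] is the filter of what holds for all
    large ones among them. The near-covering form of compactness then gives one such set that
    contains [K]. *)
Lemma compact_local_ind (P : set X -> Prop) (K : set X) : compact K ->
  P set0 -> (forall A B, A `<=` B -> P B -> P A) ->
  (forall A B, P A -> P B -> P (A `|` B)) ->
  (forall x, K x -> exists2 U, nbhs x U & P U) -> P K.
Proof.
move=> /compact_near_coveringP cK P0 PS PU Ploc.
pose F : set_system (set X) := [set S | exists2 A, P A & forall B, A `<=` B -> P B -> S B].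
have FF : Filter F.
  split; first by exists set0.
    move=> S1 S2 [A1 P1 H1] [A2 P2 H2]; exists (A1 `|` A2); first exact: PU.
    by move=> B; rewrite subUset => -[B1 B2] PB; split; [exact: H1|exact: H2].
  by move=> S1 S2 S12 [A PA H]; exists A => // B AB PB; apply/S12/H.
have [x Kx|A PA] := cK (set X) F (fun A y => A y) FF.
  have [U xU PU'] := Ploc x Kx.
  exists (U, [set B | U `<=` B]) => /=; first by split => //; exists U.
  by move=> [y B] [/= Uy UB]; exact: UB.
by move=> /(_ A (@subset_refl _ A) PA) KA; apply: (PS _ A).
Qed.

End CompactInduction.

(** The hypotheses on one group are bundled, so that every result applies to both groups, and
    results about maps apply to [T] as well as to its inverse. *)
Record walg (R : realType) (p : R) := WAlg {
  wG :> ptopologicalType;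
  gm : wG -> wG -> wG; gi : wG -> wG; ge : wG;
  lam : {measure set (Borel wG) -> \bar R};
  wt : wG -> R;
  walg_group : lc_group gm gi ge;
  walg_haar : left_haar gm lam;
  walg_weight : weight gm ge wt;
  walg_p : 1 <= p;
  walg_alg : Lp_conv_algebra lam gm gi wt p }.
Arguments gm {R p w}.
Arguments gi {R p w}.
Arguments ge {R p w}.
Arguments lam {R p w}.
Arguments wt {R p w}.

(** * Topology and Haar measure of a weighted group *)

Section OneGroup.
Variables (R : realType) (p : R) (X : walg p).
Implicit Types (x y z : X) (f g : X -> C R) (A B E F K U V : set X).

Lemma p_gt0 : 0 < p. Proof. exact: lt_le_trans ltr01 (walg_p X). Qed.

Lemma gmA : associative (@gm R p X). Proof. by case: (walg_group X) => -[]. Qed.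
Lemma g1m : left_id ge (@gm R p X). Proof. by case: (walg_group X) => -[]. Qed.
Lemma gm1 : right_id ge (@gm R p X). Proof. by case: (walg_group X) => -[]. Qed.
Lemma gVm x : gm (gi x) x = ge.
Proof. by case: (walg_group X) => -[_ _ _ /(_ x)[]]. Qed.
Lemma gmV x : gm x (gi x) = ge.
Proof. by case: (walg_group X) => -[_ _ _ /(_ x)[]]. Qed.
Lemma gmK x y : gm (gi x) (gm x y) = y. Proof. by rewrite gmA gVm g1m. Qed.
Lemma gmVK x y : gm x (gm (gi x) y) = y. Proof. by rewrite gmA gmV g1m. Qed.
Lemma gm_inj x : injective (gm x). Proof. exact: can_inj (gmK x). Qed.
Lemma giK x : gi (gi x) = x.
Proof. by rewrite -[LHS]gm1 -(gVm x) gmK. Qed.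
Lemma giM x y : gi (gm x y) = gm (gi y) (gi x).
Proof. by apply: (@gm_inj (gm x y)); rewrite gmV -gmA gmVK gmV. Qed.

Lemma hausX : hausdorff_space X. Proof. by case: (walg_group X) => _ []. Qed.

Lemma cont_gm2 (Y : topologicalType) (u v : Y -> X) :
  continuous u -> continuous v -> continuous (fun t => gm (u t) (v t)).
Proof.
move=> cu cv t; case: (walg_group X) => _ [cm _ _ _].
apply: (@continuous_comp _ _ _ (fun t => (u t, v t)) (fun q => gm q.1 q.2)).
  by apply: cvg_pair => /=; [exact: cu | exact: cv].
exact: cm.
Qed.

Lemma cont_gi (Y : topologicalType) (u : Y -> X) :
  continuous u -> continuous (fun t => gi (u t)).
Proof.
move=> cu t; case: (walg_group X) => _ [_ ci _ _].
by apply: (@continuous_comp _ _ _ u gi); [exact: cu | exact: ci].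
Qed.

Lemma cont_id (Y : topologicalType) : continuous (fun t : Y => t).
Proof. by move=> t; exact: cvg_id. Qed.
Lemma cont_cst (Y Z : topologicalType) (s : Z) : continuous (fun _ : Y => s).
Proof. by move=> t; exact: cvg_cst. Qed.

Lemma wt_cont : continuous (@wt R p X). Proof. by case: (walg_weight X). Qed.
Lemma wt_gt0 x : 0 < wt x. Proof. by case: (walg_weight X). Qed.
Lemma wt_ge0 x : 0 <= wt x. Proof. exact/ltW/wt_gt0. Qed.
Lemma wtM x y : wt (gm x y) <= wt x * wt y. Proof. by case: (walg_weight X). Qed.
Lemma wt1 : wt (ge : X) = 1. Proof. by case: (walg_weight X). Qed.
Lemma measurable_wt : measurable_fun setT (@wt R p X : Borel X -> R).
Proof. exact: continuous_BorelR wt_cont. Qed.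

Definition borel E := measurable (E : set (Borel X)).
(** Relatively compact Borel sets, the test sets of the whole proof: Haar measure and the weight are
    bounded on them, so their indicators lie in the weighted [Lp]. *)
Definition bB E := borel E /\ exists2 K, compact K & E `<=` K.

Lemma compact_borel K : compact K -> borel K.
Proof. exact: compact_Borel hausX. Qed.
Lemma open_borel U : open U -> borel U. Proof. exact: open_Borel. Qed.

Lemma compact_bB K : compact K -> bB K.
Proof. by move=> cK; split; [exact: compact_borel | exists K]. Qed.

Lemma bB_sub E F : bB F -> borel E -> E `<=` F -> bB E.
Proof. by move=> [_ [K cK FK]] mE EF; split => //; exists K => //; exact: subset_trans FK. Qed.

Lemma bB0 : bB set0. Proof. exact: compact_bB compact0. Qed.

Lemma bBU E F : bB E -> bB F -> bB (E `|` F).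
Proof.
move=> [mE [K cK EK]] [mF [L cL FL]]; split; first exact: measurableU.
by exists (K `|` L); [exact: compactU | exact: setUSS].
Qed.

Lemma bBI E F : bB E -> borel F -> bB (E `&` F).
Proof. by move=> bE mF; apply: (bB_sub bE) => //; apply: measurableI => //; exact: bE.1. Qed.

Lemma bBD E F : bB E -> borel F -> bB (E `\` F).
Proof. by move=> bE mF; apply: (bB_sub bE) => //; apply: measurableD => //; exact: bE.1. Qed.

Lemma bB_nbhs x V : nbhs x V -> exists U, [/\ open U, U x, U `<=` V & bB U].
Proof.
move=> Vx; case: (walg_group X) => _ [_ _ _ lcX].
have [W + [cW _]] := lcX x I; rewrite withinET => Wx.
have : nbhs x (V `&` W) by exact: filterI.
rewrite nbhsE => -[U [oU Ux] UVW].
exists U; split => //; first by move=> y /UVW[].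
by split; [exact: open_borel | exists W => // y /UVW[]].
Qed.

Lemma hausdorff_sep x y : x <> y ->
  exists A B, [/\ open A, open B, A x, B y & forall z, A z -> B z -> False].
Proof.
move=> /eqP xy; have := hausX; rewrite open_hausdorff => /(_ x y xy)[[A B] /= [xA yB]].
move=> [oA oB /eqP AB]; rewrite !inE in xA yB; exists A, B; split => // z Az Bz.
by suff : (A `&` B) z by rewrite AB.
Qed.

(** Local compactness provides one compact neighbourhood [K] of [x], possibly not inside [V]. The
    compact set of points of [K] outside [W] is separated from [x] by disjoint open sets [A] and
    [B]; removing [A] from [K] leaves a compact set inside [V], still a neighbourhood of [x]. *)
Lemma compact_nbhs x V : nbhs x V ->
  exists U D, [/\ open U, U x, U `<=` D, compact D & D `<=` V].
Proof.
rewrite nbhsE => -[W [oW Wx] WV].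
have [U [oU Ux _ [_ [K cK UK]]]] := bB_nbhs (@filterT _ (nbhs x) _).
have sub (S : set X) : open S -> compact (K `\` S).
  move=> oS; have cl : closed (K `&` ~` S).
    by apply: closedI; [exact: compact_closed hausX cK | exact: open_closedC].
  by apply: subclosed_compact cl cK _; exact: subIsetl.
pose P S := exists A B : set X,
  [/\ open A, open B, S `<=` A, B x & forall z, A z -> B z -> False].
have [A [B [oA oB KA Bx AB]]] : P (K `\` W).
  apply: compact_local_ind (sub _ oW) _ _ _ _.
  - by exists set0, setT; split => //; [exact: open0 | exact: openT].
  - move=> S T ST [A [B [oA oB TA Bx AB]]]; exists A, B; split => //.
    exact: subset_trans TA.
  - move=> S T [A [B [oA oB SA Bx AB]]] [A' [B' [oA' oB' SA' Bx' AB']]].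
    exists (A `|` A'), (B `&` B'); split => //.
    + exact: openU.
    + exact: openI.
    + exact: setUSS.
    + by move=> z [Az|Az] [Bz Bz']; [exact: (AB z) | exact: (AB' z)].
  - move=> y [Ky Wy].
    have yx : y <> x by move=> yx; apply: Wy; rewrite yx.
    have [A [B [oA oB Ay Bx AB]]] := hausdorff_sep yx.
    by exists A; [apply: open_nbhs_nbhs | exists A, B; split].
exists (U `&` B), (K `\` A); split => //; [exact: openI| | exact: sub |].
- by move=> z [Uz Bz]; split; [exact: UK | move=> Az; exact: (AB z)].
- by move=> z [Kz Az]; apply: WV; apply: contrapT => Wz; apply/Az/KA.
Qed.

Lemma borel_comp (Y : walg p) (u : Y -> X) E : continuous u -> borel E ->
  measurable (u @^-1` E : set (Borel Y)).
Proof.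
by move=> /continuous_Borel mu mE; rewrite -[X in measurable X]setTI; exact: mu.
Qed.

Definition shift x E : set X := [set gm x y | y in E].

Lemma shiftE x E : shift x E = gm (gi x) @^-1` E.
Proof.
apply/seteqP; split => [_ [y Ey <-]|y /= Ey]; first by rewrite /= gmK.
by exists (gm (gi x) y) => //; rewrite gmVK.
Qed.

Lemma borel_shift x E : borel E -> borel (shift x E).
Proof.
move=> mE; rewrite shiftE; apply: (borel_comp (Y := X)) => //.
by apply: cont_gm2; [exact: cont_cst|exact: cont_id].
Qed.

Lemma open_shift x E : open E -> open (shift x E).
Proof.
move=> oE; rewrite shiftE; apply: open_comp => // y _.
by apply: cont_gm2; [exact: cont_cst|exact: cont_id].
Qed.

Lemma compact_shift x K : compact K -> compact (shift x K).
Proof.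
move=> cK; apply: continuous_compact => //; apply: continuous_subspaceT => y.
by apply: cont_gm2; [exact: cont_cst|exact: cont_id].
Qed.

Lemma bB_shift x E : bB E -> bB (shift x E).
Proof.
move=> [mE [K cK EK]]; split; first exact: borel_shift.
by exists (shift x K); [exact: compact_shift | exact: image_subset].
Qed.

Lemma lam_shift x E : borel E -> lam (shift x E) = lam E.
Proof. by case: (walg_haar X) => + _ _ _ _ => /(_ x E). Qed.

Lemma lam_compact K : compact K -> (lam K < +oo)%E.
Proof. by case: (walg_haar X) => _ + _ _ _; exact. Qed.

Lemma lam_open U : open U -> U !=set0 -> (0 < lam U)%E.
Proof. by case: (walg_haar X) => _ _ + _ _; exact. Qed.

Lemma lam_bB E : bB E -> (lam E < +oo)%E.
Proof.
move=> [mE [K cK EK]]; apply: le_lt_trans (lam_compact cK).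
by apply: le_measure => //; rewrite inE //; exact: compact_borel.
Qed.

(** [fine] sends an infinite measure to 0, so the value is meaningful only where [rlE] applies. *)
Definition rl E : R := fine (lam E).

Lemma rlE E : bB E -> lam E = (rl E)%:E.
Proof. by move=> bE; rewrite fineK // ge0_fin_numE // lam_bB. Qed.

Lemma rl_ge0 E : 0 <= rl E. Proof. exact: fine_ge0. Qed.

Lemma lam_outer E (e : R) : borel E -> (lam E < +oo)%E -> 0 < e ->
  exists U, [/\ open U, E `<=` U & (lam (U `\` E) <= e%:E)%E].
Proof.
move=> mE fE e0; case: (walg_haar X) => _ _ _ /(_ E mE) lE _.
have fE' : lam E \is a fin_num by rewrite ge0_fin_numE.
have := @lb_ereal_inf_adherent _ [set lam U | U in [set U | open U /\ E `<=` U]] e e0.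
rewrite -lE => /(_ fE')[_ [U [oU EU] <-] lU]; exists U; split => //.
have mU : borel U by exact: open_borel.
rewrite measureD //; last by rewrite (lt_le_trans lU) // leey.
rewrite setIidr // leeBlDr // addeC; exact: ltW.
Qed.

(** The Haar axioms give inner regularity on open sets only. Choose an open [U] around [E], a
    compact [K] in [U], and an open [V] around the excess of [U] over [E], each up to [e / 3].
    Removing [V] from [K] leaves a compact subset of [E], and what it misses lies in the excess of
    [U] over [K] together with [V]. *)
Lemma lam_inner E (e : R) : borel E -> (lam E < +oo)%E -> 0 < e ->
  exists K, [/\ compact K, K `<=` E & (lam (E `\` K) <= e%:E)%E].
Proof.
move=> mE fE e0; have e3 : 0 < e / 3 by rewrite divr_gt0.
have [U [oU EU lU]] := lam_outer mE fE e3.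
have mU := open_borel oU.
have mUE : borel (U `\` E) by exact: measurableD.
have fUE : (lam (U `\` E) < +oo)%E by rewrite (le_lt_trans lU) // ltry.
have fU : (lam U < +oo)%E.
  rewrite -(setDUK EU) measureU //; first by rewrite lte_add_pinfty.
  by rewrite setDE setICA setICr setI0.
have [V [oV UEV lV]] := lam_outer mUE fUE e3.
have mV := open_borel oV.
case: (walg_haar X) => _ _ _ _ /(_ U oU) lUE.
have fU' : lam U \is a fin_num by rewrite ge0_fin_numE.
have := @ub_ereal_sup_adherent _ [set lam K | K in [set K | compact K /\ K `<=` U]] _ e3.
rewrite -lUE => /(_ fU')[_ [K [cK KU] <-] lK].
have mK := compact_borel cK.
exists (K `\` V); split.
- have cl : closed (K `&` ~` V).
    by apply: closedI; [exact: compact_closed hausX cK | exact: open_closedC].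
  by apply: subclosed_compact cl cK _; exact: subIsetl.
- by move=> y [Ky Vy]; apply: contrapT => Ey; apply/Vy/UEV; split => //; exact: KU.
have sub : E `\` (K `\` V) `<=` (U `\` K) `|` ((U `\` E) `|` (V `\` (U `\` E))).
  rewrite setDUK // => y [Ey KVy].
  have [Ky|Ky] := pselect (K y); last by left; split => //; exact: EU.
  by right; apply: contrapT => Vy; apply: KVy.
have mUK : borel (U `\` K) by exact: measurableD.
have mVE : borel (V `\` (U `\` E)) by exact: measurableD.
apply: (@le_trans _ _ (lam ((U `\` K) `|` ((U `\` E) `|` (V `\` (U `\` E)))))).
  by apply: le_measure => //; rewrite inE; [apply: measurableD => //; exact: measurableD|
    apply: measurableU => //; exact: measurableU].
apply: (@le_trans _ _ (lam (U `\` K) + (lam (U `\` E) + lam (V `\` (U `\` E))))%E).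
  apply: le_trans (measureU2 _ _ _) _ => //; first exact: measurableU.
  by rewrite leeD2l // measureU2.
apply: (@le_trans _ _ ((e / 3)%:E + ((e / 3)%:E + (e / 3)%:E))%E); last first.
  by rewrite -!EFinD lee_fin; lra.
apply: leeD; last exact: leeD.
rewrite measureD // setIidr // leeBlDr ?ge0_fin_numE //; last exact: lam_compact.
by rewrite addeC -leeBlDr // ltW.
Qed.

End OneGroup.

(** * The weighted [Lp] space of a group, with regularity in norm *)

Section LpGroup.
Variables (R : realType) (p : R) (X : walg p).
Implicit Types (x y z : X) (f g : X -> C R) (A B D E F K U V : set X).

Local Notation lam := (@lam R p X).

Let p1 : 1 <= p := walg_p X.
Let p0 : 0 < p := p_gt0 X.

Lemma aeS (P Q : X -> Prop) : (forall x, P x -> Q x) ->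
  {ae lam, forall x, P x} -> {ae lam, forall x, Q x}.
Proof. by move=> PQ; apply: negligibleS => x /= nQ /PQ. Qed.

Lemma aeT (P : X -> Prop) : (forall x, P x) -> {ae lam, forall x, P x}.
Proof. by move=> H; exists set0; split => // x /(_ (H x)). Qed.

Lemma aeI (P Q : X -> Prop) : {ae lam, forall x, P x} -> {ae lam, forall x, Q x} ->
  {ae lam, forall x, P x /\ Q x}.
Proof.
move=> P0 Q0; apply: negligibleS (negligibleU P0 Q0) => x /=.
by move=> /not_andP[?|?]; [left|right].
Qed.

Lemma aeS2 (P Q S : X -> Prop) : (forall x, P x -> Q x -> S x) ->
  {ae lam, forall x, P x} -> {ae lam, forall x, Q x} -> {ae lam, forall x, S x}.
Proof. by move=> H P0 Q0; apply: aeS (aeI P0 Q0) => x [/H]; apply. Qed.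

Lemma aeS3 (P Q S Z : X -> Prop) : (forall x, P x -> Q x -> S x -> Z x) ->
  {ae lam, forall x, P x} -> {ae lam, forall x, Q x} -> {ae lam, forall x, S x} ->
  {ae lam, forall x, Z x}.
Proof. by move=> H P0 Q0 S0; apply: aeS2 (aeI P0 Q0) S0 => x [/H] + ?; apply. Qed.

(* [NN], [LL], [mm], [ii]: the [p]-th power of the norm, membership in the weighted [Lp],
   measurability, and complex indicators on the weighted group [X]. *)
Definition NN f : \bar R := @Np _ (Borel X) R lam (@wt R p X) p f.
Definition LL f := @Lp _ (Borel X) R lam (@wt R p X) p f.
Definition mm f := @cmeas _ (Borel X) R f.
Definition ii E : X -> C R := @ind _ (Borel X) R E.

Lemma InLpE f : InLp lam wt p f <-> LL f.
Proof. by split => [[? ? ?]|[[? ?] ?]]; split => //; rewrite /NN ?NpE // -NpE. Qed.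

Let mw := @measurable_wt R p X.
Let w0 := @wt_gt0 R p X.

Lemma mm_ii E : borel E -> mm (ii E). Proof. exact: cmeas_ind. Qed.
Lemma iiT E x : E x -> ii E x = 1. Proof. exact: indT. Qed.
Lemma iiF E x : ~ E x -> ii E x = 0. Proof. exact: indF. Qed.
Lemma cabs_ii E x : cabs (ii E x) = \1_E x. Proof. exact: cabs_ind. Qed.
Lemma ii_split E F x : ii E x = ii (E `&` F) x + ii (E `\` F) x.
Proof. exact: ind_split. Qed.
Lemma mm_cst (a : C R) : mm (fun=> a). Proof. exact: cmeas_cst. Qed.
Lemma mmD f g : mm f -> mm g -> mm (fun x => f x + g x).
Proof. exact: cmeasD. Qed.
Lemma mmB f g : mm f -> mm g -> mm (fun x => f x - g x).
Proof. exact: cmeasB. Qed.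
Lemma mmM f g : mm f -> mm g -> mm (fun x => f x * g x).
Proof. exact: cmeasM. Qed.
Lemma mmZ (a : C R) f : mm f -> mm (fun x => a * f x).
Proof. by move=> mf; apply: mmM => //; exact: mm_cst. Qed.
Lemma mm_indM E f : borel E -> mm f -> mm (fun x => ii E x * f x).
Proof. by move=> mE mf; apply: mmM => //; exact: mm_ii. Qed.

Lemma NN_ge0 f : (0 <= NN f)%E. Proof. exact: Np_ge0. Qed.
Lemma le_NN f g : mm f -> mm g ->
  {ae lam, forall x, cabs (f x) <= cabs (g x)} -> (NN f <= NN g)%E.
Proof. exact: le_Np. Qed.
Lemma le_NNW f g : mm f -> mm g ->
  (forall x, cabs (f x) <= cabs (g x)) -> (NN f <= NN g)%E.
Proof. by move=> mf mg fg; apply: le_NN => //; exact: aeT. Qed.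
Lemma eq_NN f g : mm f -> mm g -> {ae lam, forall x, f x = g x} -> NN f = NN g.
Proof. by move=> mf mg fg; apply: eq_Np => //; apply: aeS fg => x ->. Qed.
Lemma NND_le f g (a b : R) : mm f -> mm g ->
  (NN f <= a%:E)%E -> (NN g <= b%:E)%E ->
  (NN (fun x => f x + g x)%R <= (2 `^ p * (a + b))%:E)%E.
Proof. exact: NpD_le. Qed.
Lemma NNZ (a : C R) f : mm f -> NN (fun x => a * f x)%R = ((cabs a `^ p)%:E * NN f)%E.
Proof. exact: NpZ. Qed.
Lemma NNC f g : NN (fun x => f x - g x) = NN (fun x => g x - f x).
Proof. exact: NpC. Qed.
Lemma NN_small0 f : mm f -> (forall e : R, 0 < e -> (NN f <= e%:E)%E) ->
  {ae lam, forall x, f x = 0}.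
Proof. exact: Np_small0. Qed.
Lemma NN_small0_on D f : borel D -> mm f ->
  (forall e : R, 0 < e -> (NN (fun x => ii D x * f x)%R <= e%:E)%E) ->
  {ae lam, forall x, D x -> f x = 0}.
Proof. exact: Np_small0_on. Qed.
Lemma ae0_NN f : mm f -> {ae lam, forall x, f x = 0} -> NN f = 0%E.
Proof. exact: ae0_Np. Qed.
Lemma NN_convex (t : R) f g (M : \bar R) : mm f -> mm g -> 0 <= t <= 1 ->
  (NN f <= M)%E -> (NN g <= M)%E ->
  (NN (fun x => rc t * f x + rc (1 - t) * g x)%R <= M)%E.
Proof. exact: Np_convex. Qed.
Lemma le_NN_indM E f : borel E -> mm f -> (NN (fun x => ii E x * f x)%R <= NN f)%E.
Proof. exact: le_Np_indM. Qed.

Lemma LLD f g : LL f -> LL g -> LL (fun x => f x + g x). Proof. exact: LpD. Qed.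
Lemma LLB f g : LL f -> LL g -> LL (fun x => f x - g x). Proof. exact: LpB. Qed.
Lemma LLZ (a : C R) f : LL f -> LL (fun x => a * f x). Proof. exact: LpZ. Qed.
Lemma LL0 : LL (fun=> 0). Proof. exact: Lp0. Qed.
Lemma LL_le f g : mm f -> LL g -> {ae lam, forall x, cabs (f x) <= cabs (g x)} -> LL f.
Proof. exact: Lp_le. Qed.
Lemma LL_indM E f : borel E -> LL f -> LL (fun x => ii E x * f x).
Proof. exact: Lp_indM. Qed.
Lemma LL_fin f : LL f -> exists2 a : R, 0 <= a & NN f = a%:E.
Proof. exact: Lp_fin. Qed.
Lemma LL_mm f : LL f -> mm f. Proof. by case. Qed.

Lemma wt_bounded K : compact K -> exists2 M : R, 0 < M & forall x, K x -> wt x <= M.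
Proof.
move=> cK; pose P S := exists2 M : R, 0 < M & forall x : X, S x -> wt x <= M.
apply: (@compact_local_ind _ P) => //; first by exists 1.
- by move=> A B AB [M M0 H]; exists M => // x /AB/H.
- move=> A B [M M0 H] [M' M0' H']; exists (M + M'); first exact: addr_gt0.
  move=> x [/H|/H'] /le_trans; apply; first by rewrite lerDl ltW.
  by rewrite lerDr ltW.
- move=> x _; exists (wt @^-1` [set r | r < wt x + 1]).
    apply: wt_cont; apply: open_nbhs_nbhs; split; first exact: open_lt.
    by rewrite /= ltrDl.
  by exists (wt x + 1); [rewrite addr_gt0 ?wt_gt0 | move=> y /ltW].
Qed.

Lemma Np_ind_le E (M : R) : borel E -> (forall x, E x -> wt x <= M) ->
  (NN (ii E) <= (M `^ p)%:E * lam E)%E.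
Proof.
move=> mE EM; rewrite /NN Np_ind // -integral_cst //.
apply: ge0_le_integral => //.
- by move=> x _; rewrite lee_fin powR_ge0.
- apply/measurable_EFinP/measurable_funTS.
  by apply: (measurableT_comp (measurable_powR p)); exact: measurable_wt.
- by move=> x Ex; rewrite lee_fin le_powR ?wt_ge0 // EM.
Qed.

Lemma markov_Np E f (c : R) : borel E -> mm f -> 0 <= c ->
  (forall x, E x -> c <= cabs (f x) * wt x) -> ((c `^ p)%:E * lam E <= NN f)%E.
Proof.
move=> mE mf c0 Ec; rewrite /NN NpE -integral_cst //.
apply: (@le_trans _ _ (\int[lam]_(x in E) ((cabs (f x) * wt x) `^ p)%:E)%E).
  apply: ge0_le_integral => //.
  - by move=> x _; rewrite lee_fin powR_ge0.
  - by apply: measurable_funTS; apply: measurable_Np => //; exact: measurable_wt.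
  - by move=> x Ex; rewrite lee_fin le_powR // Ec.
apply: ge0_subset_integral => //; first by apply: measurable_Np => //; exact: measurable_wt.
by move=> x _; rewrite lee_fin powR_ge0.
Qed.

Lemma LL_ind E : bB E -> LL (ii E).
Proof.
move=> [mE [K cK EK]]; split; first exact: cmeas_ind.
have [M M0 KM] := wt_bounded cK.
apply: le_lt_trans (Np_ind_le mE (fun x Ex => KM x (EK x Ex))) _.
apply: lte_mul_pinfty => //; first by rewrite lee_fin powR_ge0.
by apply: lam_bB; split => //; exists K.
Qed.

Lemma Np_inner_bB E (e : R) : bB E -> 0 < e ->
  exists K, [/\ compact K, K `<=` E & (NN (ii (E `\` K)) <= e%:E)%E].
Proof.
move=> bE e0; have [mE [K0 cK0 EK0]] := bE; have [M M0 KM] := wt_bounded cK0.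
have e0' : 0 < e / M `^ p by rewrite divr_gt0 ?powR_gt0.
have [K [cK KE lK]] := lam_inner mE (lam_bB bE) e0'.
exists K; split => //; have mK := compact_borel cK.
apply: le_trans (Np_ind_le _ (M := M) _) _; first exact: measurableD.
  by move=> x [Ex _]; apply/KM/EK0.
apply: (@le_trans _ _ ((M `^ p)%:E * (e / M `^ p)%:E)%E).
  by apply: lee_wpmul2l lK; rewrite lee_fin powR_ge0.
by rewrite -EFinM lee_fin mulrC divfK // gt_eqF // powR_gt0.
Qed.

(** Outer regularity makes the excess small in measure; cutting down to a relatively compact open
    [V] around [K] bounds the weight, which makes it small in norm. *)
Lemma Np_outer K (e : R) : compact K -> 0 < e ->
  exists U, [/\ open U, K `<=` U, bB U & (NN (ii (U `\` K)) <= e%:E)%E].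
Proof.
move=> cK e0.
have [V [oV KV bV]] : exists V, [/\ open V, K `<=` V & bB V].
  pose P S := exists V, [/\ open V, S `<=` V & bB V].
  apply: (@compact_local_ind _ P) => //.
  - by exists set0; split => //; [exact: open0 | exact: bB0].
  - by move=> A B AB [V [oV BV bV]]; exists V; split => //; exact: subset_trans BV.
  - move=> A B [V [oV BV bV]] [V' [oV' BV' bV']]; exists (V `|` V'); split.
    + exact: openU.
    + exact: setUSS.
    + exact: bBU.
  - move=> x _; have [U [oU Ux _ bU]] := bB_nbhs (@filterT _ (nbhs x) _).
    by exists U; [apply: open_nbhs_nbhs | exists U; split].
have [mV [L cL VL]] := bV; have [M M0 LM] := wt_bounded cL.
have e0' : 0 < e / M `^ p by rewrite divr_gt0 ?powR_gt0.
have mK := compact_borel cK.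
have [U [oU KU lU]] := lam_outer mK (lam_compact cK) e0'.
have mU := open_borel oU.
exists (U `&` V); split.
- exact: openI.
- by move=> x Kx; split; [exact: KU | exact: KV].
- by rewrite setIC; apply: bBI.
have mUVK : borel (U `&` V `\` K) by apply: measurableD => //; exact: measurableI.
apply: le_trans (Np_ind_le mUVK (M := M) _) _.
  by move=> x [[Ux Vx] _]; apply/LM/VL.
apply: (@le_trans _ _ ((M `^ p)%:E * (e / M `^ p)%:E)%E).
  apply: lee_wpmul2l; first by rewrite lee_fin powR_ge0.
  apply: le_trans lU; apply: le_measure; rewrite ?inE //; first exact: measurableD.
  by move=> x [[]].
by rewrite -EFinM lee_fin mulrC divfK // gt_eqF // powR_gt0.
Qed.

(* A function in Lp vanishes off a sigma-finite set, so inner regularity applies. *)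
Lemma locally_ae0 f D : LL f -> borel D ->
  (forall K, compact K -> K `<=` D -> {ae lam, forall x, K x -> f x = 0}) ->
  {ae lam, forall x, D x -> f x = 0}.
Proof.
move=> Lf mD H; have [mf Nf] := Lf.
have mfw : measurable_fun setT (fun x : Borel X => cabs (f x) * wt x).
  by apply: measurable_funM; [exact: measurable_cabs | exact: measurable_wt].
pose F n := D `&` [set x | n.+1%:R^-1 <= cabs (f x) * wt x].
have mF n : borel (F n).
  apply: measurableI => //.
  have -> : [set x | n.+1%:R^-1 <= cabs (f x) * wt x] =
     [set: Borel X] `&` (fun x => cabs (f x) * wt x) @^-1` `[n.+1%:R^-1, +oo[%classic.
    by rewrite setTI; apply/seteqP; split => x /=; rewrite in_itv /= andbT.
  exact: mfw.
have F0 n : lam (F n) = 0%E.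
  have n0 : 0 <= n.+1%:R^-1 :> R by rewrite invr_ge0.
  have n0' : 0 < n.+1%:R^-1 `^ p :> R by rewrite powR_gt0 // invr_gt0.
  have fF : (lam (F n) < +oo)%E.
    rewrite ltey; apply/eqP => FF.
    have := @markov_Np (F n) f _ (mF n) mf n0 (fun x Fx => Fx.2).
    by rewrite FF gt0_muley ?lte_fin // leye_eq => /eqP NF; rewrite -/(NN f) NF in Nf.
  apply/eqP; rewrite eq_le measure_ge0 andbT; apply/lee_addgt0Pr => e e0.
  rewrite add0e; have [K [cK KF lK]] := lam_inner (mF n) fF e0.
  have mK := compact_borel cK.
  have mFK : borel (F n `\` K) by apply: measurableD => //; exact: mF.
  have -> : lam (F n) = (lam K + lam (F n `\` K))%E.
    by rewrite -measureU ?setDUK // setDE setICA setICr setI0.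
  suff -> : lam K = 0%E by rewrite add0e.
  apply/(negligibleP _ mK).
  have [N [mN N0 sN]] := H K cK (subset_trans KF (@subIsetl _ _ _)).
  exists N; split => //; apply: subset_trans sN => x Kx /(_ Kx) fx0.
  have := (KF _ Kx).2; rewrite /= fx0 cabs0 mul0r.
  by rewrite leNgt invr_gt0 ltr0n.
have : lam.-negligible (\bigcup_n F n).
  by apply: negligible_bigcup => n; apply/(negligibleP _ (mF n))/F0.
apply: negligibleS => x /= /not_implyP[Dx fx].
have fx0 : 0 < cabs (f x) * wt x by rewrite mulr_gt0 ?wt_gt0 // cabs_gt0; apply/eqP.
have [n nP] := @ltr_add_invr R 0 _ fx0.
by exists n => //; split => //=; rewrite -[leLHS]add0r ltW.
Qed.

End LpGroup.

(** * Induction from indicators of compact sets to all of [Lp] *)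

Section LpDensity.
Variables (R : realType) (p : R) (X : walg p).
Implicit Types (x y z : X) (f g : X -> C R) (u v : X -> R) (A B D E F K U V : set X).

Local Notation lam := (@lam R p X).
Let p1 : 1 <= p := walg_p X.
Let p0 : 0 < p := p_gt0 X.

Definition good u := (forall x, 0 <= u x) /\ LL (fun x => rc (u x)).

Section PositiveCone.
Variable P : (X -> R) -> Prop.
Hypothesis PK : forall K, compact K -> P (\1_K).
Hypothesis PD : forall u v, good u -> good v -> P u -> P v -> P (fun x => u x + v x).
Hypothesis PZ : forall (a : R) u, 0 <= a -> good u -> P u -> P (fun x => a * u x).
Hypothesis Plim : forall u, good u -> (forall e : R, 0 < e ->
  exists v, [/\ good v, P v & (NN (fun x => rc (u x) - rc (v x))%R <= e%:E)%E]) -> P u.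

Lemma good_ind E : LL (ii E) -> good (\1_E).
Proof. by []. Qed.

Lemma goodD u v : good u -> good v -> good (fun x => u x + v x).
Proof.
move=> [u0 Lu] [v0 Lv]; split; first by move=> x; exact: addr_ge0.
by under eq_fun do rewrite rcD; exact: LLD.
Qed.

Lemma goodZ (a : R) u : 0 <= a -> good u -> good (fun x => a * u x).
Proof.
move=> a0 [u0 Lu]; split; first by move=> x; exact: mulr_ge0.
by under eq_fun do rewrite rcM; exact: LLZ.
Qed.

Let good0 : good (fun=> 0). Proof. by split => //; exact: LL0. Qed.

Let P0 : P (fun=> 0).
Proof.
have -> : (fun=> 0 : R) = (fun x => 0 * (\1_(set0 : set X) x : R)).
  by apply/funext => x; rewrite mul0r.
apply: PZ => //; last exact: PK compact0.
by apply: good_ind; apply: LL_ind; exact: bB0.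
Qed.

(** Level sets of an [Lp] function need not be relatively compact; finite measure and a bounded
    weight suffice for inner regularity to give compact subsets that are close in norm. *)
Let PE E (M : R) : borel E -> (lam E < +oo)%E -> 0 < M -> (forall x, E x -> wt x <= M) ->
  good (\1_E) /\ P (\1_E).
Proof.
move=> mE fE M0 EM.
have gE : good (\1_E).
  apply: good_ind; split; first exact: cmeas_ind.
  apply: le_lt_trans (Np_ind_le mE EM) _; apply: lte_mul_pinfty => //.
  by rewrite lee_fin powR_ge0.
split => //; apply: Plim => // e e0.
have e0' : 0 < e / M `^ p by rewrite divr_gt0 ?powR_gt0.
have [K [cK KE lK]] := lam_inner mE fE e0'.
exists (\1_K); split; [by apply/good_ind/LL_ind/compact_bB|exact: PK|].
have mK := compact_borel cK.
have mEK : borel (E `\` K) by exact: measurableD.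
have -> : (fun x => rc (\1_E x) - rc (\1_K x) : C R) = ii (E `\` K).
  apply/funext => x; change (ii E x - ii K x = ii (E `\` K) x).
  by rewrite (ii_split E K) (setIidr KE) addrC addKr.
apply: le_trans (Np_ind_le mEK (M := M) _) _; first by move=> x [Ex _]; exact: EM.
apply: (@le_trans _ _ ((M `^ p)%:E * (e / M `^ p)%:E)%E).
  by apply: lee_wpmul2l lK; rewrite lee_fin powR_ge0.
by rewrite -EFinM lee_fin mulrC divfK // gt_eqF // powR_gt0.
Qed.

Let Psum n (a : nat -> R) (F : nat -> set X) : (forall k, 0 <= a k) ->
  (forall k, a k = 0 \/ good (\1_(F k)) /\ P (\1_(F k))) ->
  let v := fun x => \sum_(k < n) a k * \1_(F k) x in good v /\ P v.
Proof.
move=> a0 H; elim: n => [|n [gn Pn]] /=.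
  suff -> : (fun x => \sum_(k < 0) a k * \1_(F k) x) = (fun=> 0) by [].
  by apply/funext => x; rewrite big_ord0.
have [gF PF] : good (fun x => a n * \1_(F n) x) /\ P (fun x => a n * \1_(F n) x).
  have [an0|[gF PF]] := H n; last by split; [exact: goodZ | exact: PZ].
  suff -> : (fun x => a n * \1_(F n) x) = (fun=> 0) by [].
  by apply/funext => x; rewrite an0 mul0r.
suff -> : (fun x => \sum_(k < n.+1) a k * \1_(F k) x) =
    (fun x => \sum_(k < n) a k * \1_(F k) x + a n * \1_(F n) x).
  by split; [exact: goodD | exact: PD].
by apply/funext => x; rewrite big_ord_recr.
Qed.

(** Dyadic approximations of [u] are cut to the set [S n] where the weight lies between [n.+1%:R^-1]
    and [n.+1%:R]. The lower bound makes the level sets of finite measure by Markov's inequality,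
    the upper bound lets [PE] handle them; dominated convergence removes the cut. *)
Lemma LL_ind_pos u : good u -> P u.
Proof.
move=> gu; have [u0 [mu Nu]] := gu.
have mu' : measurable_fun setT (u : Borel X -> R) by exact: mu.1.
have mw := @measurable_wt R p X.
pose a n x : R := approx [set: Borel X] (EFin \o u) n x.
pose S n : set X := [set x | n.+1%:R^-1 <= wt x <= n.+1%:R].
have mS n : borel (S n).
  have -> : S n = [set: Borel X] `&` wt @^-1` `[n.+1%:R^-1, n.+1%:R]%classic.
    by rewrite setTI; apply/seteqP; split => x /=; rewrite in_itv.
  exact: mw.
pose v n x : R := a n x * \1_(S n) x.
have a_ge0 n x : 0 <= a n x.
  by rewrite addr_ge0 ?sumr_ge0 // => *; rewrite ?mulr_ge0 ?invr_ge0 ?exprn_ge0.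
have a_le n x : a n x <= u x.
  by have := @le_approx _ (Borel X) R setT (EFin \o u) n x (fun y _ => u0 y) I.
have a_cvg x : a ^~ x @ \oo --> u x.
  by have := @cvg_approx _ (Borel X) R setT (EFin \o u) x (fun y _ => u0 y) I (ltry _).
have v_ge0 n x : 0 <= v n x by rewrite mulr_ge0.
have v_le n x : v n x <= u x.
  rewrite /v indicE; case: (x \in S n); rewrite ?mulr1 // mulr0; exact: u0.
have gP n : good (v n) /\ P (v n).
  (* The last index [n * 2 ^ n] stands for the set where [u] is at least [n], with coefficient [n];
     smaller indices are the dyadic levels. *)
  pose F k : set X := (if (k < n * 2 ^ n)%N then dyadic_approx [set: Borel X] (EFin \o u) n k
     else integer_approx [set: Borel X] (EFin \o u) n) `&` S n.
  pose b k : R := if (k < n * 2 ^ n)%N then k%:R * 2 ^- n else n%:R.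
  have -> : v n = fun x => \sum_(k < (n * 2 ^ n).+1) b k * \1_(F k) x.
    apply/funext => x; rewrite /v /a /approx big_ord_recr /= mulrDl; congr (_ + _).
      rewrite mulr_suml; apply: eq_bigr => k _.
      by rewrite /b /F ltn_ord indicI mulrA.
    by rewrite /b /F ltnn [in RHS]indicI mulrA.
  apply: (@Psum (n * 2 ^ n).+1).
    by move=> k; rewrite /b; case: ifP => _; rewrite ?mulr_ge0 ?invr_ge0 ?exprn_ge0.
  (* A level with coefficient 0 may have infinite measure, but it contributes nothing to the sum. *)
  move=> k; have [bk0|bk0] := eqVneq (b k) 0; [by left | right].
  have bk_gt0 : 0 < b k.
    rewrite lt_def bk0 /b; case: ifP => _ /=; last exact: ler0n.
    by rewrite mulr_ge0 // invr_ge0 exprn_ge0.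
  have Fb x : F k x -> b k <= u x /\ S n x.
    move=> [Hx Sx]; split => //; move: Hx; rewrite /b /dyadic_approx /integer_approx.
    have [kn|kn] := boolP (k < n * 2 ^ n)%N; rewrite ?kn ?(negbTE kn) => -[_] /=;
      last by rewrite lee_fin.
    by rewrite inE /= => -[r +] [<-]; rewrite in_itv /= => /andP[].
  have mF : borel (F k).
    apply: measurableI; last exact: mS.
    rewrite /dyadic_approx /integer_approx.
    have meu : measurable_fun setT (EFin \o u : Borel X -> \bar R).
      exact/measurable_EFinP.
    have [kn|kn] := boolP (k < n * 2 ^ n)%N; rewrite ?kn ?(negbTE kn) setTI.
      have -> : [set x | (EFin \o u) x \in [set r%:E | r in [set` dyadic_itv R n k]]] =
         u @^-1` [set` dyadic_itv R n k].
        apply/seteqP; split => x /=; rewrite inE /=; first by move=> [r ? [<-]].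
        by move=> ?; exists (u x).
      by rewrite -[X in measurable X]setTI; apply: mu'.
    have -> : [set x | (n%:R%:E <= (EFin \o u) x)%E] = u @^-1` `[n%:R, +oo[%classic.
      by apply/seteqP; split => x /=; rewrite in_itv /= lee_fin andbT.
    by rewrite -[X in measurable X]setTI; apply: mu'.
  apply: (@PE _ n.+1%:R) => //; last by move=> x /Fb[_ /andP[]].
  rewrite ltey; apply/eqP => FF.
  have c0 : 0 < b k * n.+1%:R^-1 by rewrite mulr_gt0 // invr_gt0.
  have := @markov_Np _ _ _ (F k) _ _ mF mu (ltW c0).
  rewrite FF gt0_muley ?lte_fin ?powR_gt0 // leye_eq => H.
  suff /H/eqP NF : forall x, F k x -> b k / n.+1%:R <= cabs (rc (u x)) * wt x.
    by rewrite -/(NN _) NF in Nu.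
  move=> x /Fb[bu /andP[Sx _]]; rewrite cabs_rc ger0_norm //.
  by apply: ler_pM => //; exact: ltW.
apply: Plim => // e e0.
suff [n Hn] : exists n, (NN (fun x => rc (u x) - rc (v n x))%R <= e%:E)%E.
  by exists (v n); have [? ?] := gP n.
pose h n x := ((cabs (rc (u x) - rc (v n x)) * wt x) `^ p)%:E.
have mh n : measurable_fun setT (h n : Borel X -> \bar R).
  apply: measurable_Np => //; apply: mmB => //.
  by have [[_ [? _]] _] := gP n.
have ig : lam.-integrable setT (fun x : Borel X => ((cabs (rc (u x)) * wt x) `^ p)%:E).
  apply/integrableP; split; first exact: measurable_Np.
  under eq_integral do rewrite gee0_abs ?lee_fin ?powR_ge0 //.
  by move: Nu; rewrite NpE.
have hcvg x : h ^~ x @ \oo --> 0%E.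
  apply: cvg_EFin; first by near=> n.
  apply/cvgrPdist_le => d d0; have [c c0 cd] := powR_small p1 1 d0; rewrite mul1r in cd.
  have c0' : 0 < c / wt x by rewrite divr_gt0 ?wt_gt0.
  have := a_cvg x => /cvgrPdist_le /(_ _ c0') Ha.
  near=> n; rewrite sub0r normrN /= ger0_norm ?powR_ge0 //.
  apply: le_trans cd; apply: le_powR => //; first by rewrite mulr_ge0 ?cabs_ge0 ?wt_ge0.
  rewrite -ler_pdivlMr ?wt_gt0 // -rcN -rcD cabs_rc.
  rewrite /v indicE mem_set ?mulr1; first by near: n.
  have wx := @wt_gt0 R p X x.
  apply/andP; split.
    rewrite invf_ple ?posrE //; apply: (@le_trans _ _ n%:R); last by rewrite ler_nat.
    by near: n; exact: nbhs_infty_ger.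
  apply: (@le_trans _ _ n%:R); last by rewrite ler_nat.
  by near: n; exact: nbhs_infty_ger.
have mc : measurable_fun setT (cst 0%E : Borel X -> \bar R) by exact: measurable_cst.
have hae : {ae lam, forall x : Borel X, setT x -> h ^~ x @ \oo --> cst 0%E x}.
  by apply: aeT => x _; exact: hcvg.
have [] := @dominated_convergence _ (Borel X) R lam setT measurableT h (cst 0%E) _ mh
  mc hae ig.
  apply: aeT => x n _; rewrite gee0_abs ?lee_fin ?powR_ge0 //.
  apply: le_powR => //; first by rewrite mulr_ge0 ?cabs_ge0 ?wt_ge0.
  rewrite ler_wpM2r ?wt_ge0 // -rcN -rcD !cabs_rc !ger0_norm ?subr_ge0 //.
  by rewrite lerBlDr lerDl.
move=> _ _; rewrite integral0 => H0.
have /fine_cvgP[Hf] := H0 => /cvgrPdist_le /(_ _ e0) [n0 _ Hn0].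
have [n1 _ Hf1] := Hf.
exists (maxn n0 n1); rewrite /NN NpE.
have := Hn0 (maxn n0 n1) (leq_maxl _ _); rewrite /= sub0r normrN => H1.
have H2 := Hf1 (maxn n0 n1) (leq_maxr _ _).
change ([sequence (\int[lam]_(x in [set: Borel X]) h n x)%E]_n (maxn n0 n1) <= e%:E)%E.
by rewrite -(fineK H2) lee_fin (le_trans (ler_norm _)).
Unshelve. all: by end_near. Qed.

End PositiveCone.

Section Complex.
Variable P : (X -> C R) -> Prop.
Hypothesis PK : forall K, compact K -> P (ii K).
Hypothesis PD : forall f g, LL f -> LL g -> P f -> P g -> P (fun x => f x + g x).
Hypothesis PZ : forall (a : C R) f, LL f -> P f -> P (fun x => a * f x).
Hypothesis Plim : forall f, LL f -> (forall e : R, 0 < e ->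
  exists g, [/\ LL g, P g & (NN (fun x => f x - g x)%R <= e%:E)%E]) -> P f.

(** The real and imaginary parts are split into positive and negative parts; each is dominated by
    the modulus of [f], hence stays in the space, and [LL_ind_pos] applies. *)
Lemma LL_induct f : LL f -> P f.
Proof.
move=> Lf; have [[mr mi] _] := Lf.
have pos u : good u -> P (fun x => rc (u x)).
  apply: (LL_ind_pos (P := fun u => P (fun x => rc (u x)))) => //.
  - by move=> v w [_ Lv] [_ Lw] Pv Pw; under eq_fun do rewrite rcD; exact: PD.
  - by move=> a v a0 [_ Lv] Pv; under eq_fun do rewrite rcM; exact: PZ.
  - move=> v [_ Lv] H; apply: Plim => // e /H[v' [[_ Lv'] Pv' N]].
    by exists (fun x => rc (v' x)).
have part (h : X -> R) : measurable_fun setT (h : Borel X -> R) ->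
    (forall x, `|h x| <= cabs (f x)) ->
    P (fun x => rc (h x)) /\ LL (fun x => rc (h x)).
  move=> mh hf.
  have gmax (s : R) : `|s| = 1 -> good (fun x => Num.max (s * h x) 0).
    move=> s1; split; first by move=> x; rewrite le_max lexx orbT.
    apply: LL_le (Lf) _.
      apply: cmeas_rc; apply: measurable_maxr => //; exact: measurable_funM.
    apply: aeT => x; rewrite cabs_rc; apply: le_trans (hf x).
    rewrite ger0_norm ?le_max ?lexx ?orbT // ge_max normr_ge0 andbT.
    by rewrite (le_trans (ler_norm _)) // normrM s1 mul1r.
  have g1 := gmax 1 (normr1 _).
  have g2 := gmax (-1) (normrN1 _).
  have -> : (fun x => rc (h x)) = (fun x => rc (Num.max (1 * h x) 0) +
      (-1) * rc (Num.max (-1 * h x) 0)).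
    apply/funext => x; rewrite mulN1r -rcN -rcD; congr rc.
    by rewrite mul1r mulN1r; case: (ltP (h x) 0) => h0; case: (ltP (- h x) 0) => h1; lra.
  split; last by apply: LLD; [exact: g1.2 | apply: LLZ; exact: g2.2].
  apply: PD; [exact: g1.2 | by apply: LLZ; exact: g2.2 | exact: pos |].
  by apply: PZ; [exact: g2.2 | exact: pos].
have [Pr Lr] := part _ mr (fun x => cabs_Re _).
have [Pi Li] := part _ mi (fun x => cabs_Im _).
have -> : f = fun x => rc (cRe (f x)) + complex.Complex 0 1 * rc (cIm (f x)).
  apply/funext => x; apply: complex_eq; rewrite ?cReD ?cImD ?cReM ?cImM /=;
  by rewrite !(mul0r, mulr0, mul1r, addr0, add0r, subr0).
by apply: PD => //; [exact: LLZ | exact: PZ].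
Qed.

End Complex.

End LpDensity.

(** * Translations, complex integrals and convolution *)

Section Translation.
Variables (R : realType) (p : R) (X : walg p).
Implicit Types (x y z : X) (f g h k : X -> C R) (u v : X -> R) (A B D E F K U V : set X).

Local Notation lam := (@lam R p X).
Let p1 : 1 <= p := walg_p X.
Let p0 : 0 < p := p_gt0 X.

Definition tr x f : X -> C R := fun z => f (gm (gi x) z).

Lemma cont_gml x : continuous (gm x).
Proof. by apply: cont_gm2; [exact: cont_cst | exact: cont_id]. Qed.

Lemma cont_div z : continuous (fun y => gm (gi y) z).
Proof. by apply: cont_gm2; [apply: cont_gi; exact: cont_id | exact: cont_cst]. Qed.

Lemma mm_comp (s : X -> X) f : continuous s -> mm f -> mm (fun x => f (s x)).
Proof.
move=> /continuous_Borel ms [mr mi]; split.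
  exact: (measurableT_comp mr ms).
exact: (measurableT_comp mi ms).
Qed.

Lemma mm_tr x f : mm f -> mm (tr x f).
Proof. exact/mm_comp/cont_gml. Qed.

Lemma measurable_shift x : measurable_fun setT (gm x : Borel X -> Borel X).
Proof. by apply: continuous_Borel; exact: cont_gml. Qed.

Lemma ge0_integral_shift x (F : X -> \bar R) :
  measurable_fun setT (F : Borel X -> \bar R) -> (forall y, 0 <= F y)%E ->
  (\int[lam]_(y in [set: Borel X]) F (gm x y) =
   \int[lam]_(y in [set: Borel X]) F y)%E.
Proof.
move=> mF F0.
have := @ge0_integral_pushforward _ _ (Borel X) (Borel X) R _ (measurable_shift x)
  lam setT F measurableT mF (fun y _ => F0 y).
rewrite preimage_setT => <-.
apply: eq_measure_integral => [|? A mA _]; first exact: measurable_shift.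
by have := lam_shift (gi x) mA; rewrite shiftE giK.
Qed.

Lemma integral_shift x (F : X -> \bar R) :
  measurable_fun setT (F : Borel X -> \bar R) ->
  (\int[lam]_(y in [set: Borel X]) F (gm x y) =
   \int[lam]_(y in [set: Borel X]) F y)%E.
Proof.
move=> mF; rewrite integralE [RHS]integralE; congr (_ - _)%E.
  rewrite -(ge0_integral_shift x (measurable_funepos mF) (fun y => funepos_ge0 F y)).
  by apply: eq_integral => y _; rewrite !funeposE.
rewrite -(ge0_integral_shift x (measurable_funeneg mF) (fun y => funeneg_ge0 F y)).
by apply: eq_integral => y _; rewrite !funenegE.
Qed.

Lemma ae_shift x (P : X -> Prop) : {ae lam, forall y, P y} ->
  {ae lam, forall y, P (gm x y)}.
Proof.
move=> [N [mN N0 sN]]; exists (shift (gi x) N); split.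
- exact: borel_shift.
- by rewrite lam_shift.
- by move=> y /= nP; rewrite shiftE giK; exact: sN.
Qed.

Lemma NN_tr x f : mm f -> (NN (tr x f) <= (wt x `^ p)%:E * NN f)%E.
Proof.
move=> mf; have mw := @measurable_wt R p X; have m1 := mm_tr x mf.
rewrite /NN !NpE -(@ge0_integral_shift x); last 2 first.
- exact: measurable_Np.
- by move=> y; rewrite lee_fin powR_ge0.
rewrite -ge0_integralZl_EFin ?powR_ge0 //; last 2 first.
- by move=> y _; rewrite lee_fin powR_ge0.
- exact: measurable_Np.
apply: ge0_le_integral => //.
- by move=> y _; rewrite lee_fin powR_ge0.
- have mw' : measurable_fun setT (fun y : Borel X => wt (gm x y)).
    exact: (measurableT_comp mw (@measurable_shift x)).
  have m2 := mm_comp (@cont_gml x) m1.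
  exact (@measurable_Np _ (Borel X) R _ p mw' _ m2).
- by apply: measurable_funeM; exact: measurable_Np.
move=> y _; rewrite -EFinM lee_fin -powRM ?wt_ge0 ?mulr_ge0 ?cabs_ge0 ?wt_ge0 //.
apply: le_powR => //; first by rewrite mulr_ge0 ?cabs_ge0 ?wt_ge0.
by rewrite /tr gmK mulrCA ler_wpM2l ?cabs_ge0 ?wtM.
Qed.

Lemma LL_tr x f : LL f -> LL (tr x f).
Proof.
move=> [mf Nf]; split; first exact: mm_tr.
apply: le_lt_trans (NN_tr x mf) _; apply: lte_mul_pinfty => //.
by rewrite lee_fin powR_ge0.
Qed.

Lemma trM x y f : tr x (tr y f) = tr (gm x y) f.
Proof. by apply/funext => z; rewrite /tr giM gmA. Qed.

Lemma tr_ii x E : tr x (ii E) = ii (shift x E).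
Proof.
apply/funext => z; rewrite /tr shiftE.
by have [Ez|Ez] := pselect (E (gm (gi x) z)); [rewrite !iiT | rewrite !iiF].
Qed.

Definition ci h : C R := cint lam h.
Definition absint h : \bar R := (\int[lam]_(y in [set: Borel X]) (cabs (h y))%:E)%E.

Lemma absint_ReIm h : mm h -> (absint h < +oo)%E ->
  lam.-integrable setT (fun y : Borel X => (cRe (h y))%:E) /\
  lam.-integrable setT (fun y : Borel X => (cIm (h y))%:E).
Proof.
move=> mh fh; have [mr mi] := mh.
have H (u : X -> R) : measurable_fun setT (u : Borel X -> R) ->
    (forall y, `|u y| <= cabs (h y)) -> lam.-integrable setT (fun y : Borel X => (u y)%:E).
  move=> mu uh; apply/integrableP; split; first exact/measurable_EFinP.
  apply: le_lt_trans fh; apply: ge0_le_integral => //.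
  - by apply/measurable_EFinP; apply: measurableT_comp.
  - by apply/measurable_EFinP; exact: measurable_cabs.
  - by move=> y _; rewrite /= lee_fin.
by split; apply: H => // y; [exact: cabs_Re | exact: cabs_Im].
Qed.

Lemma ci_ae h k : mm h -> mm k -> {ae lam, forall y, h y = k y} -> ci h = ci k.
Proof.
move=> [h1 h2] [k1 k2] hk; congr complex.Complex; congr fine; apply: ae_eq_integral => //;
  try (by apply/measurable_EFinP); by apply: aeS hk => y ->.
Qed.

Lemma ciD h k : mm h -> mm k -> (absint h < +oo)%E -> (absint k < +oo)%E ->
  ci (fun y => h y + k y) = ci h + ci k.
Proof.
move=> mh mk fh fk; have [h1 h2] := absint_ReIm mh fh; have [k1 k2] := absint_ReIm mk fk.
apply: complex_eq; [rewrite cReD /= -(RintegralD measurableT h1 k1) |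
  rewrite cImD /= -(RintegralD measurableT h2 k2)];
by apply: eq_Rintegral => y _; rewrite ?cReD ?cImD.
Qed.

Lemma ciZ (a : C R) h : mm h -> (absint h < +oo)%E -> ci (fun y => a * h y) = a * ci h.
Proof.
move=> mh fh; have [h1 h2] := absint_ReIm mh fh.
have Z (r : R) (u : X -> R) : lam.-integrable setT (fun y : Borel X => (u y)%:E) ->
    lam.-integrable setT (fun y : Borel X => (r * u y)%:E).
  by move=> iu; exact: (integrableZl measurableT r iu).
apply: complex_eq.
  rewrite cReM /= -(RintegralZl _ measurableT h1) -(RintegralZl _ measurableT h2).
  rewrite -(RintegralB measurableT (Z _ _ h1) (Z _ _ h2)).
  by apply: eq_Rintegral => y _; rewrite cReM.
rewrite cImM /= -(RintegralZl _ measurableT h1) -(RintegralZl _ measurableT h2).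
rewrite -(RintegralD measurableT (Z _ _ h2) (Z _ _ h1)).
by apply: eq_Rintegral => y _; rewrite cImM.
Qed.

(** The factor 2 comes from bounding the real and the imaginary part separately. *)
Lemma ci_le h : mm h -> (absint h < +oo)%E -> cabs (ci h) <= 2 * fine (absint h).
Proof.
move=> mh fh; have [h1 h2] := absint_ReIm mh fh.
have mc : measurable_fun setT (fun y : Borel X => cabs (h y)) by exact: measurable_cabs.
have ic : lam.-integrable setT (fun y : Borel X => (cabs (h y))%:E).
  apply/integrableP; split; first exact/measurable_EFinP.
  by under eq_integral do rewrite gee0_abs ?lee_fin ?cabs_ge0 //.
have H (u : X -> R) : lam.-integrable setT (fun y : Borel X => (u y)%:E) ->
    (forall y, `|u y| <= cabs (h y)) ->
    `|Rintegral lam setT (fun y : Borel X => u y)| <= fine (absint h).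
  move=> iu uh; apply: le_trans (le_normr_Rintegral _ iu) _ => //.
  by apply: le_Rintegral => //; apply: integrable_norm.
rewrite mulr2n mulrDl mul1r; apply: le_trans (cabs_le _) _.
by apply: lerD; apply: H => // y; [exact: cabs_Re | exact: cabs_Im].
Qed.

Lemma ci_shift x h : mm h -> ci (fun y => h (gm x y)) = ci h.
Proof.
move=> [h1 h2]; congr complex.Complex; congr fine.
  by apply: (@integral_shift x (fun y => (cRe (h y))%:E)); exact/measurable_EFinP.
by apply: (@integral_shift x (fun y => (cIm (h y))%:E)); exact/measurable_EFinP.
Qed.

Lemma ci_rc u : ci (fun y => rc (u y)) =
  rc (fine (\int[lam]_(y in [set: Borel X]) (u y)%:E)%E).
Proof. by congr complex.Complex; rewrite /= Rintegral_cst // mul0r. Qed.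

Lemma ci_ii E : borel E -> ci (ii E) = rc (rl E).
Proof.
move=> mE; rewrite ci_rc /rl; congr (rc (fine _)).
by rewrite integral_indic // setIT.
Qed.

Definition cv f g : X -> C R := Defs.conv lam gm gi f g.

Definition cvi f g z : X -> C R := fun y => f y * g (gm (gi y) z).

Lemma cvE f g z : cv f g z = ci (cvi f g z). Proof. by []. Qed.

Lemma mm_cvi f g z : mm f -> mm g -> mm (cvi f g z).
Proof. by move=> mf mg; apply: mmM => //; exact: mm_comp (@cont_div z) mg. Qed.

(** The algebra hypothesis raised to the power [p]; the absolute value of its constant is taken
    because no sign is prescribed for it. *)
Lemma conv_alg : exists2 M : R, 0 <= M & forall f g, LL f -> LL g ->
  [/\ {ae lam, forall z, (absint (cvi f g z) < +oo)%E}, LL (cv f g) &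
      (NN (cv f g) <= M%:E * NN f * NN g)%E].
Proof.
have [M0 HM] := walg_alg X; exists (`|M0| `^ p); first exact: powR_ge0.
move=> f g Lf Lg; have [Hae Hcv Hn] := HM f g ((InLpE f).2 Lf) ((InLpE g).2 Lg).
move/InLpE: Hcv => Lcv; split => //.
  by apply: aeS Hae => z; apply: le_lt_trans; rewrite le_eqVlt; apply/orP; left;
     apply/eqP; apply: eq_integral => y _; rewrite cabsM.
have [a a0 Ea] := LL_fin Lf; have [b b0 Eb] := LL_fin Lg; have [c c0 Ec] := LL_fin Lcv.
have nE h : normLp lam wt p h = (fine (NN h)) `^ p^-1 by rewrite /normLp /NN NpE.
move: Hn; rewrite -/(cv f g) !nE Ea Eb Ec /= => Hn.
rewrite -!EFinM lee_fin.
have H : c `^ p^-1 <= `|M0| * a `^ p^-1 * b `^ p^-1.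
  apply: le_trans Hn _; rewrite -!mulrA ler_wpM2r ?mulr_ge0 ?powR_ge0 //.
  exact: ler_norm.
have := le_powR p1 (powR_ge0 _ _) H.
by rewrite !powRM ?mulr_ge0 ?powR_ge0 // -!powRrM mulVf ?gt_eqF // !powRr1.
Qed.

Lemma LL_cv f g : LL f -> LL g -> LL (cv f g).
Proof. by have [M _ H] := conv_alg => Lf Lg; have [] := H f g Lf Lg. Qed.

Lemma ae_absint f g : LL f -> LL g -> {ae lam, forall z, (absint (cvi f g z) < +oo)%E}.
Proof. by have [M _ H] := conv_alg => Lf Lg; have [] := H f g Lf Lg. Qed.

Lemma cvDr f g h : LL f -> LL g -> LL h ->
  {ae lam, forall z, cv f (fun y => g y + h y) z = cv f g z + cv f h z}.
Proof.
move=> Lf Lg Lh; apply: aeS2 (ae_absint Lf Lg) (ae_absint Lf Lh) => z fg fh.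
rewrite !cvE -ciD //; try by apply: mm_cvi; exact: LL_mm.
by congr ci; apply/funext => y; rewrite /cvi mulrDr.
Qed.

Lemma cvZr (a : C R) f g : LL f -> LL g ->
  {ae lam, forall z, cv f (fun y => a * g y) z = a * cv f g z}.
Proof.
move=> Lf Lg; apply: aeS (ae_absint Lf Lg) => z fg.
rewrite !cvE -ciZ //; try by apply: mm_cvi; exact: LL_mm.
by congr ci; apply/funext => y; rewrite /cvi mulrCA.
Qed.

Lemma cvr_ae0 f g : LL f -> LL g -> {ae lam, forall z, g z = 0} ->
  {ae lam, forall z, cv f g z = 0}.
Proof.
move=> Lf Lg g0; have [M M0 /(_ f g Lf Lg)[_ Lc]] := conv_alg.
rewrite (ae0_NN (LL_mm Lg) g0) mule0 => Nc.
by apply: NN_small0 (LL_mm Lc) _ => e e0; apply: le_trans Nc _; rewrite lee_fin ltW.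
Qed.

(* The submultiplicativity of the norm makes the class of [cv f g] depend only on the
   class of [g]; in general this uses that inversion preserves null sets. *)
Lemma cvr_ae f g h : LL f -> LL g -> LL h -> {ae lam, forall z, g z = h z} ->
  {ae lam, forall z, cv f g z = cv f h z}.
Proof.
move=> Lf Lg Lh gh; have Ld := LLB Lg Lh.
have gh0 : {ae lam, forall z, g z - h z = 0} by apply: aeS gh => z ->; rewrite subrr.
apply: aeS2 (cvDr Lf Lh Ld) (cvr_ae0 Lf Ld gh0) => z + E0; rewrite E0 addr0 => <-.
by congr (cv f _ z); apply/funext => y; rewrite addrC subrK.
Qed.

End Translation.

(** * Pointwise majorants of convolutions with indicators *)

Section Young.
Variables (R : realType) (p : R) (X : walg p).
Implicit Types (x y z : X) (f g h : X -> C R) (u v s t : X -> R).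
Implicit Types (A B D E F K U V Wo : set X).

Local Notation lam := (@lam R p X).
Let p1 : 1 <= p := walg_p X.
Let p0 : 0 < p := p_gt0 X.

Lemma tube (Y Z : topologicalType) (K : set X) (Wo : set Z) (F : Y -> X -> Z) (y0 : Y) :
  continuous (fun q : X * Y => F q.2 q.1) -> compact K -> open Wo ->
  (forall k, K k -> Wo (F y0 k)) ->
  \forall y0' \near y0, forall k, K k -> Wo (F y0' k).
Proof.
move=> cF /compact_near_coveringP cK oO H.
have := cK Y (nbhs y0) (fun (y : Y) (k : X) => Wo (F y k)) _.
apply => k Kk; have := cF (k, y0) Wo.
by apply; apply: open_nbhs_nbhs; split => //; exact: H.
Qed.

(** The convolution of the indicator of [A] with a nonnegative [u], kept in the extended reals so
    that it can be split and compared before it is known to be finite. *)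
Definition av A u z : \bar R :=
  (\int[lam]_(y in (A : set (Borel X))) (u (gm (gi y) z))%:E)%E.

Let mdiv u z : measurable_fun setT (u : Borel X -> R) ->
  measurable_fun setT (fun y : Borel X => (u (gm (gi y) z))%:E).
Proof.
move=> mu; apply/measurable_EFinP.
apply: (measurableT_comp mu); apply: continuous_Borel; exact: cont_div.
Qed.

Lemma av_ge0 A u z : (forall y, 0 <= u y) -> (0 <= av A u z)%E.
Proof. by move=> u0; apply: integral_ge0 => y _; rewrite lee_fin. Qed.

Lemma absint_av A g z : absint (cvi (ii A) g z) = av A (fun y => cabs (g y)) z.
Proof.
rewrite /av [RHS]integral_mkcond; apply: eq_integral => y _.
rewrite cabsM cabs_ii patchE indicE; case: (y \in A); first by rewrite mul1r.
by rewrite mul0r.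
Qed.

Lemma cv_av A u z : cv (ii A) (fun y => rc (u y)) z = rc (fine (av A u z)).
Proof.
rewrite cvE; transitivity (ci (fun y : X => rc (\1_A y * u (gm (gi y) z)))).
  by congr ci; apply/funext => y; rewrite rcM.
rewrite ci_rc; congr (rc (fine _)); rewrite /av [RHS]integral_mkcond.
apply: eq_integral => y _; rewrite patchE indicE; case: (y \in A).
  by rewrite mul1r.
by rewrite mul0r.
Qed.

Lemma le_av A u v z : borel A -> measurable_fun setT (u : Borel X -> R) ->
  measurable_fun setT (v : Borel X -> R) -> (forall y, 0 <= u y) ->
  (forall y, A y -> u (gm (gi y) z) <= v (gm (gi y) z)) -> (av A u z <= av A v z)%E.
Proof.
move=> mA mu mv u0 uv; apply: ge0_le_integral => //.
- by move=> y _; rewrite lee_fin.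
- by apply: measurable_funTS; exact: mdiv.
- by apply: measurable_funTS; exact: mdiv.
Qed.

Lemma av_cst A (c : R) z : bB A -> av A (fun=> c) z = (rl A * c)%:E.
Proof. by move=> bA; rewrite /av integral_cst ?rlE -?EFinM 1?mulrC //; exact: bA.1. Qed.

Lemma av_le A u (c : R) z : bB A -> measurable_fun setT (u : Borel X -> R) ->
  (forall y, 0 <= u y) ->
  (forall y, A y -> u (gm (gi y) z) <= c) -> (av A u z <= (rl A * c)%:E)%E.
Proof.
by move=> bA mu u0 uc; rewrite -(av_cst c z bA); apply: le_av => //; exact: bA.1.
Qed.

Lemma av_split A B u z : borel A -> borel B -> measurable_fun setT (u : Borel X -> R) ->
  (forall y, 0 <= u y) -> av A u z = (av (A `&` B) u z + av (A `\` B) u z)%E.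
Proof.
move=> mA mB mu u0; rewrite /av -ge0_integral_setU //.
- by rewrite setUIDK.
- exact: measurableI.
- exact: measurableD.
- by apply: measurable_funTS; exact: mdiv.
- by move=> y _; rewrite lee_fin.
- by apply/disj_setPS => y [[_ By] [_]].
Qed.

Lemma avD A u v z : borel A -> measurable_fun setT (u : Borel X -> R) ->
  measurable_fun setT (v : Borel X -> R) ->
  (forall y, 0 <= u y) -> (forall y, 0 <= v y) ->
  av A (fun y => u y + v y) z = (av A u z + av A v z)%E.
Proof.
move=> mA mu mv u0 v0; rewrite /av -ge0_integralD //;
  try (by move=> y _; rewrite lee_fin); by apply: measurable_funTS; exact: mdiv.
Qed.

Lemma good_meas u : good u -> measurable_fun setT (u : Borel X -> R).
Proof. by move=> [_ [[]]]. Qed.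

(* On small pieces [A_i] of [A], [1_{A_i} * s] is at most [lam A_i] times a translate of [t];
   [S] is the resulting convex combination of translates. *)
Lemma majorant K0 (C0 : R) s t U : compact K0 -> 0 <= C0 -> (forall y, K0 y -> wt y <= C0) ->
  good s -> good t -> nbhs ge U ->
  (forall y z, U y -> s (gm (gi y) z) <= t z) ->
  forall A, bB A -> A `<=` K0 -> exists S : X -> R,
  [/\ mm (fun z => rc (S z)), forall z, 0 <= S z,
      (NN (fun z => rc (S z)) <= (C0 `^ p)%:E * NN (fun z => rc (t z)))%E &
      forall z, (av A s z <= (rl A * S z)%:E)%E].
Proof.
move=> cK0 C00 HC gs gt Ue st; set M := ((C0 `^ p)%:E * _)%E.
have M0 : (0 <= M)%E by rewrite mule_ge0 ?NN_ge0 // lee_fin powR_ge0.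
have [s0 _] := gs; have [t0 [mt _]] := gt; have ms := good_meas gs.
pose Q A := exists S : X -> R, [/\ mm (fun z => rc (S z)), forall z, 0 <= S z,
  (NN (fun z => rc (S z)) <= M)%E & forall z, (av A s z <= (rl A * S z)%:E)%E].
(* Splitting [A] along a union of two sets needs one of them Borel, hence the open set [Wo] around
   [W]. *)
pose P (W : set X) := exists Wo, [/\ open Wo, W `<=` Wo & forall A, bB A -> A `<=` Wo -> Q A].
suff : P K0.
  by move=> [Wo [_ K0O H]] A bA AK; apply: H => //; exact: subset_trans K0O.
apply: compact_local_ind cK0 _ _ _ _.
- exists set0; split => //; first exact: open0.
  move=> A bA; rewrite subset0 => ->; exists (fun=> 0); split => //.
  + by rewrite ae0_NN //; exact: aeT.
  + by move=> z; rewrite /av integral_set0 mulr0.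
- by move=> W W' WW' [Wo [oO WO H]]; exists Wo; split => //; exact: subset_trans WO.
- move=> W1 W2 [Wo1 [oO1 WO1 H1]] [Wo2 [oO2 WO2 H2]]; exists (Wo1 `|` Wo2); split.
  + exact: openU.
  + exact: setUSS.
  move=> A bA AO; have mO1 := open_borel oO1; have mA := bA.1.
  have bA1 := bBI bA mO1; have bA2 := bBD bA mO1.
  have [S1 [mS1 S10 NS1 HS1]] := H1 _ bA1 (@subIsetr _ _ _).
  have [|S2 [mS2 S20 NS2 HS2]] := H2 _ bA2.
    by move=> y [Ay nO1]; case: (AO _ Ay).
  have rA : rl A = rl (A `&` Wo1) + rl (A `\` Wo1).
    apply: EFin_inj; rewrite EFinD -!rlE // -measureU ?setUIDK //; [exact: bA1.1|exact: bA2.1|].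
    by apply/seteqP; split => // y [[_ ?] [_]].
  have avle z : (av A s z <= (rl (A `&` Wo1) * S1 z + rl (A `\` Wo1) * S2 z)%:E)%E.
    by rewrite (av_split _ mA mO1) // EFinD leeD.
  (* The coefficients below are proportions of [rl A]; when it is 0 both pieces are null and any
     majorant serves. *)
  have [rA0|rA0] := eqVneq (rl A) 0.
    exists S1; split => // z; apply: le_trans (avle z) _; rewrite rA0 mul0r lee_fin.
    have := rl_ge0 (A `&` Wo1); have := rl_ge0 (A `\` Wo1); rewrite rA in rA0 => h1 h2.
    have -> : rl (A `&` Wo1) = 0 by lra.
    have -> : rl (A `\` Wo1) = 0 by lra.
    by rewrite !mul0r addr0.
  pose c := rl (A `&` Wo1) / rl A.
  have rAp : 0 < rl A by rewrite lt_def rA0 rl_ge0.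
  have c01 : 0 <= c <= 1.
    rewrite divr_ge0 ?rl_ge0 //= ler_pdivrMr // mul1r rA lerDl rl_ge0 //.
  have c1 : 1 - c = rl (A `\` Wo1) / rl A.
    by rewrite /c -[X in X - _](divff rA0) -mulrBl; congr (_ / _); rewrite {1}rA addrC addKr.
  exists (fun z => c * S1 z + (1 - c) * S2 z); split.
  + by under eq_fun do rewrite rcD (rcM c) (rcM (1 - c)); apply: mmD; apply: mmZ.
  + by move=> z; rewrite addr_ge0 // mulr_ge0 //; have /andP[? ?] := c01; rewrite ?subr_ge0.
  + under eq_fun do rewrite rcD (rcM c) (rcM (1 - c)).
    exact: NN_convex.
  + move=> z; apply: le_trans (avle z) _; rewrite lee_fin c1 /c.
    by rewrite le_eqVlt; apply/orP; left; apply/eqP; field.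
- move=> y0 Ky0; have [Wo [oO Oe OU]] : exists Wo, [/\ open Wo, Wo ge & Wo `<=` U].
    by move: Ue; rewrite nbhsE => -[Wo [? ?] ?]; exists Wo.
  exists (shift y0 Wo).
    apply: open_nbhs_nbhs; split; first exact: open_shift.
    by exists ge => //; rewrite gm1.
  exists (shift y0 Wo); split => //; first exact: open_shift.
  move=> A bA AO; exists (fun z => t (gm (gi y0) z)); split => //.
  + exact: (mm_tr y0 mt).
  + apply: le_trans (NN_tr y0 mt) _; apply: lee_wpmul2r; first exact: NN_ge0.
    by rewrite lee_fin le_powR ?wt_ge0 // HC.
  + move=> z; apply: av_le => // y /AO[v Ov <-].
    by rewrite giM -gmA; apply/st/OU.
Qed.

(** A substitute for uniform continuity: [s], moved by any [y] near the unit, stays below [t], and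
    both are close to [u]. For the indicator of a compact [K], [s] is that indicator and [t] the
    indicator of an open superset of small excess; the tube lemma gives [U]. The property is stable
    under sums, multiples and limits. *)
Lemma dominated_approx u : good u -> forall e : R, 0 < e -> exists s t U,
  [/\ good s, good t, nbhs ge U, forall y z, U y -> s (gm (gi y) z) <= t z &
      (NN (fun z => rc (u z) - rc (s z))%R <= e%:E)%E /\
      (NN (fun z => rc (u z) - rc (t z))%R <= e%:E)%E].
Proof.
move: u; apply: LL_ind_pos.
- move=> K cK e e0; have [Wo [oO KO bO NO]] := Np_outer cK e0.
  have mK := compact_borel cK; have mO := open_borel oO.
  exists (\1_K), (\1_Wo), [set y | forall k, K k -> Wo (gm y k)]; split.
  + by apply/good_ind/LL_ind/compact_bB.
  + exact/good_ind/LL_ind.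
  + apply: (@tube X X K Wo gm) => //; last by move=> k; rewrite g1m; exact: KO.
    by apply: cont_gm2 => q; [exact: cvg_snd | exact: cvg_fst].
  + move=> y z yK; rewrite !indicE.
    have [/set_mem Kz|_] := boolP (gm (gi y) z \in K); last exact: ler0n.
    by rewrite mem_set //; have := yK _ Kz; rewrite gmVK.
  split.
    under eq_fun do rewrite subrr.
    by rewrite ae0_NN; [rewrite lee_fin ltW | exact: mm_cst | exact: aeT].
  rewrite NNC; apply: le_trans NO; rewrite le_eqVlt; apply/orP; left; apply/eqP.
  congr NN; apply/funext => z; change (ii Wo z - ii K z = ii (Wo `\` K) z).
  by rewrite (ii_split Wo K) (setIidr KO) addrC addKr.
- move=> u v gu gv Hu Hv e e0; pose e' := e / (2 `^ p * 2).
  have e0' : 0 < e' by rewrite divr_gt0 // mulr_gt0 ?powR_gt0.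
  have [s [t [U [gs gt Ue st [us ut]]]]] := Hu _ e0'.
  have [s' [t' [U' [gs' gt' Ue' st' [us' ut']]]]] := Hv _ e0'.
  have -> : e = 2 `^ p * (e' + e').
    by rewrite /e'; field; rewrite gt_eqF // powR_gt0.
  exists (fun z => s z + s' z), (fun z => t z + t' z), (U `&` U'); split.
  + exact: goodD.
  + exact: goodD.
  + exact: filterI.
  + by move=> y z [/st Uy /st' Uy']; rewrite lerD.
  have aux (a b c d : X -> R) : good a -> good b -> good c -> good d ->
     (NN (fun z => rc (a z) - rc (b z))%R <= e'%:E)%E ->
     (NN (fun z => rc (c z) - rc (d z))%R <= e'%:E)%E ->
     (NN (fun z => rc (a z + c z) - rc (b z + d z))%R <= (2 `^ p * (e' + e'))%:E)%E.
    move=> [_ [ma _]] [_ [mb _]] [_ [mc _]] [_ [md _]] H1 H2.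
    have := NND_le (mmB ma mb) (mmB mc md) H1 H2; apply: le_trans.
    rewrite le_eqVlt; apply/orP; left; apply/eqP; congr NN; apply/funext => z.
    by rewrite !rcD opprD addrACA.
  by split; apply: aux.
- move=> a u a0 gu Hu e e0; pose e' := e / (a `^ p + 1).
  have a1 : 0 < a `^ p + 1 by rewrite ltr_wpDl ?powR_ge0.
  have e0' : 0 < e' by rewrite divr_gt0.
  have [s [t [U [gs gt Ue st [us ut]]]]] := Hu _ e0'.
  exists (fun z => a * s z), (fun z => a * t z), U; split => //.
  + exact: goodZ.
  + exact: goodZ.
  + by move=> y z Uy; rewrite ler_wpM2l // st.
  have aux (b c : X -> R) : good b -> good c ->
     (NN (fun z => rc (b z) - rc (c z))%R <= e'%:E)%E ->
     (NN (fun z => rc (a * b z) - rc (a * c z))%R <= e%:E)%E.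
    move=> [_ [mb _]] [_ [mc _]] H.
    have -> : (fun z => rc (a * b z) - rc (a * c z)) = (fun z => rc a * (rc (b z) - rc (c z))).
      by apply/funext => z; rewrite mulrBr -!rcM.
    rewrite NNZ; last exact: mmB.
    apply: (@le_trans _ _ ((cabs (rc a) `^ p)%:E * e'%:E)%E).
      by apply: lee_wpmul2l => //; rewrite lee_fin powR_ge0.
    rewrite -EFinM lee_fin cabs_rc ger0_norm // /e' mulrA ler_pdivrMr // mulrC.
    by rewrite ler_wpM2l ?ltW // ltrDl.
  by split; apply: aux.
- move=> u gu Hu e e0; pose e' := e / (2 `^ p * 2).
  have e0' : 0 < e' by rewrite divr_gt0 // mulr_gt0 ?powR_gt0.
  have [v [gv Hv Nuv]] := Hu _ e0'.
  have [s [t [U [gs gt Ue st [us ut]]]]] := Hv _ e0'.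
  have Ee : e = 2 `^ p * (e' + e').
    by rewrite /e'; field; rewrite gt_eqF // powR_gt0.
  exists s, t, U; split => //.
  have aux (b : X -> R) : good b ->
     (NN (fun z => rc (v z) - rc (b z))%R <= e'%:E)%E ->
     (NN (fun z => rc (u z) - rc (b z))%R <= e%:E)%E.
    move=> [_ [mb _]] H; rewrite Ee.
    have [_ [mu _]] := gu; have [_ [mv _]] := gv.
    have := NND_le (mmB mu mv) (mmB mv mb) Nuv H; apply: le_trans.
    rewrite le_eqVlt; apply/orP; left; apply/eqP; congr NN; apply/funext => z.
    by rewrite addrA subrK.
  by split; apply: aux.
Qed.

End Young.

(** * The local Young inequality and shrinking sets *)

Section ApproximateIdentity.
Variables (R : realType) (p : R) (X : walg p).
Implicit Types (x y z : X) (f g h : X -> C R) (u v s t : X -> R).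
Implicit Types (A B D E F K U V : set X).

Local Notation lam := (@lam R p X).
Let p1 : 1 <= p := walg_p X.
Let p0 : 0 < p := p_gt0 X.

Lemma lee_affine (a : \bar R) (b c : R) : 0 <= c ->
  (forall e : R, 0 < e -> (a <= (b + c * e)%:E)%E) -> (a <= b%:E)%E.
Proof.
move=> c0 H; apply/lee_addgt0Pr => e e0.
have c1 : 0 < c + 1 by rewrite ltr_wpDl.
have := H _ (divr_gt0 e0 c1); move=> /le_trans; apply.
rewrite -EFinD lee_fin lerD2l mulrA ler_pdivrMr // mulrC ler_wpM2l ?(ltW e0) //.
by rewrite lerDl.
Qed.

(* The weight is only locally bounded, hence the restriction to [A] inside a fixed compact set;
   the algebra inequality absorbs the error of the approximation by [dominated_approx]. *)
Lemma young K0 : compact K0 -> exists2 M : R, 0 <= M & forall A g, bB A -> A `<=` K0 ->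
  LL g -> (NN (cv (ii A) g) <= (M * rl A `^ p)%:E * NN g)%E.
Proof.
move=> cK0; have [C0 C00 HC] := wt_bounded cK0.
have [Ca Ca0 HCa] := conv_alg X.
pose q : R := 2 `^ p.
have q0 : 0 <= q by exact: powR_ge0.
exists (q * (q * C0 `^ p * q)); first by rewrite !mulr_ge0 ?powR_ge0.
move=> A g bA AK0 Lg; have [a a0 Ea] := LL_fin Lg; rewrite Ea -EFinM.
have LA := LL_ind bA; have [b b0 Eb] := LL_fin LA.
pose u y := cabs (g y).
have gu : good u.
  split; first by move=> y; exact: cabs_ge0.
  apply: LL_le (Lg) _; first by apply: cmeas_rc; apply: measurable_cabs; exact: LL_mm.
  by apply: aeT => y; rewrite cabs_rc ger0_norm // cabs_ge0.
have mu := good_meas gu; have [u0 [mru _]] := gu.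
have Nu : NN (fun y => rc (u y)) = a%:E.
  rewrite -Ea /NN; apply: eq_Np => //; try exact: measurable_wt; try exact: wt_gt0.
    exact: LL_mm.
  by apply: aeT => y; rewrite cabs_rc ger0_norm // cabs_ge0.
pose r := rl A; have r0 : 0 <= r := rl_ge0 A.
have rp0 : 0 <= r `^ p by exact: powR_ge0.
(* The tolerance [e] enters linearly, with a coefficient depending on [A] through the norm [b] of
   its indicator; it is sent to 0 while [A] is fixed. *)
apply: (@lee_affine _ _ (q * (q * r `^ p * C0 `^ p * q + q * (Ca * b)))).
  by rewrite mulr_ge0 // addr_ge0 ?mulr_ge0 ?powR_ge0.
move=> e e0.
have [s [t [U [gs gt Ue st [us ut]]]]] := dominated_approx gu e0.
have [S [mS S0 NS HS]] := majorant cK0 (ltW C00) HC gs gt Ue st bA AK0.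
have [s0 [mrs _]] := gs; have [t0 [mrt _]] := gt; have ms := good_meas gs.
have Nt : (NN (fun y => rc (t y)) <= (q * (a + e))%:E)%E.
  have -> : (fun y => rc (t y)) = (fun y => rc (u y) + (rc (t y) - rc (u y))).
    by apply/funext => y; rewrite addrC subrK.
  apply: NND_le => //; [exact: mmB | by rewrite Nu |].
  by rewrite NNC.
pose d y : R := `|u y - s y|.
have d0 y : 0 <= d y by exact: normr_ge0.
have md : measurable_fun setT (d : Borel X -> R).
  by apply: measurableT_comp => //; exact: measurable_funB.
have Nd : (NN (fun y => rc (d y)) <= e%:E)%E.
  apply: le_trans us; apply: le_NNW; [exact: cmeas_rc | exact: mmB |].
  by move=> y; rewrite -rcN -rcD !cabs_rc normr_id.
have Ld : LL (fun y => rc (d y)).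
  by split; [exact: cmeas_rc | apply: le_lt_trans Nd _; exact: ltry].
have [_ Lcd Ncd] := HCa _ _ LA Ld.
(* The modulus of [g] is at most [s + d]; the convolution with [s] is at most [r * S], that with [d]
   is left to the algebra inequality, and the factor 2 is that of [ci_le]. *)
pose F z : C R := rc (2 * r) * rc (S z) + rc 2 * cv (ii A) (fun y => rc (d y)) z.
have mF : mm F by apply: mmD; apply: mmZ => //; exact: LL_mm.
apply: (@le_trans _ _ (NN F)).
  apply: le_NN => //; first exact/LL_mm/LL_cv.
  apply: aeS2 (ae_absint LA Lg) (ae_absint LA Ld) => z fg fd.
  have mg : mm (cvi (ii A) g z) by apply: mm_cvi; exact: LL_mm.
  apply: le_trans (ci_le mg fg) _.
  rewrite /F cv_av -!rcM -rcD cabs_rc.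
  rewrite absint_av in fg; rewrite absint_av in fd.
  have Eu : av A (fun y => cabs (g y)) z = av A u z by [].
  have Ed : av A (fun y => cabs (rc (d y) : C R)) z = av A d z.
    by congr (av A _ z); apply/funext => y; rewrite cabs_rc ger0_norm.
  rewrite Ed in fd; rewrite absint_av.
  have avd0 := av_ge0 A z d0; have avu0 := av_ge0 A z u0.
  have fd' : av A d z \is a fin_num by rewrite ge0_fin_numE.
  have fu' : av A u z \is a fin_num by rewrite ge0_fin_numE.
  have H : (av A u z <= (r * S z)%:E + av A d z)%E.
    apply: (@le_trans _ _ (av A (fun y => s y + d y) z)).
      apply: le_av => //; [exact: bA.1 | exact: measurable_funD |].
      by move=> y _; rewrite -lerBlDl ler_norm.
    by rewrite avD //; [exact: leeD2r | exact: bA.1].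
  have H' : fine (av A u z) <= r * S z + fine (av A d z).
    by rewrite -lee_fin EFinD !fineK.
  rewrite ger0_norm; last by rewrite addr_ge0 ?mulr_ge0 // fine_ge0.
  by rewrite -mulrA -mulrDr ler_wpM2l.
have H1 : (NN (fun z => rc (2 * r) * rc (S z))%R <= (q * r `^ p * C0 `^ p * q * (a + e))%:E)%E.
  rewrite NNZ // cabs_rc ger0_norm ?mulr_ge0 // powRM //.
  apply: (@le_trans _ _ ((q * r `^ p)%:E * ((C0 `^ p)%:E * (q * (a + e))%:E))%E).
    apply: lee_wpmul2l; first by rewrite lee_fin mulr_ge0 // powR_ge0.
    apply: le_trans NS _; apply: lee_wpmul2l Nt.
    by rewrite lee_fin powR_ge0.
  by rewrite -!EFinM lee_fin !mulrA.
have H2 : (NN (fun z => rc 2 * cv (ii A) (fun y => rc (d y)) z)%R <= (q * (Ca * b * e))%:E)%E.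
  rewrite NNZ; last exact: LL_mm.
  rewrite cabs_rc ger0_norm // EFinM; apply: lee_wpmul2l; first by rewrite lee_fin.
  apply: le_trans Ncd _; rewrite Eb -EFinM [X in (_ <= X)%E]EFinM.
  by apply: lee_wpmul2l Nd; rewrite lee_fin mulr_ge0.
have mH1 : mm (fun z => rc (2 * r) * rc (S z)) by exact: mmZ.
have mH2 : mm (fun z => rc 2 * cv (ii A) (fun y => rc (d y)) z) by apply/mmZ/LL_mm.
apply: le_trans (NND_le mH1 mH2 H1 H2) _.
rewrite lee_fin -/q le_eqVlt; apply/orP; left; apply/eqP; rewrite -/r; ring.
Qed.

(** Density reduces to the indicator of a compact [K], with an open superset [Wo] of small excess
    [D]. For [A] close to [x] the difference at [z] is bounded by [F2] when [x^-1 z] lies in [K], by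
    [F1] when it lies in [D], and vanishes otherwise. [NN_tr] bounds [F1]; [young] bounds [F2] and
    carries the passage to the limit, since its constant is the same for all [A] inside [K0]. *)
Lemma approx_id x g : LL g -> forall e : R, 0 < e ->
  exists2 U, nbhs x U & forall A, bB A -> A `<=` U ->
  (NN (fun z => cv (ii A) g z - rc (rl A) * tr x g z)%R <= (e * rl A `^ p)%:E)%E.
Proof.
have [W [K0 [oW Wx WK0 cK0 _]]] := compact_nbhs (@filterT _ (nbhs x) _).
have nW : nbhs x W by exact: open_nbhs_nbhs.
have [M M0 HM] := young cK0.
pose q : R := 2 `^ p.
have q0 : 0 < q by exact: powR_gt0.
move: g; apply: LL_induct.
- move=> K cK e e0; pose c := wt x `^ p + M.
  have c0 : 0 < q * c + 1 by rewrite ltr_wpDl // mulr_ge0 ?addr_ge0 ?powR_ge0 // ltW.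
  pose d := e / (q * c + 1).
  have d0 : 0 < d by rewrite divr_gt0.
  have [Wo [oO KO bO NO]] := Np_outer cK d0.
  have mK := compact_borel cK; have bOK := bBD bO mK.
  (* For [y] in [U1] the set [y K] lies in [x Wo], so the convolution vanishes off [x Wo]; for [y]
     in [U2] the point [y^-1 z] stays in [Wo] whenever [z] is in [x K]. *)
  pose U1 := [set y | forall k, K k -> shift x Wo (gm y k)].
  pose U2 := [set y | forall k, K k -> Wo (gm (gm (gi y) x) k)].
  exists (W `&` (U1 `&` U2)).
    apply: filterI => //; apply: filterI.
      apply: (@tube _ _ _ X X K (shift x Wo) gm) => //; last first.
      - by move=> k Kk; exists k => //; exact: KO.
      - exact: open_shift.
      by apply: cont_gm2 => w; [exact: cvg_snd | exact: cvg_fst].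
    apply: (@tube _ _ _ X X K Wo (fun y k => gm (gm (gi y) x) k)) => //; last first.
      by move=> k Kk; rewrite gVm g1m; exact: KO.
    apply: cont_gm2 => [|w]; last exact: cvg_fst.
    apply: cont_gm2; last exact: cont_cst.
    by apply: cont_gi => w; exact: cvg_snd.
  move=> A bA AU; have AW : A `<=` K0 by move=> y /AU[/WK0].
  have mA := bA.1.
  pose D := Wo `\` K.
  have mD : borel D := bOK.1.
  have LA := LL_ind bA; have LD := LL_ind bOK; have LK := LL_ind (compact_bB cK).
  pose F1 z : C R := rc (rl A) * tr x (ii D) z.
  pose F2 z : C R := cv (ii A) (ii D) z.
  have mF1 : mm F1 by apply: mmZ; apply: mm_tr; exact: mm_ii.
  have mF2 : mm F2 by exact/LL_mm/LL_cv.
  have m1 (E : set X) : borel E -> measurable_fun setT (\1_E : Borel X -> R).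
    by move=> mE; exact: measurable_indic.
  have cvE' E z : cv (ii A) (ii E) z = rc (fine (av A \1_E z)) by exact: cv_av.
  have finav E z : borel E -> av A \1_E z \is a fin_num.
    move=> mE; rewrite ge0_fin_numE; last exact: av_ge0.
    apply: (@le_lt_trans _ _ (rl A * 1)%:E); last exact: ltry.
    by apply: av_le => //; exact: m1.
  apply: (@le_trans _ _ (NN (fun z => F1 z + F2 z))).
    apply: le_NNW; [apply: mmB; [exact/LL_mm/LL_cv|apply: mmZ; apply: mm_tr; exact: mm_ii]|exact: mmD|].
    move=> z; rewrite /F1 /F2 !cvE' /tr.
    have avK0 : 0 <= fine (av A \1_K z) by apply: fine_ge0; exact: av_ge0.
    have avD0 : 0 <= fine (av A \1_D z) by apply: fine_ge0; exact: av_ge0.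
    have rA := rl_ge0 A.
    have avle : fine (av A \1_K z) <= rl A.
      rewrite -lee_fin (fineK (finav K z mK)) -[rl A]mulr1.
      by apply: av_le => //; exact: m1.
    have [Kz|Kz] := pselect (K (gm (gi x) z)).
      rewrite (iiT Kz) iiF; last by move=> [_].
      rewrite mulr1 mulr0 add0r -rcN -rcD !cabs_rc.
      suff -> : rl A = fine (av A \1_K z) + fine (av A \1_D z).
        by rewrite opprD addNKr normrN.
      apply: EFin_inj; rewrite EFinD (fineK (finav K z mK)) (fineK (finav D z mD)).
      rewrite -avD //; try exact: m1.
      rewrite -[rl A]mulr1 -(av_cst 1 z bA); apply: eq_integral => y /set_mem Ay.
      congr EFin; have [_ [_ /(_ _ Kz)]] := AU _ Ay; rewrite -gmA gmVK => Oz.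
      rewrite !indicE in_setD (mem_set Oz) /=.
      by case: (_ \in K); rewrite /= ?addr0 ?add0r.
    have [Oz|Oz] := pselect (Wo (gm (gi x) z)).
      rewrite (iiF Kz) iiT // mulr1 mulr0 subr0 -rcD !cabs_rc !ger0_norm ?addr_ge0 //.
      by rewrite (le_trans avle) // lerDl.
    rewrite (iiF Kz) iiF; last by move=> [].
    rewrite !mulr0 subr0 add0r !cabs_rc.
    suff -> : av A \1_K z = 0%E by rewrite normr0.
    rewrite /av integral0_eq // => y Ay; rewrite indicE memNset // => Kyz.
    have [_ [/(_ _ Kyz) + _]] := AU _ Ay; rewrite gmVK shiftE => Oxz.
    exact: Oz.
  have H1 : (NN F1 <= (rl A `^ p * (wt x `^ p * d))%:E)%E.
    rewrite NNZ; last by apply: mm_tr; exact: mm_ii.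
    rewrite cabs_rc ger0_norm ?rl_ge0 // EFinM.
    apply: lee_wpmul2l; first by rewrite lee_fin powR_ge0.
    apply: le_trans (NN_tr _ _) _; first exact: mm_ii.
    by rewrite EFinM; apply: lee_wpmul2l NO; rewrite lee_fin powR_ge0.
  have H2 : (NN F2 <= (M * rl A `^ p * d)%:E)%E.
    apply: le_trans (HM _ _ bA AW LD) _; rewrite EFinM.
    by apply: lee_wpmul2l NO; rewrite lee_fin mulr_ge0 // powR_ge0.
  apply: le_trans (NND_le mF1 mF2 H1 H2) _; rewrite lee_fin.
  have -> : 2 `^ p * (rl A `^ p * (wt x `^ p * d) + M * rl A `^ p * d) =
    q * c * d * rl A `^ p by rewrite /c -/q; ring.
  rewrite ler_wpM2r ?powR_ge0 // /d mulrA ler_pdivrMr // mulrC ler_wpM2l ?ltW //.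
  by rewrite ltrDl.
- move=> f g Lf Lg Hf Hg e e0; pose d := e / (q * 2).
  have d0 : 0 < d by rewrite divr_gt0 // mulr_gt0.
  have [U1 U1x H1] := Hf _ d0; have [U2 U2x H2] := Hg _ d0.
  exists (U1 `&` U2); first exact: filterI.
  move=> A bA AU; have LA := LL_ind bA.
  have {}H1 := H1 A bA (subset_trans AU (@subIsetl _ _ _)).
  have {}H2 := H2 A bA (subset_trans AU (@subIsetr _ _ _)).
  have m1 h : LL h -> mm (fun z => cv (ii A) h z - rc (rl A) * tr x h z).
    by move=> Lh; apply: mmB; [exact/LL_mm/LL_cv | apply: mmZ; apply: mm_tr; exact: LL_mm].
  have := NND_le (m1 f Lf) (m1 g Lg) H1 H2.
  have -> : 2 `^ p * (d * rl A `^ p + d * rl A `^ p) = e * rl A `^ p.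
    by rewrite /d /q; field; rewrite gt_eqF.
  apply: le_trans; rewrite le_eqVlt; apply/orP; left; apply/eqP; apply: eq_NN.
  + exact/m1/LLD.
  + by apply: mmD; exact: m1.
  by apply: aeS (cvDr LA Lf Lg) => z ->; rewrite /tr mulrDr; ring.
- move=> a f Lf Hf e e0; pose c := cabs a `^ p.
  have c0 : 0 < c + 1 by rewrite ltr_wpDl // powR_ge0.
  have d0 : 0 < e / (c + 1) by rewrite divr_gt0.
  have [U Ux H] := Hf _ d0; exists U => // A bA AU; have LA := LL_ind bA.
  have {}H := H A bA AU.
  have m1 : mm (fun z => cv (ii A) f z - rc (rl A) * tr x f z).
    by apply: mmB; [exact/LL_mm/LL_cv | apply: mmZ; apply: mm_tr; exact: LL_mm].
  apply: (@le_trans _ _ (NN (fun z => a * (cv (ii A) f z - rc (rl A) * tr x f z)))).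
    rewrite le_eqVlt; apply/orP; left; apply/eqP; apply: eq_NN.
    + apply: mmB; first by apply/LL_mm/LL_cv => //; exact: LLZ.
      by apply: mmZ; apply: mm_tr; apply: mmZ; exact: LL_mm.
    + exact: mmZ.
    by apply: aeS (cvZr a LA Lf) => z ->; rewrite /tr mulrBr mulrCA.
  rewrite NNZ // -/c; apply: (@le_trans _ _ (c%:E * (e / (c + 1) * rl A `^ p)%:E)%E).
    by apply: lee_wpmul2l H; rewrite lee_fin powR_ge0.
  rewrite -EFinM lee_fin mulrA ler_wpM2r ?powR_ge0 // mulrA ler_pdivrMr // mulrC.
  by rewrite ler_wpM2l ?ltW // ltrDl.
- move=> f Lf Hf e e0; pose c := q + q * q * (M + wt x `^ p).
  have c0' : 0 <= c.
    by rewrite addr_ge0 ?(ltW q0) // mulr_ge0 ?addr_ge0 ?powR_ge0 // mulr_ge0 ?(ltW q0).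
  have c0 : 0 < c + 1 by rewrite ltr_wpDl.
  pose d := e / (c + 1); have d0 : 0 < d by rewrite divr_gt0.
  have [g [Lg Hg Nfg]] := Hf _ d0; have [U Ux H] := Hg _ d0.
  exists (U `&` W); first exact: filterI.
  move=> A bA AU; have LA := LL_ind bA; have Lfg := LLB Lf Lg.
  have {}H := H A bA (subset_trans AU (@subIsetl _ _ _)).
  have AK0 : A `<=` K0 by move=> y /AU[_ /WK0].
  have m1 h : LL h -> mm (fun z => cv (ii A) h z - rc (rl A) * tr x h z).
    by move=> Lh; apply: mmB; [exact/LL_mm/LL_cv | apply: mmZ; apply: mm_tr; exact: LL_mm].
  pose k z := f z - g z.
  have mk : mm k by exact: LL_mm.
  have H1 : (NN (cv (ii A) k) <= (M * rl A `^ p * d)%:E)%E.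
    apply: le_trans (HM A k bA AK0 Lfg) _; rewrite [X in (_ <= X)%E]EFinM.
    by apply: lee_wpmul2l Nfg; rewrite lee_fin mulr_ge0 // powR_ge0.
  have H2 : (NN (fun z => - rc (rl A) * tr x k z)%R <= (rl A `^ p * (wt x `^ p * d))%:E)%E.
    rewrite NNZ; last exact: mm_tr.
    rewrite cabsN cabs_rc ger0_norm ?rl_ge0 // EFinM.
    apply: lee_wpmul2l; first by rewrite lee_fin powR_ge0.
    apply: le_trans (NN_tr _ mk) _.
    by rewrite EFinM; apply: lee_wpmul2l Nfg; rewrite lee_fin powR_ge0.
  have mk1 : mm (cv (ii A) k) by exact/LL_mm/LL_cv.
  have mk2 : mm (fun z => - rc (rl A) * tr x k z) by apply: mmZ; exact: mm_tr.
  have H3 := NND_le mk1 mk2 H1 H2.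
  have H4 := NND_le (m1 g Lg) (mmD mk1 mk2) H H3.
  apply: (@le_trans _ _ (2 `^ p * (d * rl A `^ p + 2 `^ p * (M * rl A `^ p * d +
    rl A `^ p * (wt x `^ p * d))))%:E).
    apply: le_trans H4; rewrite le_eqVlt; apply/orP; left; apply/eqP; apply: eq_NN.
    + exact: m1.
    + by apply: mmD; [exact: m1 | exact: mmD].
    apply: aeS (cvDr LA Lg Lfg) => z Ez.
    have -> : cv (ii A) f z = cv (ii A) (fun y => g y + (f y - g y)) z.
      by congr (cv _ _ z); apply/funext => y; rewrite addrC subrK.
    by rewrite Ez /tr /k; ring.
  rewrite lee_fin -/q.
  have -> : q * (d * rl A `^ p + q * (M * rl A `^ p * d + rl A `^ p * (wt x `^ p * d))) =
    c * d * rl A `^ p by rewrite /c; ring.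
  rewrite ler_wpM2r ?powR_ge0 // /d mulrA ler_pdivrMr // mulrC ler_wpM2l ?ltW //.
  by rewrite ltrDl.
Qed.

End ApproximateIdentity.

(** Bounds and separation are fields in both directions, so that the inverse is again a [wiso]. All
    equations hold almost everywhere because functions stand for their classes. *)
Record wiso (R : realType) (p : R) (X Y : walg p) := WIso {
  wT :> (X -> C R) -> Y -> C R;
  wT_LL : forall f, LL f -> LL (wT f);
  wT_ae : forall f g, LL f -> LL g -> {ae (@lam R p X), forall x, f x = g x} ->
    {ae (@lam R p Y), forall y, wT f y = wT g y};
  wTD : forall f g, LL f -> LL g ->
    {ae (@lam R p Y), forall y, wT (fun x => f x + g x) y = wT f y + wT g y};
  wTZ : forall (a : C R) f, LL f ->
    {ae (@lam R p Y), forall y, wT (fun x => a * f x) y = a * wT f y};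
  wTcv : forall f g, LL f -> LL g ->
    {ae (@lam R p Y), forall y, wT (cv f g) y = cv (wT f) (wT g) y};
  wT_inj : forall f g, LL f -> LL g -> {ae (@lam R p Y), forall y, wT f y = wT g y} ->
    {ae (@lam R p X), forall x, f x = g x};
  wT_surj : forall h, LL h -> exists2 f, LL f & {ae (@lam R p Y), forall y, wT f y = h y};
  wT_bd : exists2 M : R, 0 <= M & forall f, LL f -> (NN (wT f) <= M%:E * NN f)%E;
  wT_bdV : exists2 M : R, 0 <= M & forall f, LL f -> (NN f <= M%:E * NN (wT f))%E;
  wT_sep : forall f g, LL f -> LL g -> {ae (@lam R p X), forall x, f x * g x = 0} ->
    {ae (@lam R p Y), forall y, wT f y * wT g y = 0};
  wT_sepV : forall f g, LL f -> LL g -> {ae (@lam R p Y), forall y, wT f y * wT g y = 0} ->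
    {ae (@lam R p X), forall x, f x * g x = 0} }.

(** * Images of indicators and their cluster points *)

Section Separating.
Variables (R : realType) (p : R) (X Y : walg p) (T : wiso X Y).
Implicit Types (x : X) (y z : Y) (f g : X -> C R) (q : Y -> C R) (A B : set X).

Local Notation lamX := (@lam R p X).
Local Notation lamY := (@lam R p Y).
Let p1 : 1 <= p := walg_p X.
Let p0 : 0 < p := p_gt0 X.

Lemma wTB f g : LL f -> LL g ->
  {ae lamY, forall y, T (fun x => f x - g x) y = T f y - T g y}.
Proof.
move=> Lf Lg; have Lg' := LLZ (-1) Lg.
have -> : (fun x => f x - g x) = (fun x => f x + -1 * g x).
  by apply/funext => x; rewrite mulN1r.
by apply: aeS2 (wTD T Lf Lg') (wTZ T (-1) Lg) => y -> ->; rewrite mulN1r.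
Qed.

Lemma wT0 f : LL f -> {ae lamX, forall x, f x = 0} -> {ae lamY, forall y, T f y = 0}.
Proof.
move=> Lf f0; have L0 := LL0 X.
have H : {ae lamY, forall y, T (fun=> 0) y = 0}.
  apply: aeS (wTZ T 0 L0) => y E; rewrite -[RHS](mul0r (T (fun=> 0) y)) -E; congr (T _ y).
  by apply/funext => x; rewrite mul0r.
by apply: aeS2 (wT_ae T Lf L0 f0) H => y -> ->.
Qed.

Lemma wT0V f : LL f -> {ae lamY, forall y, T f y = 0} -> {ae lamX, forall x, f x = 0}.
Proof.
move=> Lf Tf0; have L0 := LL0 X.
apply: (wT_inj (w := T) Lf L0).
by apply: aeS2 Tf0 (wT0 L0 (aeT (fun=> erefl))) => y -> ->.
Qed.

(** [T] applied to [approx_id]. The free representative [q] of the class of [T g] allows a genuine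
    indicator as right factor, so that the convolution can be computed at every point. *)
Lemma wT_approx x g q : LL g -> LL q -> {ae lamY, forall y, T g y = q y} ->
  forall e : R, 0 < e ->
  exists2 U, nbhs x U & forall A, bB A -> A `<=` U ->
  (NN (fun z => cv (T (ii A)) q z - rc (rl A) * T (tr x g) z)%R <= (e * rl A `^ p)%:E)%E.
Proof.
move=> Lg Lq Tgq e e0; have [M M0 HM] := wT_bd T.
have M1 : 0 < M + 1 by rewrite ltr_wpDl.
have [U Ux H] := approx_id x Lg (divr_gt0 e0 M1).
exists U => // A bA AU; have LA := LL_ind bA; have Lt := LL_tr x Lg.
have Lc := LL_cv LA Lg; have Lt' := LLZ (rc (rl A)) Lt.
have LTA := wT_LL T LA; have LTg := wT_LL T Lg; have Ld := LLB Lc Lt'.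
have -> : NN (fun z => cv (T (ii A)) q z - rc (rl A) * T (tr x g) z) =
    NN (T (fun x' : X => cv (ii A) g x' - rc (rl A) * tr x g x')).
  apply: eq_NN; first by apply: LL_mm; apply: LLB; [exact: LL_cv | exact/LLZ/wT_LL].
    exact/LL_mm/wT_LL.
  apply: aeS2 (cvr_ae LTA LTg Lq Tgq) (aeI (wTB Lc Lt')
    (aeI (wTcv T LA Lg) (wTZ T (rc (rl A)) Lt))) => z <- [-> [-> ->]] //.
apply: le_trans (HM _ Ld) _.
apply: (@le_trans _ _ (M%:E * (e / (M + 1) * rl A `^ p)%:E)%E).
  by apply: lee_wpmul2l; [rewrite lee_fin | exact: H].
rewrite -EFinM lee_fin mulrA ler_wpM2r ?powR_ge0 // mulrA ler_pdivrMr // mulrC.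
by rewrite ler_wpM2l ?ltW // ltrDl.
Qed.

(** Let [g] be a preimage of the restriction of [T (ii A)] to [Z]. Then [T g] and [T (ii A - g)] are
    disjoint, hence [g * (ii A - g) = 0]: almost everywhere [g] is 0 or equals [ii A], so it is an
    indicator. *)
Lemma wT_sub A (Z : set Y) : bB A -> borel Z -> exists A',
  [/\ bB A', A' `<=` A & {ae lamY, forall y, T (ii A') y = ii Z y * T (ii A) y}].
Proof.
move=> bA mZ; have LA := LL_ind bA; have LTA := wT_LL T LA.
have [g Lg Tg] := wT_surj T (LL_indM mZ LTA).
have Lg' := LLB LA Lg.
have H : {ae lamX, forall x, g x * (ii A x - g x) = 0}.
  apply: (wT_sepV (w := T)) => //.
  apply: aeS2 (wTB LA Lg) Tg => y -> ->.
  have [Zy|Zy] := pselect (Z y); last by rewrite (iiF Zy) !mul0r.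
  by rewrite (iiT Zy) mul1r subrr mulr0.
pose A' := A `&` [set x | g x <> 0].
have mg0 : borel [set x | g x <> 0] by apply: (@measurable_neq0 _ (Borel X)); exact: LL_mm.
have bA' : bB A' by exact: bBI.
exists A'; split => //; first exact: subIsetl.
apply: aeS2 Tg (wT_ae T (LL_ind bA') Lg _) => [y <- //|].
apply: aeS H => x /eqP; rewrite mulf_eq0 => /orP[/eqP gx|].
  by rewrite gx iiF // => -[_].
rewrite subr_eq0 => /eqP gx.
have [Ax|Ax] := pselect (A x); last first.
  by rewrite -gx (iiF Ax) iiF // => -[].
rewrite -gx (iiT Ax) iiT //; split => //=.
by rewrite -gx (iiT Ax); apply/eqP; exact: oner_neq0.
Qed.

Lemma lam_ii0 (W : walg p) (Q : set W) : borel Q ->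
  {ae (@lam R p W), forall t, ii Q t = 0} -> lam Q = 0%E.
Proof.
move=> mQ H; apply/(negligibleP _ mQ); apply: negligibleS H => y Qy /=.
by rewrite iiT // => /eqP; rewrite oner_eq0.
Qed.

Lemma rl_gt0P A : bB A -> ~ {ae lamY, forall y, T (ii A) y = 0} -> 0 < rl A.
Proof.
move=> bA H; rewrite lt_def rl_ge0 andbT; apply/negP => /eqP r0; apply: H.
apply: wT0; first exact: LL_ind.
have : lamX A = 0%E by rewrite rlE // r0.
move=> /(negligibleP _ bA.1); apply: negligibleS => x /= H.
by apply: contrapT => Ax; apply: H; rewrite iiF.
Qed.

Lemma NN_cancel (W : walg p) (k : W -> C R) (r e : R) : 0 < r -> mm k ->
  (NN (fun t => rc r * k t)%R <= (e * r `^ p)%:E)%E -> (NN k <= e%:E)%E.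
Proof.
move=> r0 mk; rewrite NNZ // cabs_rc ger0_norm ?(ltW r0) // muleC [X in (_ <= X)%E]EFinM.
by rewrite lee_pmul2r // lte_fin powR_gt0.
Qed.

(* If [T 1_A * 1_Q] is locally [o(lam A)] as [A] shrinks to [x], then [T L_x T^-1 1_Q = 0]. *)
Lemma conv_vanish x (Q : set Y) : bB Q ->
  (forall K U (e : R), compact K -> nbhs x U -> 0 < e -> exists A,
    [/\ bB A, A `<=` U, 0 < rl A &
        forall z, K z -> cabs (cv (T (ii A)) (ii Q) z) <= e * rl A]) ->
  lamY Q = 0%E.
Proof.
move=> bQ H; have LQ := LL_ind bQ; have [g Lg Tg] := wT_surj T LQ.
pose v := T (tr x g); have Lt := LL_tr x Lg; have Lv : LL v := wT_LL T Lt.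
have v0 : {ae lamY, forall y, setT y -> v y = 0}.
  apply: (locally_ae0 Lv (@measurableT _ (Borel Y))) => K cK _; have mK := compact_borel cK.
  have LK := LL_ind (compact_bB cK); have [b b0 Eb] := LL_fin LK.
  apply: NN_small0_on => //; first exact: LL_mm.
  move=> e e0; pose q : R := 2 `^ p; have q0 : 0 < q by exact: powR_gt0.
  have e1 : 0 < e / (q * 2) by rewrite divr_gt0 // mulr_gt0.
  have [d d0 db] := powR_small p1 b e1.
  have [U Ux HU] := wT_approx x Lg LQ Tg e1.
  have [A [bA AU rA HA]] := H K U d cK Ux d0.
  have LTA := wT_LL T (LL_ind bA).
  have mc : mm (cv (T (ii A)) (ii Q)) by exact/LL_mm/LL_cv.
  have mv := LL_mm Lv.
  apply: (NN_cancel rA); first exact: mm_indM.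
  pose F1 z := cv (T (ii A)) (ii Q) z - rc (rl A) * v z.
  pose F2 z := rc (d * rl A) * ii K z.
  have mF1 : mm F1 by apply: mmB => //; exact: mmZ.
  have H1 : (NN (fun z => rc (- 1) * F1 z)%R <= (e / (q * 2) * rl A `^ p)%:E)%E.
    rewrite NNZ // cabs_rc normrN1 powR1 mul1e; exact: HU.
  have H2 : (NN F2 <= (e / (q * 2) * rl A `^ p)%:E)%E.
    rewrite NNZ; last exact: mm_ii.
    rewrite Eb -EFinM lee_fin cabs_rc ger0_norm ?mulr_ge0 ?(ltW d0) ?rl_ge0 //.
    rewrite powRM ?(ltW d0) ?rl_ge0 // mulrAC ler_wpM2r ?powR_ge0 // mulrC //.
  pose F3 z := ii K z * cv (T (ii A)) (ii Q) z.
  have mF3 : mm F3 by exact: mm_indM.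
  have H3 : (NN F3 <= (e / (q * 2) * rl A `^ p)%:E)%E.
    apply: le_trans H2; apply: le_NNW => //; first by apply: mmZ; exact: mm_ii.
    move=> z; rewrite /F3 /F2; have [Kz|Kz] := pselect (K z); last first.
      by rewrite (iiF Kz) mul0r mulr0.
    rewrite (iiT Kz) mul1r mulr1 cabs_rc ger0_norm ?HA //.
    by rewrite mulr_ge0 ?rl_ge0 // ltW.
  have mF1' : mm (fun z => ii K z * (rc (-1) * F1 z)).
    by apply: mm_indM => //; exact: mmZ.
  have H1' : (NN (fun z => ii K z * (rc (- 1) * F1 z))%R <= (e / (q * 2) * rl A `^ p)%:E)%E.
    by apply: le_trans (le_NN_indM mK _) H1; exact: mmZ.
  have := NND_le mF1' mF3 H1' H3.
  have -> : 2 `^ p * (e / (q * 2) * rl A `^ p + e / (q * 2) * rl A `^ p) = e * rl A `^ p.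
    by rewrite /q; field; rewrite gt_eqF.
  apply: le_trans; rewrite le_eqVlt; apply/orP; left; apply/eqP; congr NN.
  apply/funext => z; rewrite /F1 /F3 rcN rc1; ring.
have g0 : {ae lamX, forall x', g x' = 0}.
  have t0 := wT0V Lt (aeS (fun y H => H I) v0).
  by apply: aeS (ae_shift x t0) => x'; rewrite /tr gmK.
apply: lam_ii0; first exact: bQ.1.
by apply: aeS2 Tg (wT0 Lg g0) => y <-.
Qed.

Lemma nonnull_compact (W : walg p) : exists2 Q : set W, compact Q & lam Q <> 0%E.
Proof.
have [U [Q [oU Ue UQ cQ _]]] := compact_nbhs (@filterT _ (nbhs (ge : W)) _).
exists Q => // Q0; have := lam_open oU (ex_intro _ _ Ue).
suff : (lam U <= lam Q)%E by rewrite Q0 => /le_lt_trans /[apply]; rewrite ltxx.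
by apply: le_measure; rewrite ?inE //; [exact: open_borel | exact: compact_borel].
Qed.

(** The image [T (ii A)] does not vanish on [Z] for suitable sets [A] arbitrarily close to [x]; a
    point whose open neighbourhoods are all charged is a cluster point of these supports. *)
Definition charged x (Z : set Y) := forall U, nbhs x U -> exists A,
  [/\ bB A, A `<=` U & ~ {ae lamY, forall y, Z y -> T (ii A) y = 0}].

Lemma not_charged x Z : ~ charged x Z -> exists2 U, nbhs x U &
  forall A, bB A -> A `<=` U -> {ae lamY, forall y, Z y -> T (ii A) y = 0}.
Proof.
move=> /existsNP[U /not_implyP[Ux H]]; exists U => // A bA AU.
by apply: contrapT => nA; apply: H; exists A.
Qed.

(** This excludes escape to infinity. Without a cluster point, [T (ii A)] vanishes on [Z] inside any
    given compact set once [A] is close to [x]. Apply this to [L], the set of products [K Q^-1]: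
    after restriction to [Z], the convolution with the indicator of [Q] is 0 on [K], and
    [conv_vanish] makes a non-null [Q] null. *)
Lemma charged_cluster x Z : borel Z -> charged x Z ->
  exists h, forall W, open W -> W h -> charged x (Z `&` W).
Proof.
move=> mZ cZ; apply: contrapT => nh.
have loc (h : Y) : exists2 W : set Y, nbhs h W & exists2 U, nbhs x U & forall A, bB A -> A `<=` U ->
    {ae lamY, forall y, W y -> Z y -> T (ii A) y = 0}.
  have : ~ forall W, open W -> W h -> charged x (Z `&` W) by move=> H; apply: nh; exists h.
  move=> /existsNP[W /not_implyP[oW /not_implyP[Wh /not_charged[U Ux H]]]].
  exists W; first exact: open_nbhs_nbhs.
  by exists U => // A bA AU; apply: aeS (H A bA AU) => y Hy Wy Zy; exact: Hy.
have loc' (K : set Y) : compact K -> exists2 U, nbhs x U & forall A, bB A -> A `<=` U ->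
    {ae lamY, forall y, K y -> Z y -> T (ii A) y = 0}.
  move=> cK; pose P (S : set Y) := exists2 U, nbhs x U & forall A, bB A -> A `<=` U ->
    {ae lamY, forall y, S y -> Z y -> T (ii A) y = 0}.
  apply: (@compact_local_ind _ P) => //.
  - by exists setT; [exact: filterT | move=> A bA _; exact: aeT].
  - move=> S S' SS' [U Ux H]; exists U => // A bA AU.
    by apply: aeS (H A bA AU) => y Hy /SS'; exact: Hy.
  - move=> S S' [U Ux H] [U' Ux' H']; exists (U `&` U'); first exact: filterI.
    move=> A bA AU.
    apply: aeS2 (H A bA (fun a Aa => (AU a Aa).1)) (H' A bA (fun a Aa => (AU a Aa).2)).
    by move=> y Hy Hy' [/Hy|/Hy']; apply.
have [Q cQ Q0] := nonnull_compact Y; have bQ := compact_bB cQ.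
apply: Q0; apply: (@conv_vanish x) => // K U e cK Ux e0.
pose L := [set gm q.1 (gi q.2) | q in K `*` Q].
have cL : compact L.
  apply: continuous_compact; last exact: compact_setX.
  apply: continuous_subspaceT; apply: cont_gm2.
    by move=> w; exact: cvg_fst.
  by apply: cont_gi => w; exact: cvg_snd.
have [U' Ux' H'] := loc' L cL.
have [A0 [bA0 A0U TA0]] := cZ _ (filterI Ux Ux').
have [A [bA AA0 TA]] := wT_sub bA0 mZ.
exists A; split => //.
- by move=> a /AA0/A0U[].
- apply: rl_gt0P => // TA'; apply: TA0.
  apply: aeS2 TA TA' => y -> TA' Zy.
  by move: TA'; rewrite iiT // mul1r.
move=> z Kz; suff -> : cv (T (ii A)) (ii Q) z = 0.
  by rewrite cabs0 mulr_ge0 ?rl_ge0 // ltW.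
have LTA := wT_LL T (LL_ind bA).
rewrite cvE (@ci_ae _ _ _ _ (fun=> 0)); last 3 first.
- by apply: mm_cvi; [exact: LL_mm | exact/LL_mm/LL_ind].
- exact: mm_cst.
- apply: aeS2 TA (H' A0 bA0 (fun a Aa => (A0U a Aa).2)) => y TAy TA0y; rewrite /cvi TAy.
  have [Qy|Qy] := pselect (Q (gm (gi y) z)); last by rewrite [ii Q _]iiF // mulr0.
  have [Zy|Zy] := pselect (Z y); last by rewrite (iiF Zy) !mul0r.
  rewrite TA0y ?mulr0 ?mul0r //; exists (z, gm (gi y) z) => //=.
  by rewrite giM giK gmVK.
by rewrite ci_rc integral0.
Qed.

End Separating.

(** * Integrability on compact sets and absence of cancellation *)

Section LocalIntegrability.
Variables (R : realType) (p : R) (X : walg p).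
Implicit Types (x y z : X) (f g : X -> C R) (u : X -> R) (B D K : set X).

Local Notation lam := (@lam R p X).
Let p1 : 1 <= p := walg_p X.
Let p0 : 0 < p := p_gt0 X.

(** [1 = wt (y y^-1) <= wt y * wt (y^-1)], and the weight is bounded on the inverse of [K]. *)
Lemma wt_lower K : compact K -> exists2 m : R, 0 < m & forall y, K y -> m <= wt y.
Proof.
move=> cK; have cK' : compact (gi @` K).
  by apply: continuous_compact => //; apply: continuous_subspaceT; apply: cont_gi; exact: cont_id.
have [M M0 HM] := wt_bounded cK'; exists M^-1; first by rewrite invr_gt0.
move=> y Ky; rewrite -[leLHS]mul1r ler_pdivrMr // -(wt1 X) -(gmV y).
apply: le_trans (wtM _ _) _; rewrite ler_wpM2l ?wt_ge0 //.
by apply: HM; exists y.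
Qed.

(** With the weight at least [m] on [D], [m * |f| <= |f| * wt <= 1 + (|f| * wt)^p]; this takes the
    place of the Hölder inequality. *)
Lemma LL_absint f D : LL f -> bB D -> {ae lam, forall y, ~ D y -> f y = 0} ->
  (absint f < +oo)%E.
Proof.
move=> Lf bD f0; have [mD [K cK DK]] := bD; have [m m0 Hm] := wt_lower cK.
have mf := LL_mm Lf; have mw := @measurable_wt R p X.
pose G y : \bar R := (m^-1%:E * ((\1_D y)%:E + ((cabs (f y) * wt y) `^ p)%:E))%E.
have m1 : measurable_fun setT (fun y : Borel X => (\1_D y : R)%:E).
  by apply/measurable_EFinP; exact: measurable_indic.
have m2 : measurable_fun setT (fun y : Borel X => ((cabs (f y) * wt y) `^ p)%:E).
  exact: measurable_Np.
have i0 : (0 <= m^-1%:E :> \bar R)%E by rewrite lee_fin invr_ge0 ltW.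
apply: (@le_lt_trans _ _ (\int[lam]_(y in [set: Borel X]) G y)%E).
  apply: ae_ge0_le_integral => //.
  - by move=> y _; rewrite lee_fin cabs_ge0.
  - by apply/measurable_EFinP; exact: measurable_cabs.
  - by move=> y _; rewrite mule_ge0 // adde_ge0 // lee_fin powR_ge0.
  - by apply: measurable_funeM; exact: emeasurable_funD.
  apply: aeS f0 => y f0y _; rewrite /G -EFinD -EFinM lee_fin.
  have [Dy|Dy] := pselect (D y); last first.
    by rewrite f0y // cabs0 mulr_ge0 ?invr_ge0 ?(ltW m0) // addr_ge0 ?powR_ge0.
  rewrite indicE mem_set // mulrC ler_pdivlMr //.
  have a0 := cabs_ge0 (f y).
  apply: (@le_trans _ _ (cabs (f y) * wt y)); first by rewrite ler_wpM2l // Hm //; exact: DK.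
  have b0 : 0 <= cabs (f y) * wt y by rewrite mulr_ge0 ?wt_ge0.
  have [b1|b1] := leP (cabs (f y) * wt y) 1; first by rewrite (le_trans b1) // lerDl powR_ge0.
  by rewrite (le_trans (le1r_powR (ltW b1) p1)) // lerDr.
rewrite ge0_integralZl_EFin //; last 2 first.
- by move=> y _; rewrite adde_ge0 // lee_fin powR_ge0.
- exact: emeasurable_funD.
apply: lte_mul_pinfty => //; rewrite ge0_integralD //; last first.
  by move=> y _; rewrite lee_fin powR_ge0.
rewrite integral_indic // setIT; apply: lte_add_pinfty; first exact: lam_bB.
by have [_] := Lf; rewrite NpE.
Qed.

Let real_bound (s : R) u B : `|s| = 1 -> lam.-integrable setT (fun y : Borel X => (u y)%:E) ->
  borel B -> {ae lam, forall y, 0 <= s * u y} ->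
  `|Rintegral lam setT (fun y : Borel X => u y * \1_B y)| <=
  `|Rintegral lam setT (fun y : Borel X => u y)|.
Proof.
move=> s1 iu mB su.
have mu : measurable_fun setT (u : Borel X -> R).
  by apply/measurable_EFinP; exact: (measurable_int lam iu).
have iB : lam.-integrable setT (fun y : Borel X => (u y * \1_B y)%:E).
  apply: (le_integrable measurableT _ _ iu).
    by apply/measurable_EFinP; apply: measurable_funM => //; exact: measurable_indic.
  move=> y _; rewrite /= lee_fin normrM indicE.
  by case: (_ \in _); rewrite ?normr1 ?mulr1 // normr0 mulr0.
apply: le_trans (le_normr_Rintegral measurableT iB) _.
apply: (@le_trans _ _ (Rintegral lam setT (fun y : Borel X => s * u y))).
  have -> : Rintegral lam setT (fun y : Borel X => s * u y) =
      Rintegral lam setT (fun y : Borel X => `|u y|).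
    congr fine; apply: ae_eq_integral => //.
    - by apply/measurable_EFinP; exact: measurable_funM.
    - by apply/measurable_EFinP; exact: measurableT_comp.
    by apply: aeS su => y su _; rewrite -(ger0_norm su) normrM s1 mul1r.
  apply: le_Rintegral => //; try exact: integrable_norm.
  move=> y _; rewrite normrM indicE.
  by case: (_ \in _); rewrite ?normr1 ?mulr1 // normr0 mulr0.
rewrite RintegralZl //; apply: le_trans (ler_norm _) _.
by rewrite normrM s1 mul1r.
Qed.

(** When the real and imaginary parts keep a constant sign, restricting to [B] cannot increase the
    modulus of either integral; the factor 2 recombines the two parts. *)
Lemma quadrant_bound f B (s t : R) : mm f -> (absint f < +oo)%E -> borel B ->
  `|s| = 1 -> `|t| = 1 ->
  {ae lam, forall y, 0 <= s * cRe (f y)} -> {ae lam, forall y, 0 <= t * cIm (f y)} ->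
  cabs (ci (fun y => f y * ii B y)) <= 2 * cabs (ci f).
Proof.
move=> mf af mB s1 t1 sf tf; have [i1 i2] := absint_ReIm mf af.
have H1 := real_bound s1 i1 mB sf; have H2 := real_bound t1 i2 mB tf.
apply: le_trans (cabs_le _) _; rewrite mulr2n mulrDl mul1r; apply: lerD.
  apply: le_trans (cabs_Re _); apply: le_trans H1; rewrite le_eqVlt; apply/orP; left.
  by apply/eqP; congr `|_|; apply: eq_Rintegral => y _; rewrite cReM /= mulr0 subr0.
apply: le_trans (cabs_Im _); apply: le_trans H2; rewrite le_eqVlt; apply/orP; left.
by apply/eqP; congr `|_|; apply: eq_Rintegral => y _; rewrite cImM /= mulr0 add0r.
Qed.

End LocalIntegrability.

(** * Completeness of the complex numbers *)

Section Cauchy.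
Variable R : realType.

Lemma real_cauchy (u : nat -> R) : (forall e : R, 0 < e -> exists n, forall i,
  (n <= i)%N -> `|u n - u i| <= e) ->
  exists l, forall e : R, 0 < e -> exists n, forall i, (n <= i)%N -> `|l - u i| <= e.
Proof.
move=> H; have /cauchy_cvgP cu : cauchy (u @ \oo).
  apply: cauchy_exP => e e0; have [|n Hn] := H (e / 2); first by rewrite divr_gt0.
  exists (u n); exists n => // i /= /Hn ni; rewrite -ball_normE /=.
  by apply: le_lt_trans ni _; lra.
exists (limn u) => e e0; have /cvgrPdist_le/(_ _ e0)[n _ Hn] := cu.
by exists n => i ni; exact: Hn.
Qed.

Lemma complex_cauchy (c : nat -> C R) : (forall e : R, 0 < e -> exists n, forall i,
  (n <= i)%N -> cabs (c n - c i) <= e) ->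
  exists l, forall e : R, 0 < e -> exists n, forall i, (n <= i)%N -> cabs (l - c i) <= e.
Proof.
move=> H.
have [|a Ha] := @real_cauchy (fun n => cRe (c n)).
  move=> e /H[n Hn]; exists n => i /Hn; apply: le_trans.
  by rewrite -cReN -cReD cabs_Re.
have [|b Hb] := @real_cauchy (fun n => cIm (c n)).
  move=> e /H[n Hn]; exists n => i /Hn; apply: le_trans.
  by rewrite -cImN -cImD cabs_Im.
exists (complex.Complex a b) => e e0; have e2 : 0 < e / 2 by rewrite divr_gt0.
have [n Hn] := Ha _ e2; have [m Hm] := Hb _ e2.
exists (maxn n m) => i; rewrite geq_max => /andP[/Hn ni /Hm mi].
apply: le_trans (cabs_le _) _; rewrite cReD cReN cImD cImN /=; lra.
Qed.

End Cauchy.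

(** * Supports of images shrink to one point *)

Section Localization.
Variables (R : realType) (p : R) (X Y : walg p) (T : wiso X Y).
Implicit Types (x : X) (y z h : Y) (f g : X -> C R) (q : Y -> C R) (A B : set X).
Implicit Types (W N Q M E K : set Y).

Local Notation lamX := (@lam R p X).
Local Notation lamY := (@lam R p Y).
Let p1 : 1 <= p := walg_p Y.
Let p0 : 0 < p := p_gt0 Y.

Lemma ii_nonnull M : bB M -> lamY M <> 0%E -> exists2 b : R, 0 < b & NN (ii M) = b%:E.
Proof.
move=> bM M0; have [b b0 Eb] := LL_fin (LL_ind bM); exists b => //.
rewrite lt_def b0 andbT; apply/negP => /eqP bE; apply: M0; apply: lam_ii0; first exact: bM.1.
apply: NN_small0; first exact: mm_ii bM.1.
by move=> e e0; rewrite Eb bE lee_fin ltW.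
Qed.

Lemma open_nonnull (V : walg p) (U : set V) : open U -> U !=set0 -> lam U <> 0%E.
Proof. by move=> oU U0 UE; have := lam_open oU U0; rewrite UE ltxx. Qed.

Lemma cabs_of_NN M (b d r : R) (a : C R) : bB M -> 0 < b -> NN (ii M) = b%:E ->
  0 <= d -> 0 <= r ->
  (NN (fun z => a * ii M z)%R <= (d `^ p * b * r `^ p)%:E)%E -> cabs a <= d * r.
Proof.
move=> bM b0 Eb d0 r0; rewrite NNZ; last exact: mm_ii bM.1.
rewrite Eb -EFinM lee_fin mulrAC ler_pM2r // -powRM // => H.
rewrite leNgt; apply/negP => lt; move: H; rewrite leNgt => /negP; apply.
by apply: gt0_ltr_powR; rewrite ?nnegrE ?cabs_ge0 // mulr_ge0.
Qed.

Lemma quotient_nbhs h Q : open Q -> Q (gi h) -> exists W N,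
  [/\ open W, W h, bB W, open N & [/\ N ge, bB N &
      forall y z, W y -> N z -> Q (gm (gi y) z)]].
Proof.
move=> oQ Qh.
have cd : continuous (fun w : Y * Y => gm (gi w.1) w.2).
  apply: cont_gm2; first by apply: cont_gi => w; exact: cvg_fst.
  by move=> w; exact: cvg_snd.
have : nbhs (h, ge : Y) ((fun w : Y * Y => gm (gi w.1) w.2) @^-1` Q).
  by apply: cd; apply: open_nbhs_nbhs; split => //=; rewrite gm1.
move=> [[W0 N0] [/= /bB_nbhs[W [oW Wh WW0 bW]] /bB_nbhs[N [oN Ne NN0 bN]]] sub].
exists W, N; split => //; split => // y z Wy Nz.
by apply: (sub (y, z)); split => /=; [exact: WW0 | exact: NN0].
Qed.

(** The indicator of [Q] equals 1 wherever [T (ii A)] is carried, so the value does not depend on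
    [z]. This is how the integral of [T (ii A)] is read from a convolution. *)
Lemma conv_on_plateau A W N Q z : bB A -> bB Q ->
  {ae lamY, forall y, ~ W y -> T (ii A) y = 0} ->
  (forall y, W y -> Q (gm (gi y) z)) -> cv (T (ii A)) (ii Q) z = ci (T (ii A)).
Proof.
move=> bA bQ TW WQ; have LA := wT_LL T (LL_ind bA); have LQ := LL_ind bQ.
rewrite cvE; apply: ci_ae; [by apply: mm_cvi; exact: LL_mm|exact: LL_mm|].
apply: aeS TW => y TW; rewrite /cvi; have [Wy|Wy] := pselect (W y).
  by rewrite iiT ?mulr1 //; exact: WQ.
by rewrite TW // mul0r.
Qed.

(* Otherwise the integrals of [T 1_A] are [o(lam A)]; cutting [A] so that [T 1_A] takes values in
   one quadrant, no cancellation occurs and [conv_vanish] gives a contradiction. *)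
Lemma cluster_nonvanish x h Q g : (forall W, open W -> W h -> charged T x W) ->
  open Q -> bB Q -> Q (gi h) -> LL g -> {ae lamY, forall y, T g y = ii Q y} ->
  exists N, [/\ open N, N ge & {ae lamY, forall z, N z -> T (tr x g) z <> 0}].
Proof.
move=> ch oQ bQ Qh Lg Tg.
have [W [N [oW Wh bW oN [Ne bN WNQ]]]] := quotient_nbhs oQ Qh.
exists N; split => //; apply: contrapT => nH.
pose v := T (tr x g); have Lt := LL_tr x Lg; have Lv : LL v := wT_LL T Lt.
(* On [M] the approximation compares the integral of [T (ii A)] with 0, which bounds it as soon as
   [M] is non-null. *)
pose M := N `&` [set z | v z = 0].
have mv0 : borel [set z | v z = 0] by apply: (@measurable_eq0 _ (Borel Y)); exact: LL_mm.
have bM : bB M by exact: bBI.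
have M0 : lamY M <> 0%E.
  move=> M0; apply: nH; move/(negligibleP _ bM.1): M0; apply: negligibleS => z /=.
  by move=> /not_implyP[Nz /contrapT vz].
have [b b0 Eb] := ii_nonnull bM M0.
have [Q1 cQ1 Q10] := nonnull_compact Y; have bQ1 := compact_bB cQ1.
apply: Q10; apply: (@conv_vanish _ _ _ _ T x) => // K U e cK Ux e0.
(* Half of [e], against the factor 2 of [quadrant_bound]. *)
pose d := e / 2; have d0 : 0 < d by rewrite divr_gt0.
have e1 : 0 < d `^ p * b by rewrite mulr_gt0 // powR_gt0.
have [U1 U1x H1] := wT_approx x Lg (LL_ind bQ) Tg e1.
have [A0 [bA0 A0U TA0]] := ch W oW Wh _ (filterI Ux U1x).
have LTA0 := wT_LL T (LL_ind bA0); have [mr mi] := LL_mm LTA0.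
(* The signs [s] and [t] single out a closed quadrant for the values of [T (ii A0)]. The four
   quadrants cover the plane, so [T (ii A0)] is nonzero on a non-null part of one of them. *)
pose Z (s t : R) := W `&` [set y | 0 <= s * cRe (T (ii A0) y)] `&`
  [set y | 0 <= t * cIm (T (ii A0) y)].
have mZ s t : borel (Z s t).
  have aux (r : R) (u : Y -> R) : measurable_fun setT (u : Borel Y -> R) ->
      borel [set y | 0 <= r * u y].
    move=> mu; have -> : [set y | 0 <= r * u y] =
        [set: Borel Y] `&` (fun y => r * u y) @^-1` `[0, +oo[%classic.
      by rewrite setTI; apply/seteqP; split => y /=; rewrite in_itv /= andbT.
    have mru : measurable_fun setT (fun y : Borel Y => r * u y) by exact: measurable_funM.
    exact: mru.
  apply: measurableI; last exact: aux.
  by apply: measurableI; [exact: open_borel | exact: aux].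
have [s [t [s1 t1 TZ]]] : exists s t : R, [/\ `|s| = 1, `|t| = 1 &
    ~ {ae lamY, forall y, Z s t y -> T (ii A0) y = 0}].
  apply: contrapT => nst.
  have H s t : `|s| = 1 -> `|t| = 1 -> {ae lamY, forall y, Z s t y -> T (ii A0) y = 0}.
    by move=> s1 t1; apply: contrapT => nZ; apply: nst; exists s, t.
  apply: TA0; have n1 : `|1 : R| = 1 by exact: normr1.
  have nN1 : `|(-1) : R| = 1 by exact: normrN1.
  apply: aeS2 (aeI (H _ _ n1 n1) (H _ _ n1 nN1)) (aeI (H _ _ nN1 n1) (H _ _ nN1 nN1)).
  move=> y [H11 H1N] [HN1 HNN] Wy; rewrite /Z /= !mul1r !mulN1r !oppr_ge0 in H11 H1N HN1 HNN.
  have [r0|/ltW r0] := leP 0 (cRe (T (ii A0) y));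
  have [i0|/ltW i0] := leP 0 (cIm (T (ii A0) y));
  by [apply: H11 | apply: H1N | apply: HN1 | apply: HNN].
have [A [bA AA0 TA]] := wT_sub T bA0 (mZ s t).
have LTA := wT_LL T (LL_ind bA); pose I := ci (T (ii A)).
have TAW : {ae lamY, forall y, ~ W y -> T (ii A) y = 0}.
  by apply: aeS TA => y -> Wy; rewrite iiF ?mul0r // => -[[]].
have aA := LL_absint LTA bW TAW.
exists A; split => //.
- by move=> a /AA0/A0U[].
- apply: (rl_gt0P (T := T)) => // TA'; apply: TZ.
  by apply: aeS2 TA TA' => y E + Zy; rewrite E iiT // mul1r.
move=> z _.
have Ile : cabs I <= d * rl A.
  apply: (cabs_of_NN bM b0 Eb (ltW d0) (rl_ge0 A)).
  apply: le_trans (H1 A bA (fun a Aa => (A0U a (AA0 a Aa)).2)).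
  apply: le_NNW.
  - by apply: mmZ; exact: mm_ii bM.1.
  - by apply: mmB; [exact/LL_mm/LL_cv/LL_ind | apply: mmZ; exact: LL_mm].
  move=> z'; have [[Nz vz]|Mz] := pselect (M z'); last first.
    by rewrite (iiF Mz) mulr0 cabs0 cabs_ge0.
  rewrite iiT // mulr1 (conv_on_plateau N bA bQ TAW) ?[T (tr x g) z']vz ?mulr0 ?subr0 //.
  by move=> y Wy; exact: WNQ.
pose B := [set y | Q1 (gm (gi y) z)].
have mB : borel B.
  by apply: (borel_comp (X := Y) (Y := Y)); [exact: cont_div | exact: bQ1.1].
have -> : cv (T (ii A)) (ii Q1) z = ci (fun y => T (ii A) y * ii B y).
  by rewrite cvE; congr (ci _).
have H2 : cabs (ci (fun y => T (ii A) y * ii B y)) <= 2 * cabs I.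
  apply: (quadrant_bound (LL_mm LTA) aA mB s1 t1).
    apply: aeS TA => y ->; have [Zy|Zy] := pselect (Z s t y); last first.
      by rewrite (iiF Zy) mul0r mulr0.
    by rewrite (iiT Zy) mul1r; case: Zy => -[].
  apply: aeS TA => y ->; have [Zy|Zy] := pselect (Z s t y); last first.
    by rewrite (iiF Zy) mul0r mulr0.
  by rewrite (iiT Zy) mul1r; case: Zy.
by apply: le_trans H2 _; move: Ile; rewrite /d; lra.
Qed.

Lemma chargedS x W N : W `<=` N -> charged T x W -> charged T x N.
Proof.
move=> WN cW U /cW[A [bA AU TA]]; exists A; split => // H; apply: TA.
by apply: aeS H => y Hy /WN; exact: Hy.
Qed.

Lemma nbhs_bB x U : nbhs x U -> exists A, [/\ bB A, A `<=` U & 0 < rl A].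
Proof.
move=> /bB_nbhs[A [oA Ax AU bA]]; exists A; split => //.
have : (0 < lamX A)%E by apply: lam_open => //; exists x.
by rewrite rlE // lte_fin.
Qed.

(* Two cluster points [h], [h'] would make [T (L_x g1)] and [T (L_x g2)] both nonzero near the unit,
   where [T g1], [T g2] are indicators of disjoint neighbourhoods of [h^-1], [h'^-1]. *)
Lemma wT_local x : exists h, forall W, open W -> W h ->
  exists2 U, nbhs x U & forall A, bB A -> A `<=` U ->
    {ae lamY, forall y, ~ W y -> T (ii A) y = 0}.
Proof.
have cT : charged T x setT.
  move=> U /nbhs_bB[A [bA AU rA]]; exists A; split => // TA.
  have := wT0V (T := T) (LL_ind bA) (aeS (fun y (H : setT y -> T (ii A) y = 0) => H I) TA).
  by move=> /(lam_ii0 bA.1); rewrite rlE // => -[] A0; rewrite A0 ltxx in rA.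
have [h Hh] := charged_cluster (@measurableT _ (Borel Y)) cT.
have {}Hh W : open W -> W h -> charged T x W.
  by move=> oW Wh; apply: chargedS (Hh W oW Wh) => y [].
exists h => W oW Wh; apply: contrapT => nU.
(* Failure of localization at [W] leaves its complement charged, which yields a second cluster
   point. *)
have cW : charged T x (~` W).
  by apply: contrapT => /not_charged.
have mW : borel (~` W) by apply: measurableC; exact: open_borel.
have [h' Hh'] := charged_cluster mW cW.
have hh : gi h <> gi h'.
  move=> /(congr1 gi); rewrite !giK => hh; rewrite hh in Wh.
  have [A [_ _]] := Hh' W oW Wh _ (@filterT _ (nbhs x) _).
  by apply; apply: aeT => y [].
have {}Hh' N : open N -> N h' -> charged T x N.
  by move=> oN Nh; apply: chargedS (Hh' N oN Nh) => y [].
have [P1 [P2 [oP1 oP2 P1h P2h dis]]] := hausdorff_sep hh.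
have [Q1 [oQ1 Q1h QP1 bQ1]] := bB_nbhs (open_nbhs_nbhs (conj oP1 P1h)).
have [Q2 [oQ2 Q2h QP2 bQ2]] := bB_nbhs (open_nbhs_nbhs (conj oP2 P2h)).
have [g1 Lg1 Tg1] := wT_surj T (LL_ind bQ1).
have [g2 Lg2 Tg2] := wT_surj T (LL_ind bQ2).
have [N1 [oN1 N1e v1]] := cluster_nonvanish Hh oQ1 bQ1 Q1h Lg1 Tg1.
have [N2 [oN2 N2e v2]] := cluster_nonvanish Hh' oQ2 bQ2 Q2h Lg2 Tg2.
have g12 : {ae lamX, forall x', g1 x' * g2 x' = 0}.
  apply: (wT_sepV (w := T)) => //; apply: aeS2 Tg1 Tg2 => y -> ->.
  have [Q1y|Q1y] := pselect (Q1 y); last by rewrite (iiF Q1y) mul0r.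
  rewrite [ii Q2 y]iiF ?mulr0 // => Q2y.
  exact: (dis y (QP1 _ Q1y) (QP2 _ Q2y)).
have v12 : {ae lamY, forall y, T (tr x g1) y * T (tr x g2) y = 0}.
  by apply: (wT_sep T); [exact: LL_tr | exact: LL_tr | exact: (ae_shift (gi x) g12)].
have oN : open (N1 `&` N2) by exact: openI.
apply: (open_nonnull oN); first by exists ge.
apply/(negligibleP _ (open_borel oN)).
apply: negligibleS (aeI v1 (aeI v2 v12)) => y [N1y N2y] [/(_ N1y) a1 [/(_ N2y) a2 /eqP]].
by rewrite mulf_eq0 => /orP[/eqP|/eqP].
Qed.

End Localization.

(** * The image of a translation is a multiple of a translation *)

Section TranslationLaw.
Variables (R : realType) (p : R) (X Y : walg p) (T : wiso X Y).
Implicit Types (x : X) (y z h : Y) (f g : X -> C R) (q : Y -> C R) (A B : set X).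
Implicit Types (W N Q M E K : set Y) (a c : C R).

Local Notation lamX := (@lam R p X).
Local Notation lamY := (@lam R p Y).
Let p1 : 1 <= p := walg_p X.
Let p0 : 0 < p := p_gt0 X.

Definition localizes x h := forall W, open W -> W h ->
  exists2 U, nbhs x U & forall A, bB A -> A `<=` U ->
    {ae lamY, forall y, ~ W y -> T (ii A) y = 0}.

(** [c] is the derivative at [x], with respect to Haar measure, of the set function that sends [A]
    to the integral of [T (ii A)]. *)
Definition density_at x c := forall d : R, 0 < d -> exists2 U, nbhs x U &
  forall A, bB A -> A `<=` U -> cabs (ci (T (ii A)) - rc (rl A) * c) <= d * rl A.

(** On a neighbourhood [N] of the unit the convolution of [T (ii A)] with the indicator of [Q] is
    the constant [ci (T (ii A))]. Hence [v] is on [N] a limit in norm of constants; these are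
    Cauchy, [v] equals their limit [c], and comparing any small [A] with [v] on [N] gives the
    derivative. *)
Lemma density_exists x h : localizes x h -> exists c, density_at x c.
Proof.
move=> loc.
have [Q [oQ Qh _ bQ]] := bB_nbhs (@filterT _ (nbhs (gi h)) _).
have [W [N [oW Wh bW oN [Ne bN WNQ]]]] := quotient_nbhs oQ Qh.
have LQ := LL_ind bQ; have [g Lg Tg] := wT_surj T LQ.
pose v := T (tr x g); have Lv : LL v := wT_LL T (LL_tr x Lg); have mv := LL_mm Lv.
have mN := bN.1.
have [b b0 Eb] := ii_nonnull bN (open_nonnull oN (ex_intro _ _ Ne)).
have [U0 U0x H0] := loc W oW Wh.
have key (e : R) : 0 < e -> exists2 U, nbhs x U & forall A, bB A -> A `<=` U ->
    (NN (fun z => ii N z * (ci (T (ii A)) - rc (rl A) * v z))%R <= (e * rl A `^ p)%:E)%E.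
  move=> e0; have [U1 U1x H1] := wT_approx x Lg LQ Tg e0.
  exists (U0 `&` U1); first exact: filterI.
  move=> A bA AU; have LTA := wT_LL T (LL_ind bA).
  apply: le_trans (H1 A bA (fun t At => (AU t At).2)).
  have mv' : mm (fun z => rc (rl A) * v z) by exact: mmZ.
  apply: le_NNW.
  - by apply: mm_indM => //; apply: mmB => //; exact: mm_cst.
  - by apply: mmB => //; exact/LL_mm/LL_cv.
  move=> z; have [Nz|Nz] := pselect (N z); last first.
    by rewrite (iiF Nz) mul0r cabs0 cabs_ge0.
  rewrite iiT // mul1r (conv_on_plateau N bA bQ (H0 A bA (fun t At => (AU t At).1))) //.
  by move=> y Wy; exact: WNQ.
have key' (e : R) : 0 < e -> exists c, (NN (fun z => ii N z * (c - v z))%R <= e%:E)%E.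
  move=> e0; have [U Ux H] := key _ e0; have [A [bA AU rA]] := nbhs_bB Ux.
  exists ((rc (rl A))^-1 * ci (T (ii A))).
  have rA0 : rc (rl A) != 0 :> C R by rewrite -cabs_gt0 cabs_rc ger0_norm ?rl_ge0.
  apply: (NN_cancel rA); first by apply: mm_indM => //; apply: mmB => //; exact: mm_cst.
  apply: le_trans (H A bA AU); rewrite le_eqVlt; apply/orP; left; apply/eqP; congr NN.
  by apply/funext => z; field.
pose en n : R := n.+1%:R^-1.
have en0 n : 0 < en n by rewrite invr_gt0.
have [c_ Hc] := choice (fun n => key' _ (en0 n)).
have mNc c : mm (fun z => ii N z * (c - v z)).
  by apply: mm_indM => //; apply: mmB => //; exact: mm_cst.
have dist (c c' : C R) (e e' : R) : (NN (fun z => ii N z * (c - v z))%R <= e%:E)%E ->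
    (NN (fun z => ii N z * (c' - v z))%R <= e'%:E)%E ->
    cabs (c - c') `^ p * b <= 2 `^ p * (e + e').
  move=> H H'; rewrite -lee_fin EFinM -Eb -NNZ; last exact: mm_ii.
  have {}H' : (NN (fun z => -1 * (ii N z * (c' - v z)))%R <= e'%:E)%E.
    by rewrite NNZ // cabsN cabs1 powR1 mul1e.
  apply: le_trans (NND_le (mNc c) (mmZ (-1) (mNc c')) H H').
  rewrite le_eqVlt; apply/orP; left; apply/eqP; congr NN; apply/funext => z; ring.
have [c Hlim] : exists c, forall e : R, 0 < e -> exists n, forall i, (n <= i)%N ->
    cabs (c - c_ i) <= e.
  apply: complex_cauchy => e e0.
  pose d : R := e `^ p * b / (2 `^ p * 2).
  have q0 : 0 < (2 : R) `^ p by exact: powR_gt0.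
  have d0 : 0 < d by rewrite divr_gt0 ?mulr_gt0 ?powR_gt0.
  have [n nd] := @ltr_add_invr R 0 d d0; rewrite add0r in nd.
  exists n => i ni.
  have ein : en i <= en n by rewrite /en lef_pV2 ?posrE // ler_nat ltnS.
  have := dist _ _ _ _ (Hc n) (Hc i) => /le_trans/(_ (_ : _ <= e `^ p * b)) H.
  have {}H : cabs (c_ n - c_ i) `^ p <= e `^ p.
    rewrite -(ler_pM2r b0); apply: H.
    apply: (@le_trans _ _ (2 `^ p * (d + d))).
      by rewrite ler_pM2l //; apply: lerD; [exact: ltW | exact: le_trans ein (ltW nd)].
    by rewrite le_eqVlt; apply/orP; left; apply/eqP; rewrite /d; field; rewrite gt_eqF.
  rewrite leNgt; apply/negP => lt; move: H; rewrite leNgt => /negP; apply.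
  by apply: gt0_ltr_powR; rewrite ?nnegrE ?cabs_ge0 // ltW.
have vc : {ae lamY, forall z, N z -> c - v z = 0}.
  apply: NN_small0_on => //; first by apply: mmB => //; exact: mm_cst.
  move=> e e0; have q0 : 0 < (2 : R) `^ p by exact: powR_gt0.
  have e2 : 0 < e / (2 `^ p * 2) by rewrite divr_gt0 // mulr_gt0.
  have [d d0 db] := powR_small p1 b e2.
  have [n Hn] := Hlim _ d0.
  have [m nd] := @ltr_add_invr R 0 _ e2; rewrite add0r in nd.
  pose i := maxn n m.
  have H1 : (NN (fun z => (c - c_ i) * ii N z)%R <= (e / (2 `^ p * 2))%:E)%E.
    rewrite NNZ; last exact: mm_ii.
    rewrite Eb -EFinM lee_fin (le_trans _ db) // mulrC ler_wpM2l ?(ltW b0) //.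
    by rewrite le_powR ?cabs_ge0 // Hn // leq_maxl.
  have H2 : (NN (fun z => ii N z * (c_ i - v z))%R <= (e / (2 `^ p * 2))%:E)%E.
    apply: le_trans (Hc i) _; rewrite lee_fin (le_trans _ (ltW nd)) //.
    by rewrite /en lef_pV2 ?posrE // ler_nat ltnS leq_maxr.
  have := NND_le (mmZ (c - c_ i) (mm_ii mN)) (mNc (c_ i)) H1 H2.
  have -> : 2 `^ p * (e / (2 `^ p * 2) + e / (2 `^ p * 2)) = e.
    by field; rewrite gt_eqF.
  apply: le_trans; rewrite le_eqVlt; apply/orP; left; apply/eqP; congr NN.
  by apply/funext => z; ring.
exists c => d d0.
have [U Ux H] := key (d `^ p * b) (mulr_gt0 (powR_gt0 _ d0) b0).
exists U => // A bA AU; apply: (cabs_of_NN bN b0 Eb (ltW d0) (rl_ge0 A)).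
apply: le_trans (H A bA AU); rewrite le_eqVlt; apply/orP; left; apply/eqP.
apply: eq_NN.
- by apply: mmZ; exact: mm_ii.
- apply: mm_indM => //; apply: mmB; first exact: mm_cst.
  exact: mmZ.
apply: aeS vc => z vz; have [Nz|Nz] := pselect (N z); last by rewrite (iiF Nz) mul0r mulr0.
move/eqP: (vz Nz); rewrite subr_eq0 => /eqP <-; ring.
Qed.

(** The estimate of [wT_approx] is divided by [rl A] while [A] shrinks to [x]. It serves with
    [a = 0] off the support and with [a = 1] on a plateau. *)
Lemma limit_value x c a g E K : density_at x c -> LL g -> bB E ->
  {ae lamY, forall y, T g y = ii E y} -> bB K ->
  (exists2 U, nbhs x U & forall A, bB A -> A `<=` U -> forall z, K z ->
     cv (T (ii A)) (ii E) z = a * ci (T (ii A))) ->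
  {ae lamY, forall z, K z -> T (tr x g) z = a * c}.
Proof.
move=> dc Lg bE Tg bK [U0 U0x H0].
pose v := T (tr x g); have Lv : LL v := wT_LL T (LL_tr x Lg); have mv := LL_mm Lv.
have mK := bK.1; have LE := LL_ind bE.
have [b b0 Eb] := LL_fin (LL_ind bK).
have md : mm (fun z => v z - a * c) by apply: mmB => //; exact: mm_cst.
suff H : {ae lamY, forall z, K z -> v z - a * c = 0}.
  by apply: aeS H => z H Kz; apply/eqP; rewrite -subr_eq0; apply/eqP; exact: H.
apply: NN_small0_on => // e e0.
have q0 : 0 < (2 : R) `^ p by exact: powR_gt0.
have e2 : 0 < e / (2 `^ p * 2) by rewrite divr_gt0 // mulr_gt0.
have [d d0 db] := powR_small p1 (cabs a `^ p * b) e2.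
have [U1 U1x H1] := wT_approx x Lg LE Tg e2.
have [U2 U2x H2] := dc _ d0.
have [A [bA AU rA]] := nbhs_bB (filterI U0x (filterI U1x U2x)).
have LTA := wT_LL T (LL_ind bA).
have {}H1 := H1 A bA (fun t At => (AU t At).2.1).
have {}H2 := H2 A bA (fun t At => (AU t At).2.2).
have {}H0 := H0 A bA (fun t At => (AU t At).1).
apply: (NN_cancel rA); first exact: mm_indM.
pose I := ci (T (ii A)); pose r := rl A.
pose F z := cv (T (ii A)) (ii E) z - rc r * v z.
have mF : mm F by apply: mmB; [exact/LL_mm/LL_cv | exact: mmZ].
have mF' : mm (fun z => -1 * (ii K z * F z)) by apply: mmZ; exact: mm_indM.
have H3 : (NN (fun z => -1 * (ii K z * F z))%R <= (e / (2 `^ p * 2) * r `^ p)%:E)%E.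
  rewrite NNZ; last exact: mm_indM.
  by rewrite cabsN cabs1 powR1 mul1e (le_trans (le_NN_indM mK mF)).
have H4 : (NN (fun z => (a * (I - rc r * c)) * ii K z)%R <= (e / (2 `^ p * 2) * r `^ p)%:E)%E.
  rewrite NNZ; last exact: mm_ii.
  rewrite Eb -EFinM lee_fin.
  apply: (@le_trans _ _ ((cabs a * (d * r)) `^ p * b)).
    rewrite ler_wpM2r // le_powR ?cabs_ge0 // cabsM ler_wpM2l ?cabs_ge0 //.
  rewrite !powRM ?cabs_ge0 ?mulr_ge0 ?rl_ge0 ?(ltW d0) //.
  apply: (@le_trans _ _ (cabs a `^ p * b * d `^ p * r `^ p)).
    by rewrite le_eqVlt; apply/orP; left; apply/eqP; ring.
  by rewrite ler_wpM2r // powR_ge0.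
have := NND_le mF' (mmZ (a * (I - rc r * c)) (mm_ii mK)) H3 H4.
have -> : 2 `^ p * (e / (2 `^ p * 2) * r `^ p + e / (2 `^ p * 2) * r `^ p) = e * r `^ p.
  by field; rewrite gt_eqF.
apply: le_trans; rewrite le_eqVlt; apply/orP; left; apply/eqP; congr NN.
apply/funext => z; rewrite /F; have [Kz|Kz] := pselect (K z); last first.
  by rewrite (iiF Kz) !mul0r !mulr0 addr0.
by rewrite H0 // iiT //; rewrite /I /r; ring.
Qed.

Lemma open_sub_nbhs h W : nbhs h W -> exists W', [/\ open W', W' h & W' `<=` W].
Proof. by rewrite nbhsE => -[W' [? ?] ?]; exists W'. Qed.

Lemma conv_off_support A W K z : bB A -> bB K ->
  {ae lamY, forall y, ~ W y -> T (ii A) y = 0} ->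
  (forall y, W y -> ~ K (gm (gi y) z)) -> cv (T (ii A)) (ii K) z = 0.
Proof.
move=> bA bK TW WK; have LA := wT_LL T (LL_ind bA); have LK := LL_ind bK.
rewrite cvE (@ci_ae _ _ _ _ (fun=> 0)); first by rewrite ci_rc integral0.
- by apply: mm_cvi; exact: LL_mm.
- exact: mm_cst.
apply: aeS TW => y TW; rewrite /cvi; have [Wy|Wy] := pselect (W y).
  by rewrite iiF ?mulr0 //; exact: WK.
by rewrite TW // mul0r.
Qed.

(** The bound is expressed through [T g], which is what lets the law pass to limits of [T g]. *)
Lemma NN_wTtr x : exists2 M : R, 0 <= M & forall g, LL g ->
  (NN (T (tr x g)) <= M%:E * NN (T g))%E.
Proof.
have [M1 M10 H1] := wT_bd T; have [M2 M20 H2] := wT_bdV T.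
exists (M1 * (wt x `^ p * M2)); first by rewrite !mulr_ge0 ?powR_ge0.
move=> g Lg; apply: le_trans (H1 _ (LL_tr x Lg)) _.
rewrite !EFinM -!muleA; apply: lee_wpmul2l; first by rewrite lee_fin.
apply: le_trans (NN_tr x (LL_mm Lg)) _; apply: lee_wpmul2l; first by rewrite lee_fin powR_ge0.
exact: H2.
Qed.

(** Off [h K] the convolutions vanish eventually on each compact set, and [locally_ae0] concludes. A
    point of [h K] need not be interior to it, so the plateau argument fails for [K] itself; it is
    applied to an open [Q] around [K] of small excess, and [NN_wTtr] bounds the error. *)
Lemma law_compact x h c K g : localizes x h -> density_at x c -> compact K -> LL g ->
  {ae lamY, forall y, T g y = ii K y} ->
  {ae lamY, forall z, T (tr x g) z = c * ii (shift h K) z}.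
Proof.
move=> loc dc cK Lg Tg; have bK := compact_bB cK.
pose v := T (tr x g); have Lv : LL v := wT_LL T (LL_tr x Lg); have mv := LL_mm Lv.
have chK : compact (shift h K) := compact_shift cK; have mhK := compact_borel chK.
have off : {ae lamY, forall z, (~` shift h K) z -> v z = 0}.
  apply: locally_ae0 => //; first exact: measurableC.
  move=> D cD DK.
  have H : {ae lamY, forall z, D z -> v z = 0 * c}.
    apply: (limit_value dc Lg bK Tg (compact_bB cD)).
    have [|W [oW Wh WD]] := @open_sub_nbhs h [set y | forall k, K k -> (~` D) (gm y k)].
      apply: (@tube _ _ Y Y Y K (~` D) gm) => //.
      - by apply: cont_gm2 => w; [exact: cvg_snd | exact: cvg_fst].
      - by apply: closed_openC; exact: compact_closed (@hausX _ _ Y) cD.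
      - by move=> k Kk Dk; apply: (DK _ Dk); exists k.
    have [U Ux HU] := loc W oW Wh; exists U => // A bA AU z Dz; rewrite mul0r.
    apply: (conv_off_support bA bK (HU A bA AU)) => y Wy Kyz.
    by apply: (WD y Wy _ Kyz); rewrite gmVK.
  by apply: aeS H => z Hz /Hz; rewrite mul0r.
have on : {ae lamY, forall z, shift h K z -> v z - c = 0}.
  apply: NN_small0_on => //; first by apply: mmB => //; exact: mm_cst.
  have [M M0 HM] := NN_wTtr x.
  have M1 : 0 < M + 1 by rewrite ltr_wpDl.
  move=> e e0; have [Q [oQ KQ bQ NQ]] := Np_outer cK (divr_gt0 e0 M1).
  have LQ := LL_ind bQ; have [gQ LgQ TgQ] := wT_surj T LQ.
  have vQ : {ae lamY, forall z, shift h K z -> T (tr x gQ) z = 1 * c}.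
    apply: (limit_value dc LgQ bQ TgQ (compact_bB chK)).
    have [|W [oW Wh WD]] := @open_sub_nbhs h [set y | forall k, shift h K k -> Q (gm (gi y) k)].
      apply: (@tube _ _ Y Y Y (shift h K) Q (fun y k => gm (gi y) k)) => //.
      - apply: cont_gm2; last by move=> w; exact: cvg_fst.
        by apply: cont_gi => w; exact: cvg_snd.
      - by move=> _ [k Kk <-]; rewrite gmK; exact: KQ.
    have [U Ux HU] := loc W oW Wh; exists U => // A bA AU z hKz; rewrite mul1r.
    by apply: (conv_on_plateau setT bA bQ (HU A bA AU)) => y Wy; exact: WD.
  pose gd (x' : X) := g x' - gQ x'; have Lgd : LL gd := LLB Lg LgQ.
  apply: (@le_trans _ _ (NN (T (tr x gd)))).
    apply: le_NN; [by apply: mm_indM => //; apply: mmB => //; exact: mm_cst| |].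
      exact: LL_mm (wT_LL T (LL_tr x Lgd)).
    apply: aeS2 vQ (wTB T (LL_tr x Lg) (LL_tr x LgQ)) => z vQz Ez.
    have [Kz|Kz] := pselect (shift h K z); last by rewrite (iiF Kz) mul0r cabs0 cabs_ge0.
    by rewrite (iiT Kz) mul1r [T (tr x gd) z]Ez vQz // mul1r.
  apply: le_trans (HM _ Lgd) _.
  have -> : NN (T gd) = NN (ii (Q `\` K)).
    rewrite [RHS](_ : _ = NN (fun z => -1 * ii (Q `\` K) z)); last first.
      rewrite NNZ ?cabsN ?cabs1 ?powR1 ?mul1e //.
      by apply: mm_ii; apply: measurableD; [exact: bQ.1 | exact: bK.1].
    apply: eq_NN; first exact: LL_mm (wT_LL T Lgd).
      by apply: mmZ; apply: mm_ii; apply: measurableD; [exact: bQ.1 | exact: bK.1].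
    apply: aeS3 Tg TgQ (wTB T Lg LgQ) => z E1 E2 ->; rewrite E1 E2.
    by rewrite (ii_split Q K) (setIidr KQ); ring.
  apply: (@le_trans _ _ (M%:E * (e / (M + 1))%:E)%E).
    by apply: lee_wpmul2l => //; rewrite lee_fin.
  by rewrite -EFinM lee_fin mulrA ler_pdivrMr // mulrC ler_wpM2l ?(ltW e0) // lerDl.
apply: aeS2 on off => z Hon Hoff; have [Kz|Kz] := pselect (shift h K z).
  by rewrite (iiT Kz) mulr1; apply/eqP; rewrite -subr_eq0; apply/eqP; exact: Hon.
by rewrite (iiF Kz) mulr0; exact: Hoff.
Qed.

(** The density induction runs over [q = T g], because the law is known when this image, rather than
    [g], is the indicator of a compact set. *)
Lemma law_all x h c : localizes x h -> density_at x c ->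
  forall g, LL g -> {ae lamY, forall z, T (tr x g) z = c * tr h (T g) z}.
Proof.
move=> loc dc.
suff H q : LL q -> forall g, LL g -> {ae lamY, forall y, T g y = q y} ->
    {ae lamY, forall z, T (tr x g) z = c * tr h q z}.
  by move=> g Lg; apply: (H (T g)) => //; [exact: wT_LL | exact: aeT].
move: q; apply: LL_induct.
- move=> K cK g Lg Tg; rewrite tr_ii; exact: law_compact.
- move=> q1 q2 Lq1 Lq2 H1 H2 g Lg Tg.
  have [g1 Lg1 Tg1] := wT_surj T Lq1; have [g2 Lg2 Tg2] := wT_surj T Lq2.
  have gE : {ae lamX, forall x', g x' = g1 x' + g2 x'}.
    apply: (wT_inj (w := T)) => //; first exact: LLD.
    by apply: aeS2 Tg (aeI (wTD T Lg1 Lg2) (aeI Tg1 Tg2)) => y -> [-> [-> ->]].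
  have L1 := LL_tr x Lg1; have L2 := LL_tr x Lg2.
  have E := wT_ae T (LL_tr x Lg) (LLD L1 L2) (ae_shift (gi x) gE).
  apply: aeS3 E (wTD T L1 L2) (aeI (H1 _ Lg1 Tg1) (H2 _ Lg2 Tg2)) => z -> -> [-> ->].
  by rewrite -mulrDr.
- move=> a q Lq H g Lg Tg; have [g1 Lg1 Tg1] := wT_surj T Lq.
  have gE : {ae lamX, forall x', g x' = a * g1 x'}.
    apply: (wT_inj (w := T)) => //; first exact: LLZ.
    by apply: aeS3 Tg (wTZ T a Lg1) Tg1 => y -> -> ->.
  have L1 := LL_tr x Lg1.
  have E := wT_ae T (LL_tr x Lg) (LLZ a L1) (ae_shift (gi x) gE).
  apply: aeS3 E (wTZ T a L1) (H _ Lg1 Tg1) => z -> -> ->.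
  by rewrite mulrCA.
- move=> q Lq H g Lg Tg.
  have Lv := wT_LL T (LL_tr x Lg); have Lw := LLZ c (LL_tr h Lq).
  suff E : {ae lamY, forall z, T (tr x g) z - c * tr h q z = 0}.
    by apply: aeS E => z /eqP; rewrite subr_eq0 => /eqP.
  apply: NN_small0; first exact: LL_mm (LLB Lv Lw).
  have [M M0 HM] := NN_wTtr x.
  pose k := 2 `^ p * (M + cabs c `^ p * wt h `^ p).
  have k0 : 0 <= k by rewrite mulr_ge0 ?addr_ge0 ?mulr_ge0 ?powR_ge0.
  have k1 : 0 < k + 1 by rewrite ltr_wpDl.
  move=> e e0; have d0 : 0 < e / (k + 1) by rewrite divr_gt0.
  have [q' [Lq' H' Nq]] := H _ d0; have [g' Lg' Tg'] := wT_surj T Lq'.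
  have E' := H' _ Lg' Tg'.
  pose gd (x' : X) := g x' - g' x'; have Lgd : LL gd := LLB Lg Lg'.
  pose qd z := q z - q' z; have Lqd : LL qd := LLB Lq Lq'.
  have N1 : (NN (T (tr x gd)) <= (M * (e / (k + 1)))%:E)%E.
    apply: le_trans (HM _ Lgd) _; rewrite EFinM; apply: lee_wpmul2l; first by rewrite lee_fin.
    apply: le_trans Nq; rewrite le_eqVlt; apply/orP; left; apply/eqP; apply: eq_NN.
    - exact: LL_mm (wT_LL T Lgd).
    - exact: LL_mm Lqd.
    by apply: aeS3 Tg Tg' (wTB T Lg Lg') => z -> -> ->.
  have N2 : (NN (fun z => - c * tr h qd z)%R <= (cabs c `^ p * wt h `^ p * (e / (k + 1)))%:E)%E.
    rewrite NNZ; last exact: LL_mm (LL_tr h Lqd).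
    rewrite cabsN -mulrA EFinM; apply: lee_wpmul2l; first by rewrite lee_fin powR_ge0.
    apply: le_trans (NN_tr h (LL_mm Lqd)) _; rewrite EFinM; apply: lee_wpmul2l => //.
    by rewrite lee_fin powR_ge0.
  have m1 := LL_mm (wT_LL T (LL_tr x Lgd)).
  have m2 := LL_mm (LLZ (- c) (LL_tr h Lqd)).
  apply: le_trans (le_trans _ (NND_le m1 m2 N1 N2)) _.
    rewrite le_eqVlt; apply/orP; left; apply/eqP; apply: eq_NN.
    - exact: LL_mm (LLB Lv Lw).
    - exact: mmD.
    apply: aeS2 E' (wTB T (LL_tr x Lg) (LL_tr x Lg')) => z E1 E2.
    by rewrite [T (tr x gd) z]E2 E1 /tr /qd; ring.
  rewrite lee_fin -mulrDl mulrA -/k mulrA ler_pdivrMr // mulrC.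
  by rewrite ler_wpM2l ?(ltW e0) // lerDl.
Qed.

Lemma wT_core x : exists h c, [/\ localizes x h, density_at x c, c <> 0 &
  forall g, LL g -> {ae lamY, forall z, T (tr x g) z = c * tr h (T g) z}].
Proof.
have [h loc] := wT_local T x; have [c dc] := density_exists loc.
exists h, c; split => //; last exact: law_all.
(* With [c = 0] the law would make [T] vanish on every translate by [x], against injectivity. *)
move=> c0; have [Q cQ Q0] := nonnull_compact X; apply: Q0.
have LQ := LL_ind (compact_bB cQ); have Lt := LL_tr x LQ.
apply: lam_ii0; first exact: compact_borel.
have H : {ae lamX, forall x', tr x (ii Q) x' = 0}.
  apply: (wT0V (T := T)) => //; apply: aeS (law_all loc dc LQ) => z ->.
  by rewrite c0 mul0r.
by apply: aeS (ae_shift x H) => x'; rewrite /tr gmK.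
Qed.

End TranslationLaw.

(** * The inverse isomorphism *)

Section Inverse.
Variables (R : realType) (p : R) (X Y : walg p) (T : wiso X Y).

Lemma wiso_inv : exists S : wiso Y X, forall q, LL q ->
  {ae (@lam R p Y), forall y, T (S q) y = q y}.
Proof.
have H (q : Y -> C R) : exists f, LL q -> LL f /\ {ae (@lam R p Y), forall y, T f y = q y}.
  (* Outside the space the preimage is the dummy value 0. *)
  have [Lq|nLq] := pselect (LL q); last by exists (fun=> 0).
  by have [f Lf Tf] := wT_surj T Lq; exists f.
have [S HS] := choice H.
have SL q : LL q -> LL (S q) by move=> /HS[].
have TS q : LL q -> {ae (@lam R p Y), forall y, T (S q) y = q y} by move=> /HS[].
have inj f g : LL f -> LL g -> {ae (@lam R p Y), forall y, T f y = T g y} ->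
  {ae (@lam R p X), forall x, f x = g x} by exact: wT_inj.
have Sae q q' : LL q -> LL q' -> {ae (@lam R p Y), forall y, q y = q' y} ->
    {ae (@lam R p X), forall x, S q x = S q' x}.
  move=> Lq Lq' E; apply: inj; [exact: SL | exact: SL |].
  by apply: aeS3 (TS q Lq) (TS q' Lq') E => y -> -> ->.
have [M1 M10 B1] := wT_bd T; have [M2 M20 B2] := wT_bdV T.
have NTS q : LL q -> NN (T (S q)) = NN q.
  by move=> Lq; apply: eq_NN; [exact/LL_mm/wT_LL/SL | exact: LL_mm | exact: TS].
unshelve eexists (@WIso R p Y X S SL Sae _ _ _ _ _ _ _ _ _).
- move=> q q' Lq Lq'; have L1 := SL _ Lq; have L2 := SL _ Lq'.
  apply: inj; [exact/SL/LLD | exact: LLD |].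
  by apply: aeS3 (TS _ (LLD Lq Lq')) (wTD T L1 L2) (aeI (TS _ Lq) (TS _ Lq'))
    => y -> -> [-> ->].
- move=> a q Lq; have L1 := SL _ Lq.
  apply: inj; [exact/SL/LLZ | exact: LLZ |].
  by apply: aeS3 (TS _ (LLZ a Lq)) (wTZ T a L1) (TS _ Lq) => y -> -> ->.
- move=> q q' Lq Lq'; have L1 := SL _ Lq; have L2 := SL _ Lq'.
  have L3 := wT_LL T L1; have L4 := wT_LL T L2.
  apply: inj; [exact/SL/LL_cv | exact: LL_cv |].
  apply: aeS3 (TS _ (LL_cv Lq Lq')) (wTcv T L1 L2) (cvr_ae L3 L4 Lq' (TS _ Lq')) => y -> -> ->.
  (* A change of the left factor on a null set alters no value, since the integration variable is
     its argument; the right factor was handled by [cvr_ae]. *)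
  symmetry.
  rewrite !cvE; apply: ci_ae; try (by apply: mm_cvi; exact: LL_mm).
  by apply: aeS (TS _ Lq) => y' E; rewrite /cvi E.
- move=> q q' Lq Lq' E; have := wT_ae T (SL _ Lq) (SL _ Lq') E.
  by apply: aeS3 (TS _ Lq) (TS _ Lq') => y -> ->.
- move=> f Lf; exists (T f); first exact: wT_LL.
  apply: inj; [exact/SL/wT_LL | by [] | exact/TS/wT_LL].
- exists M2 => // q Lq; rewrite -(NTS q Lq); exact/B2/SL.
- exists M1 => // q Lq; rewrite -(NTS q Lq); exact/B1/SL.
- move=> q q' Lq Lq' E; apply: (wT_sepV (w := T)); [exact: SL | exact: SL |].
  by apply: aeS3 (TS _ Lq) (TS _ Lq') E => y -> ->.
- move=> q q' Lq Lq' E; have := wT_sep T (SL _ Lq) (SL _ Lq') E.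
  by apply: aeS3 (TS _ Lq) (TS _ Lq') => y -> ->.
by [].
Qed.

End Inverse.

(** * A multiple of a translation determines both *)

Section TranslationUnique.
Variables (R : realType) (p : R) (Y : walg p).

(** Test on the indicator of a neighbourhood [N] of the unit. If [h] and [h'] differ, [h' N] misses
    a neighbourhood of [h], so [a] would vanish; once they agree, the values on [h N] give
    [a = b]. *)
Lemma tr_unique (a b : C R) (h h' : Y) : a <> 0 ->
  (forall q, LL q -> {ae (@lam R p Y), forall y, a * tr h q y = b * tr h' q y}) ->
  h = h' /\ a = b.
Proof.
move=> a0 H.
have contra (N V : set Y) : open N -> N ge -> open V ->
    V h -> {ae (@lam R p Y), forall y, ~ (shift h N y /\ V y)} -> False.
  move=> oN Ne oV Vh E; have oS : open (shift h N `&` V) by apply: openI => //; exact: open_shift.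
  apply: (open_nonnull oS); first by exists h; split => //; exists ge => //; rewrite gm1.
  apply/(negligibleP _ (open_borel oS)); apply: negligibleS E => y [? ?] /=; exact.
have hh : h = h'.
  apply: contrapT => /hausdorff_sep[A [B [oA oB Ah Bh' dis]]].
  have nB : nbhs (ge : Y) (gm h' @^-1` B).
    by apply: cont_gml; rewrite gm1; exact: open_nbhs_nbhs.
  have [N [oN Ne NB bN]] := bB_nbhs nB.
  apply: (contra N A oN Ne oA Ah).
  apply: aeS (H _ (LL_ind bN)) => y; rewrite !tr_ii => + [hN Ay].
  rewrite (iiT hN) iiF; first by rewrite mulr1 mulr0.
  by move=> [n Nn nE]; apply: (dis y Ay); rewrite -nE; exact: NB.
split => //; rewrite -{}hh in H.
have [N [oN Ne _ bN]] := bB_nbhs (@filterT _ (nbhs (ge : Y)) _).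
apply: contrapT => ab; apply: (contra N setT oN Ne openT I).
apply: aeS (H _ (LL_ind bN)) => y; rewrite !tr_ii => + [hN _].
by rewrite (iiT hN) !mulr1.
Qed.

End TranslationUnique.

(** * Comparison of the factor with the weights *)

Section WeightBound.
Variables (R : realType) (p : R) (X Y : walg p) (T : wiso X Y).

Definition law (x : X) (h : Y) (c : C R) := forall g, LL g ->
  {ae (@lam R p Y), forall z, T (tr x g) z = c * tr h (T g) z}.

(* Test the law on the indicator of a small neighbourhood of the unit: translation by [h]
   has norm [wt h]. *)
Lemma weight_bound : exists2 M : R, 0 <= M & forall x h c, law x h c ->
  cabs c * wt h <= M * wt x.
Proof.
have p0 := p_gt0 X; have p1 := walg_p X.
have [M1 M10 B1] := wT_bd T; have [M2 M20 B2] := wT_bdV T.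
(* The factor 4 collects two losses of 2: the weight is below 2 on [N], and above [wt h / 2] on
   [h N]. *)
pose M := (M1 * M2) `^ p^-1 * 4; exists M; first by rewrite mulr_ge0 ?powR_ge0.
move=> x h c lw.
have n1 : nbhs (ge : Y) (wt @^-1` [set r : R | r < 2]).
  apply: wt_cont; rewrite wt1; apply: open_nbhs_nbhs; split; first exact: open_lt.
  by rewrite /= ltr1n.
have n2 : nbhs (ge : Y) ((fun z => wt (gm h z)) @^-1` [set r : R | wt h / 2 < r]).
  have cc : continuous (fun z : Y => wt (gm h z)).
    by move=> z; apply: (@continuous_comp _ _ _ (gm h) wt); [exact: cont_gml | exact: wt_cont].
  apply: cc; rewrite gm1; apply: open_nbhs_nbhs; split; first exact: open_gt.
  by rewrite /= ltr_pdivrMr // mulrC mulr2n mulrDl mul1r ltrDl wt_gt0.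
have [N [oN Ne sN bN]] := bB_nbhs (filterI n1 n2).
have LN := LL_ind bN; have mN := bN.1.
have l0 : 0 < rl N by have := lam_open oN (ex_intro _ _ Ne); rewrite rlE // lte_fin.
have [g Lg Tg] := wT_surj T LN.
have H1 : (NN (ii N) <= (2 `^ p * rl N)%:E)%E.
  rewrite EFinM -rlE //; apply: Np_ind_le => // z /sN[/ltW ? _] //.
have H2 : ((((wt h / 2) `^ p) * rl N)%:E <= NN (tr h (ii N)))%E.
  rewrite tr_ii EFinM -rlE // -(lam_shift h) //.
  apply: markov_Np.
  - exact: borel_shift.
  - by apply: mm_ii; exact: borel_shift.
  - by rewrite divr_ge0 ?wt_ge0.
  move=> _ [n Nn <-]; rewrite iiT; last by exists n.
  by rewrite cabs1 mul1r; have [_ /ltW] := sN _ Nn.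
have H3 : ((cabs c `^ p)%:E * NN (tr h (ii N)) <= (M1 * (wt x `^ p * (M2 * (2 `^ p * rl N))))%:E)%E.
  rewrite -NNZ; last by apply: mm_tr; exact: mm_ii.
  have -> : NN (fun z => c * tr h (ii N) z) = NN (T (tr x g)).
    apply: eq_NN.
    - by apply: mmZ; apply: mm_tr; exact: mm_ii.
    - exact: LL_mm (wT_LL T (LL_tr x Lg)).
    have E := ae_shift (gi h) Tg.
    by apply: aeS2 (lw g Lg) E => z ->; rewrite /tr => ->.
  apply: le_trans (B1 _ (LL_tr x Lg)) _; rewrite EFinM.
  apply: lee_wpmul2l; first by rewrite lee_fin.
  apply: le_trans (NN_tr x (LL_mm Lg)) _; rewrite EFinM.
  apply: lee_wpmul2l; first by rewrite lee_fin powR_ge0.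
  apply: le_trans (B2 g Lg) _; rewrite EFinM; apply: lee_wpmul2l; first by rewrite lee_fin.
  apply: le_trans H1; rewrite le_eqVlt; apply/orP; left; apply/eqP; apply: eq_NN => //.
    exact: LL_mm (wT_LL T Lg).
  exact: mm_ii.
have {H2 H3} H : cabs c `^ p * ((wt h / 2) `^ p * rl N) <=
    M1 * (wt x `^ p * (M2 * (2 `^ p * rl N))).
  rewrite -lee_fin; apply: le_trans H3; rewrite EFinM; apply: lee_wpmul2l => //.
  by rewrite lee_fin powR_ge0.
have {}H : (cabs c * (wt h / 2)) `^ p <= ((M1 * M2) `^ p^-1 * (wt x * 2)) `^ p.
  have w2 : 0 <= wt h / 2 by rewrite divr_ge0 ?wt_ge0.
  rewrite (powRM p (cabs_ge0 c) w2) (@powRM _ (_ `^ _)) ?powR_ge0 ?mulr_ge0 ?wt_ge0 //.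
  rewrite (@powRM _ (wt x)) ?wt_ge0 // -powRrM mulVf ?gt_eqF // powRr1 ?mulr_ge0 //.
  rewrite -(ler_pM2r l0).
  rewrite [leLHS](_ : _ = cabs c `^ p * ((wt h / 2) `^ p * rl N)); last by ring.
  by rewrite [leRHS](_ : _ = M1 * (wt x `^ p * (M2 * (2 `^ p * rl N)))) //; ring.
have {}H : cabs c * (wt h / 2) <= (M1 * M2) `^ p^-1 * (wt x * 2).
  rewrite leNgt; apply/negP => lt; move: H; rewrite leNgt => /negP; apply.
  by apply: gt0_ltr_powR; rewrite ?nnegrE ?mulr_ge0 ?powR_ge0 ?cabs_ge0 ?divr_ge0 ?wt_ge0.
rewrite /M; lra.
Qed.

End WeightBound.

(** * The homomorphism [phi] and the character [gamma] *)

Section PointMap.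
Variables (R : realType) (p : R) (X Y : walg p) (T : wiso X Y).
Variables (phi : X -> Y) (gamma : X -> C R).
Hypothesis loc : forall x, localizes T x (phi x).
Hypothesis dens : forall x, density_at T x (gamma x).
Hypothesis gamma0 : forall x, gamma x <> 0.
Hypothesis lawT : forall x, law T x (phi x) (gamma x).

Local Notation lamY := (@lam R p Y).

(** The law for [gm x x'] and the composite of the laws for [x] and [x'] describe the same operator,
    and [tr_unique] compares them. *)
Lemma phi_gammaM x x' : phi (gm x x') = gm (phi x) (phi x') /\
  gamma (gm x x') = gamma x * gamma x'.
Proof.
apply: tr_unique => // q Lq; have [g Lg Tg] := wT_surj T Lq.
have L1 := LL_tr x' Lg; have LTg := wT_LL T Lg.
have E1 := lawT (gm x x') Lg; rewrite -trM in E1.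
have E2 := lawT x L1; have E3 := ae_shift (gi (phi x)) (lawT x' Lg).
have E4 := ae_shift (gi (gm (phi x) (phi x'))) Tg.
have E5 := ae_shift (gi (phi (gm x x'))) Tg.
apply: aeS3 (aeI E1 E2) (aeI E3 E4) E5 => z [e1 e2] [e3 e4] e5.
rewrite e1 in e2; rewrite /tr in e2 e3.
rewrite /tr -e4 -e5 e2 e3 -mulrA; congr (_ * (_ * T g _)).
by rewrite giM gmA.
Qed.

(** Localization at [x] concerns all small sets near [x], including those around a nearby [x']. If
    [phi x'] lay outside the compact neighbourhood [D] of [phi x], the image of a small set around
    [x'] would vanish off [W] and also on [D], hence everywhere, against injectivity. *)
Lemma phi_cont : continuous phi.
Proof.
move=> x V /compact_nbhs[W [D [oW Wx WD cD DV]]].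
have [U Ux HU] := loc oW Wx.
have [U' [oU' U'x U'U bU']] := bB_nbhs Ux.
apply: (@filterS _ (nbhs x) _ U'); last exact: open_nbhs_nbhs.
move=> x' U'x' /=; apply: DV; apply: contrapT => nD.
have oD : open (~` D) by apply: closed_openC; exact: compact_closed (@hausX _ _ Y) cD.
have [U2 U2x H2] := loc oD nD.
have nU' : nbhs x' U' by exact: open_nbhs_nbhs.
have [A [bA AU rA]] := nbhs_bB (filterI nU' U2x).
have E1 := HU A bA (fun a Aa => U'U _ (AU a Aa).1).
have E2 := H2 A bA (fun a Aa => (AU a Aa).2).
have E0 : {ae lamY, forall y, T (ii A) y = 0}.
  apply: aeS2 E1 E2 => y H1 H2'; have [Wy|Wy] := pselect (W y); last exact: H1.
  by apply: H2' => /(_ (WD _ Wy)).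
have := lam_ii0 bA.1 (wT0V (LL_ind bA) E0).
by rewrite rlE // => -[] A0; rewrite A0 ltxx in rA.
Qed.

(** A small set around [x'] is also a small set near [x], so its average is within [d / 2] of both
    values. *)
Lemma gamma_close x (d : R) : 0 < d ->
  exists2 U, nbhs x U & forall x', U x' -> cabs (gamma x - gamma x') <= d.
Proof.
move=> d0; have d2 : 0 < d / 2 by rewrite divr_gt0.
have [U Ux HU] := dens x d2; have [U' [oU' U'x U'U _]] := bB_nbhs Ux.
exists U'; first exact: open_nbhs_nbhs.
move=> x' U'x'; have [V Vx HV] := dens x' d2.
have nU' : nbhs x' U' by exact: open_nbhs_nbhs.
have [A [bA AU rA]] := nbhs_bB (filterI nU' Vx).
have H1 := HU A bA (fun a Aa => U'U _ (AU a Aa).1).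
have H2 := HV A bA (fun a Aa => (AU a Aa).2).
rewrite -(ler_pM2l rA) -[X in X * cabs _](ger0_norm (ltW rA)) -cabs_rc -cabsM.
have -> : rc (rl A) * (gamma x - gamma x') =
  (ci (T (ii A)) - rc (rl A) * gamma x') - (ci (T (ii A)) - rc (rl A) * gamma x) by ring.
apply: le_trans (cabsB _ _) _; lra.
Qed.

Lemma gamma_cont : continuous (fun x => cRe (gamma x)) /\ continuous (fun x => cIm (gamma x)).
Proof.
split => x; apply/cvgrPdist_le => e /(gamma_close x)[U Ux H].
  by apply: (@filterS _ (nbhs x) _ U) => // x' /H; apply: le_trans; rewrite -cReN -cReD cabs_Re.
by apply: (@filterS _ (nbhs x) _ U) => // x' /H; apply: le_trans; rewrite -cImN -cImD cabs_Im.
Qed.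

Lemma phi1 : phi ge = ge.
Proof.
have [+ _] := phi_gammaM ge ge; rewrite g1m -{1}[phi ge]gm1 => E.
by rewrite -(gm_inj (esym E)).
Qed.

Lemma phiV x : phi (gi x) = gi (phi x).
Proof.
apply: (@gm_inj _ _ _ (phi x)).
by rewrite gmV -(phi_gammaM x (gi x)).1 gmV phi1.
Qed.

Lemma gamma1 : gamma ge = 1.
Proof.
have [_ +] := phi_gammaM ge ge; rewrite g1m => E.
have g0 : gamma ge != 0 by exact/eqP.
by apply: (mulfI g0); rewrite mulr1 -E.
Qed.

Lemma gammaV x : gamma x * gamma (gi x) = 1.
Proof. by rewrite -(phi_gammaM x (gi x)).2 gmV gamma1. Qed.

(** * Images of indicators vanish off the image of the set *)

Section Support.
Variable psi : Y -> X.
Hypothesis phiK : cancel phi psi.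
Hypothesis psiK : cancel psi phi.
Hypothesis psi_cont : continuous psi.

Lemma preE E : psi @^-1` E = phi @` E.
Proof.
apply/seteqP; split => [y Ey|_ [x Ex <-]]; last by rewrite /= phiK.
by exists (psi y) => //; exact: psiK.
Qed.

Lemma pre_borel (E : set X) : borel E -> borel (psi @^-1` E).
Proof. exact: (borel_comp (X := X) (Y := Y)). Qed.

Lemma pre_compact K : compact K -> compact (psi @^-1` K).
Proof.
move=> cK; rewrite preE; apply: continuous_compact => //.
apply: continuous_subspaceT; exact: phi_cont.
Qed.

Lemma pre_bB (E : set X) : bB E -> bB (psi @^-1` E).
Proof.
move=> [mE [K cK EK]]; split; first exact: pre_borel.
by exists (psi @^-1` K); [exact: pre_compact | move=> y /EK].
Qed.

(** It suffices to treat a compact [D] disjoint from [phi K]. Each point of [K] has a neighbourhood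
    whose subsets have images vanishing on [D], and additivity of [T] glues these over a finite
    cover. *)
Lemma support_off_compact K : compact K ->
  {ae lamY, forall y, ~ K (psi y) -> T (ii K) y = 0}.
Proof.
move=> cK; have cK' := pre_compact cK; have LTK := wT_LL T (LL_ind (compact_bB cK)).
apply: (@locally_ae0 _ _ Y _ (~` (psi @^-1` K))) => //.
  by apply: measurableC; exact: compact_borel.
move=> D cD DK.
pose P (S : set X) := exists V, [/\ open V, S `<=` V & forall A, bB A -> A `<=` V ->
  {ae lamY, forall y, D y -> T (ii A) y = 0}].
suff [V [oV KV HV]] : P K by apply: HV => //; exact: compact_bB.
apply: compact_local_ind cK _ _ _ _.
- exists set0; split => //; first exact: open0.
  move=> A bA; rewrite subset0 => ->; have L0 := LL_ind (bB0 X).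
  have : {ae lamY, forall y, T (ii set0) y = 0} by apply: wT0 => //; apply: aeT => x; exact: iiF.
  by apply: aeS => y ->.
- by move=> S S' SS' [V [oV SV HV]]; exists V; split => //; exact: subset_trans SV.
- move=> S1 S2 [V1 [oV1 SV1 H1]] [V2 [oV2 SV2 H2]]; exists (V1 `|` V2); split.
  + exact: openU.
  + exact: setUSS.
  move=> A bA AV; have mV1 := open_borel oV1.
  have b1 := bBI bA mV1; have b2 := bBD bA mV1.
  have E1 := H1 _ b1 (@subIsetr _ _ _).
  have E2 : {ae lamY, forall y, D y -> T (ii (A `\` V1)) y = 0}.
    by apply: H2 => // x [Ax nV1]; case: (AV _ Ax).
  have := wTD T (LL_ind b1) (LL_ind b2).
  have <- : ii A = (fun x => ii (A `&` V1) x + ii (A `\` V1) x).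
    by apply/funext => x; exact: ii_split.
  by apply: aeS3 E1 E2 => y e1 e2 -> Dy; rewrite e1 // e2 // addr0.
- move=> x Kx.
  have oD : open (~` D) by apply: closed_openC; exact: compact_closed (@hausX _ _ Y) cD.
  have nDx : (~` D) (phi x) by move=> /DK; apply; rewrite /= phiK.
  have [U Ux HU] := loc oD nDx.
  have [V [oV Vx VU _]] := bB_nbhs Ux.
  exists V; first exact: open_nbhs_nbhs.
  exists V; split => // A bA AV; have := HU A bA (subset_trans AV VU).
  by apply: aeS => y H Dy; apply: H => /(_ Dy).
Qed.

(** Inner regularity replaces [E] by a compact subset; the remainder has a small image because [T]
    is bounded. *)
Lemma support_off E : bB E -> {ae lamY, forall y, ~ E (psi y) -> T (ii E) y = 0}.
Proof.
move=> bE; have mD : borel (~` (psi @^-1` E)) by apply: measurableC; exact: pre_borel bE.1.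
have LTE := wT_LL T (LL_ind bE).
apply: (NN_small0_on mD (LL_mm LTE)) => e e0.
have [M M0 HM] := wT_bd T; have M1 : 0 < M + 1 by rewrite ltr_wpDl.
have [K [cK KE NK]] := Np_inner_bB bE (divr_gt0 e0 M1).
have bK := compact_bB cK; have bEK := bBD bE bK.1.
have LEK := LL_ind bEK; have LTEK := wT_LL T LEK.
apply: (@le_trans _ _ (NN (T (ii (E `\` K))))).
  apply: le_NN; [exact: mm_indM (LL_mm LTE)|exact: LL_mm|].
  have := wTD T (LL_ind bK) LEK.
  have <- : ii E = (fun x => ii K x + ii (E `\` K) x).
    by apply/funext => x; rewrite (ii_split E K) (setIidr KE).
  apply: aeS2 (support_off_compact cK) => y H1 H2.
  have [Ey|Ey] := pselect (E (psi y)); first by rewrite iiF ?mul0r ?cabs0 ?cabs_ge0.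
  by rewrite iiT // mul1r H2 H1 ?add0r // => /KE.
apply: le_trans (HM _ LEK) _.
apply: (@le_trans _ _ (M%:E * (e / (M + 1))%:E)%E).
  by apply: lee_wpmul2l => //; rewrite lee_fin.
by rewrite -EFinM lee_fin mulrA ler_pdivrMr // mulrC ler_wpM2l ?(ltW e0) // lerDl.
Qed.

End Support.
End PointMap.

(** * Absolute integrals and inversion of sets *)

Section Absint.
Variables (R : realType) (p : R) (X : walg p).
Implicit Types (h k : X -> C R).

Lemma absint_shift x h : mm h -> absint (fun y => h (gm x y)) = absint h.
Proof.
move=> mh; apply: (@ge0_integral_shift _ _ _ x (fun y => (cabs (h y))%:E)).
  by apply/measurable_EFinP; exact: measurable_cabs.
by move=> y; rewrite lee_fin cabs_ge0.
Qed.

Lemma absint_ae h k : mm h -> mm k -> {ae (@lam R p X), forall y, h y = k y} ->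
  absint h = absint k.
Proof.
move=> mh mk hk; apply: ae_eq_integral => //.
- by apply/measurable_EFinP; exact: measurable_cabs.
- by apply/measurable_EFinP; exact: measurable_cabs.
by apply: aeS hk => y ->.
Qed.

Lemma absintZ (a : C R) h : mm h -> absint (fun y => a * h y) = ((cabs a)%:E * absint h)%E.
Proof.
move=> mh; rewrite /absint -ge0_integralZl_EFin ?cabs_ge0 //.
- by apply: eq_integral => y _; rewrite cabsM.
- by move=> y _; rewrite lee_fin cabs_ge0.
- by apply/measurable_EFinP; exact: measurable_cabs.
Qed.

Lemma bB_inv (B : set X) : bB B -> bB (gi @^-1` B).
Proof.
have cg : continuous (@gi R p X) by apply: cont_gi; exact: cont_id.
move=> [mB [K cK BK]]; split; first exact: (borel_comp (X := X) (Y := X)).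
exists (gi @` K); first by apply: continuous_compact => //; exact: continuous_subspaceT.
by move=> y /BK Ky; exists (gi y) => //; rewrite giK.
Qed.

End Absint.

(** * Comparing Haar measures along a homeomorphism *)

Section MeasureComparison.
Variables (R : realType) (p : R) (X Y : walg p) (phi : X -> Y) (psi : Y -> X).
Hypothesis phiK : cancel phi psi.
Hypothesis psiK : cancel psi phi.
Hypothesis phi_cont : continuous phi.
Hypothesis psi_cont : continuous psi.

(** Inner regularity on [X] passes from compact to open sets, outer regularity on [Y] from open to
    Borel sets; sets of infinite measure are thus covered. *)
Lemma lam_le_compact (k : R) : 0 < k ->
  (forall K : set X, compact K -> (lam K <= k%:E * lam (psi @^-1` K))%E) ->
  forall E : set X, borel E -> (lam E <= k%:E * lam (psi @^-1` E))%E.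
Proof.
move=> k0 HK.
have mpre (E : set X) : borel E -> borel (psi @^-1` E) by exact: (borel_comp (X := X) (Y := Y)).
have HU (U : set X) : open U -> (lam U <= k%:E * lam (psi @^-1` U))%E.
  move=> oU; case: (walg_haar X) => _ _ _ _ /(_ U oU) ->.
  apply: ge_ereal_sup => _ [K [cK KU] <-]; apply: le_trans (HK K cK) _.
  apply: lee_wpmul2l; first by rewrite lee_fin ltW.
  apply: le_measure; rewrite ?inE.
  - by apply: mpre; exact: compact_borel.
  - by apply: mpre; exact: open_borel.
  by move=> y /KU.
move=> E mE; rewrite -lee_pdivrMl //.
have mE' : borel (psi @^-1` E) by exact: mpre.
case: (walg_haar Y) => _ _ _ /(_ (psi @^-1` E) mE') -> _.
apply: le_ereal_inf_tmp => _ [V [oV EV] <-]; rewrite lee_pdivrMl //.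
have oU : open (phi @^-1` V) by apply: open_comp => // x _; exact: phi_cont.
have -> : V = psi @^-1` (phi @^-1` V).
  by apply/seteqP; split => y /=; rewrite psiK.
apply: le_trans (HU _ oU); apply: le_measure; rewrite ?inE //; first exact: open_borel.
by move=> x Ex; apply: EV; rewrite /= phiK.
Qed.

End MeasureComparison.

(** * The point map of the inverse *)

Section InversePair.
Variables (R : realType) (p : R) (X Y : walg p) (T : wiso X Y) (S : wiso Y X).
Variables (phi : X -> Y) (gamma : X -> C R) (psi : Y -> X) (delta : Y -> C R).
Hypothesis TS : forall q, LL q -> {ae (@lam R p Y), forall y, T (S q) y = q y}.
Hypothesis gamma0 : forall x, gamma x <> 0.
Hypothesis delta0 : forall y, delta y <> 0.
Hypothesis lawT : forall x, law T x (phi x) (gamma x).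
Hypothesis lawS : forall y, law S y (psi y) (delta y).

Lemma ST f : LL f -> {ae (@lam R p X), forall x, S (T f) x = f x}.
Proof.
move=> Lf; have LT := wT_LL T Lf; apply: (wT_inj (w := T)) => //; first exact: wT_LL.
exact: TS.
Qed.

(** As [T] after [S] is the identity, the law of [S] at [h] followed by the law of [T] at [psi h]
    must be translation by [h] with factor 1. *)
Lemma law_inverse h : phi (psi h) = h /\ gamma (psi h) * delta h = 1.
Proof.
have [E1 E2] : phi (psi h) = h /\ delta h * gamma (psi h) = 1; last by rewrite mulrC.
apply: tr_unique.
  by apply/eqP; rewrite mulf_neq0 //; apply/eqP.
move=> q Lq; have LS := wT_LL S Lq; have Lt := LL_tr h Lq; have L1 := LL_tr (psi h) LS.
have A1 := wT_ae T (wT_LL S Lt) (LLZ (delta h) L1) (lawS h Lq).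
have A2 := ae_shift (gi (phi (psi h))) (TS Lq).
apply: aeS3 (aeI A1 (TS Lt)) (aeI (wTZ T (delta h) L1) (lawT (psi h) LS)) A2.
move=> z [a1 a2] [a3 a4] a5; rewrite mul1r -a2 a1 a3 a4 mulrA; congr (_ * _).
by rewrite /tr a5.
Qed.

End InversePair.

(** * The explicit formula and the ratio of Haar measures *)

Section StandardForm.
Variables (R : realType) (p : R) (X Y : walg p) (T : wiso X Y) (S : wiso Y X).
Variables (phi : X -> Y) (gamma : X -> C R) (psi : Y -> X) (delta : Y -> C R).
Hypothesis TS : forall q, LL q -> {ae (@lam R p Y), forall y, T (S q) y = q y}.
Hypothesis locT : forall x, localizes T x (phi x).
Hypothesis locS : forall y, localizes S y (psi y).
Hypothesis densT : forall x, density_at T x (gamma x).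
Hypothesis gamma0 : forall x, gamma x <> 0.
Hypothesis delta0 : forall y, delta y <> 0.
Hypothesis lawT : forall x, law T x (phi x) (gamma x).
Hypothesis lawS : forall y, law S y (psi y) (delta y).

Local Notation lamX := (@lam R p X).
Local Notation lamY := (@lam R p Y).

Lemma psiK : cancel psi phi.
Proof. by move=> h; have [] := law_inverse TS gamma0 delta0 lawT lawS h. Qed.

Lemma phiK : cancel phi psi.
Proof. by move=> x; have [] := law_inverse (ST TS) delta0 gamma0 lawS lawT x. Qed.

Lemma gamma_delta x : gamma x * delta (phi x) = 1.
Proof. by have [_] := law_inverse TS gamma0 delta0 lawT lawS (phi x); rewrite phiK. Qed.

Let phi_c : continuous phi := phi_cont locT.
Let psi_c : continuous psi := phi_cont locS.
Let psiV y : psi (gi y) = gi (psi y) := phiV delta0 lawS y.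
Let phi_V x : phi (gi x) = gi (phi x) := phiV gamma0 lawT x.
Let gamV x : gamma x * gamma (gi x) = 1 := gammaV gamma0 lawT x.

Let preB (E : set X) : bB E -> bB (psi @^-1` E) := pre_bB locT phiK psiK psi_c (E := E).
Let suppT (E : set X) (bE : bB E) : {ae lamY, forall y, ~ E (psi y) -> T (ii E) y = 0} :=
  support_off locT phiK psiK psi_c bE.
Let suppS (E : set Y) (bE : bB E) : {ae lamX, forall x, ~ E (phi x) -> S (ii E) x = 0} :=
  support_off locS psiK phiK phi_c bE.

(** Let [Z] be the part of [phi E] where [T (ii E)] vanishes. Its indicator is disjoint from
    [T (ii E)], so [S (ii Z)] vanishes on [E]; by [suppS] it also vanishes off [E]. Hence [Z] is
    null. *)
Lemma support_on (E : set X) : bB E -> {ae lamY, forall y, E (psi y) -> T (ii E) y <> 0}.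
Proof.
move=> bE; have LE := LL_ind bE; have LTE := wT_LL T LE.
pose Z : set Y := psi @^-1` E `&` [set y | T (ii E) y = 0].
have bZ : bB Z.
  by apply: bBI; [exact: preB | apply: (@measurable_eq0 _ (Borel Y)); exact: LL_mm].
have LZ := LL_ind bZ; have LS := wT_LL S LZ.
have H : {ae lamX, forall x, S (ii Z) x * ii E x = 0}.
  apply: (wT_sepV (w := T)) => //; apply: aeS (TS LZ) => y ->.
  have [[_ Zy]|Zy] := pselect (Z y); last by rewrite (iiF Zy) mul0r.
  by rewrite Zy mulr0.
have S0 : {ae lamX, forall x, S (ii Z) x = 0}.
  apply: aeS2 H (suppS bZ) => x H1 H2; have [Ex|Ex] := pselect (E x).
    by move: H1; rewrite iiT // mulr1.
  by apply: H2 => -[]; rewrite /= phiK.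
have Z0 : {ae lamY, forall y, ii Z y = 0} by apply: aeS2 (TS LZ) (wT0 T LS S0) => y <-.
apply: aeS Z0 => y Zy Ey Ty.
have Zy' : Z y by [].
by move/eqP: Zy; rewrite (iiT Zy') oner_eq0.
Qed.

(** [T] is local: [f] is disjoint from the indicator of [E], whose image is nonzero almost
    everywhere on [phi E]. *)
Lemma restriction (E : set X) f : bB E -> LL f -> {ae lamX, forall x, E x -> f x = 0} ->
  {ae lamY, forall y, E (psi y) -> T f y = 0}.
Proof.
move=> bE Lf f0; have LE := LL_ind bE.
have H : {ae lamY, forall y, T f y * T (ii E) y = 0}.
  apply: (wT_sep T) => //; apply: aeS f0 => x fx; have [Ex|Ex] := pselect (E x).
    by rewrite fx // mul0r.
  by rewrite (iiF Ex) mulr0.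
apply: aeS2 H (support_on bE) => y /eqP + nz Ey; rewrite mulf_eq0 => /orP[/eqP //|/eqP].
by move=> /(nz Ey).
Qed.

(* Convolving with a large set [A] makes [1_A * 1_B] constant on [D], while on the other side
   the translation law pulls [gamma] out of the integral. *)
Lemma convolution_identity (B D : set X) (t : Y -> C R) : bB B -> bB D -> LL t ->
  {ae lamY, forall y, T (ii B) y = t y} -> (forall y, ~ B (psi y) -> t y = 0) ->
  {ae lamY, forall z, D (psi z) -> rc (rl (gi @^-1` B)) * T (ii D) z =
    gamma (psi z) * ci (fun y => T (ii (gi @^-1` B)) y * t (gi y))}.
Proof.
move=> bB' bD Lt TB t0; pose Bi : set X := gi @^-1` B.
have bBi : bB Bi by exact: bB_inv.
have [_ [KB cKB BKB]] := bB'; have [_ [KD cKD DKD]] := bD.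
pose A : set X := [set gm a.1 (gi a.2) | a in KD `*` KB].
have cA : compact A.
  apply: continuous_compact; last exact: compact_setX.
  apply: continuous_subspaceT; apply: cont_gm2; first by move=> w; exact: cvg_fst.
  by apply: cont_gi => w; exact: cvg_snd.
have bA := compact_bB cA.
have DBA x y : D x -> Bi y -> A (gm x y).
  move=> Dx By; exists (x, gi y) => /=; last by rewrite giK.
  by split => /=; [exact: DKD | exact: BKB].
have LA := LL_ind bA; have LB := LL_ind bB'; have LD := LL_ind bD; have LBi := LL_ind bBi.
have Lc := LL_cv LA LB; have LTA := wT_LL T LA; have LTB := wT_LL T LB.
have FD x : D x -> cv (ii A) (ii B) x = rc (rl Bi).
  move=> Dx; have mc : mm (cvi (ii A) (ii B) x) by apply: mm_cvi; exact: LL_mm.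
  rewrite cvE -(ci_shift x mc) -ci_ii; last exact: bBi.1.
  congr (ci _); apply/funext => y; rewrite /cvi giM -gmA gVm gm1.
  have [By|By] := pselect (Bi y); last by rewrite (iiF By) [ii B _]iiF ?mulr0.
  by rewrite (iiT By) [ii B _]iiT // [ii A _]iiT ?mulr1 //; exact: DBA.
have LrD := LLZ (rc (rl Bi)) LD.
have R1 : {ae lamY, forall z, D (psi z) ->
    T (fun x => cv (ii A) (ii B) x - rc (rl Bi) * ii D x) z = 0}.
  apply: restriction => //; first exact: LLB.
  by apply: aeT => x Dx; rewrite FD // iiT // mulr1 subrr.
have E1 := aeI (wTB T Lc LrD) (aeI (wTZ T (rc (rl Bi)) LD)
  (aeI (wTcv T LA LB) (cvr_ae LTA LTB Lt TB))).
apply: aeS3 R1 E1 (ae_absint LTA Lt) => z r1 [e1 [e2 [e3 e4]]] fin Dz.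
move/eqP: (r1 Dz); rewrite e1 e2 e3 e4 subr_eq0 => /eqP <-.
pose x := psi z; have zE : phi x = z by exact: psiK.
have mcv : mm (cvi (T (ii A)) t z) by apply: mm_cvi; exact: LL_mm.
pose k y := T (ii Bi) y * t (gi y).
have mk : mm k.
  apply: mmM; first exact: LL_mm (wT_LL T LBi).
  by apply: (mm_comp (s := gi)); [apply: cont_gi; exact: cont_id | exact: LL_mm].
(* The set [x^-1 A] contains [Bi], so locality replaces the former by the latter on [phi Bi], and
   [x] survives only through the factor [gamma x]. *)
have bA' := bB_shift (gi x) bA; have LA' := LL_ind bA'.
have R2 : {ae lamY, forall y, Bi (psi y) -> T (fun x' => ii (shift (gi x) A) x' - ii Bi x') y = 0}.
  apply: restriction => //; first exact: LLB.
  apply: aeT => x' Bx'; rewrite (iiT Bx') iiT ?subrr // shiftE /= giK.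
  exact: DBA.
have key : {ae lamY, forall y, cvi (T (ii A)) t z (gm z y) = gamma x * k y}.
  apply: aeS3 R2 (wTB T LA' LBi) (lawT (gi x) LA) => y r2 e5.
  rewrite tr_ii phi_V zE /tr giK => lw.
  rewrite /cvi giM -gmA gVm gm1 /k.
  have [By|By] := pselect (Bi (psi y)); last first.
    by rewrite [t (gi y)]t0 ?mulr0 // psiV.
  move/eqP: (r2 By); rewrite e5 lw subr_eq0 => /eqP <-.
  by rewrite !mulrA gamV mul1r.
have ms : mm (fun y => cvi (T (ii A)) t z (gm z y)).
  by apply: (mm_comp (s := gm z)) => //; exact: cont_gml.
have mgk : mm (fun y => gamma x * k y) by exact: mmZ.
have fk : (absint k < +oo)%E.
  have : (absint (fun y => gamma x * k y)%R < +oo)%E.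
    by rewrite -(absint_ae ms mgk key) (absint_shift z mcv).
  rewrite absintZ // => f1; rewrite ltey; apply/eqP => kE; move: f1.
  by rewrite kE gt0_muley ?ltxx // lte_fin cabs_gt0; apply/eqP.
by rewrite cvE -(ci_shift z mcv) (ci_ae ms mgk key) ciZ.
Qed.

Lemma constant_exists : exists2 k : C R, k <> 0 & forall D : set X, bB D ->
  {ae lamY, forall z, T (ii D) z = k * gamma (psi z) * ii D (psi z)}.
Proof.
have [V cV V0] := nonnull_compact X; have bV := compact_bB cV.
pose B : set X := gi @^-1` V; have bB' : bB B by exact: bB_inv.
have BiE : gi @^-1` B = V by apply/seteqP; split => x; rewrite /B /= giK.
have LB := LL_ind bB'; have LTB := wT_LL T LB; have bpB := preB bB'.
(* A representative of [T (ii B)] that vanishes everywhere off [phi B]: it is later evaluated at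
   [gi y], and almost-everywhere statements are not carried through inversion. *)
pose t y := ii (psi @^-1` B) y * T (ii B) y.
have Lt : LL t by apply: LL_indM => //; exact: bpB.1.
have Tt : {ae lamY, forall y, T (ii B) y = t y}.
  apply: aeS (suppT bB') => y H; rewrite /t.
  have [By|By] := pselect (B (psi y)); first by rewrite iiT // mul1r.
  by rewrite [ii _ _]iiF // mul0r H.
have t0 y : ~ B (psi y) -> t y = 0 by move=> By; rewrite /t iiF // mul0r.
have r0 : rc (rl V) != 0 :> C R.
  rewrite -cabs_gt0 cabs_rc normr_gt0; apply/eqP => r0.
  by apply: V0; rewrite rlE // r0.
pose k := (rc (rl V))^-1 * ci (fun y => T (ii V) y * t (gi y)).
have Hk (D : set X) : bB D -> {ae lamY, forall z, T (ii D) z = k * gamma (psi z) * ii D (psi z)}.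
  move=> bD; have := convolution_identity bB' bD Lt Tt t0; rewrite BiE.
  apply: aeS2 (suppT bD) => z H1 H2.
  have [Dz|Dz] := pselect (D (psi z)); last by rewrite [ii D _]iiF // mulr0 H1.
  rewrite [ii D _]iiT // mulr1; apply: (mulfI r0); rewrite H2 // /k.
  by rewrite -mulrA mulVKf // mulrC.
exists k => // k0; apply: V0; apply: lam_ii0; first exact: bV.1.
apply: (wT0V (T := T)); first exact: LL_ind.
by apply: aeS (Hk V bV) => z ->; rewrite k0 !mul0r.
Qed.

Let mm_gamma : mm gamma.
Proof. by have [c1 c2] := gamma_cont densT; split; exact: continuous_BorelR. Qed.

Lemma mm_psi f : mm f -> mm (fun y => f (psi y)).
Proof.
move=> [m1 m2]; have mpsi := continuous_Borel psi_c.
by split; [exact: (measurableT_comp m1 mpsi) | exact: (measurableT_comp m2 mpsi)].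
Qed.

(** The formula is inserted for both [V] and [B] in [convolution_identity]. Since
    [gamma y * gamma (gi y) = 1], the integrand is [k * k] on [phi V], and cancelling [k * gamma]
    leaves the claim. *)
Lemma rl_scale (k : C R) : k <> 0 -> (forall D : set X, bB D ->
    {ae lamY, forall z, T (ii D) z = k * gamma (psi z) * ii D (psi z)}) ->
  forall V : set X, bB V -> rc (rl V) = k * rc (rl (psi @^-1` V)).
Proof.
move=> k0 Hk V bV; pose B : set X := gi @^-1` V; have bB' : bB B by exact: bB_inv.
have BiE : gi @^-1` B = V by apply/seteqP; split => x; rewrite /B /= giK.
have bpV := preB bV.
pose t y := k * gamma (psi y) * ii B (psi y).
have Tt := Hk B bB'.
have mt : mm t.
  apply: mmM; first by apply: mmZ; exact: mm_psi.
  by apply: (mm_psi (f := ii B)); apply: mm_ii; exact: bB'.1.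
have Lt : LL t.
  apply: LL_le (wT_LL T (LL_ind bB')) _ => //.
  by apply: aeS Tt => y ->.
have t0 y : ~ B (psi y) -> t y = 0 by move=> By; rewrite /t iiF // mulr0.
have LV := LL_ind bV; have LTV := wT_LL T LV.
have ciE : ci (fun y => T (ii V) y * t (gi y)) = k * k * rc (rl (psi @^-1` V)).
  have mp := mm_ii bpV.1.
  have fp : (absint (ii (psi @^-1` V)) < +oo)%E.
    by apply: (@LL_absint _ _ Y _ (psi @^-1` V)) => //; [exact: LL_ind | apply: aeT => y; exact: iiF].
  have cp := ci_ii bpV.1; rewrite -cp -(ciZ (k * k) mp fp).
  apply: ci_ae.
  - apply: mmM; first exact: LL_mm.
    by apply: (mm_comp (s := gi)) => //; apply: cont_gi; exact: cont_id.
  - exact: mmZ.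
  apply: aeS (Hk V bV) => y ->; rewrite /t psiV.
  have [Vy|Vy] := pselect (V (psi y)); last by rewrite [ii V _]iiF // [ii _ y]iiF // !mulr0 mul0r.
  have By : B (gi (psi y)) by rewrite /B /= giK.
  rewrite (iiT Vy) (iiT By) iiT //.
  transitivity (k * k * (gamma (psi y) * gamma (gi (psi y)))); first by ring.
  by rewrite gamV.
(* A non-null [D] provides a point at which the almost-everywhere identities can be evaluated. *)
have [D cD D0] := nonnull_compact X; have bD := compact_bB cD.
have := convolution_identity bB' bD Lt Tt t0; rewrite BiE ciE => H.
apply: contrapT => nE; apply: D0; apply: lam_ii0; first exact: bD.1.
apply: (wT0V (T := T)); first exact: LL_ind.
apply: aeS3 H (Hk D bD) (suppT bD) => z H1 H2 H3.
have [Dz|Dz] := pselect (D (psi z)); last exact: H3.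
exfalso; apply: nE; move: (H1 Dz); rewrite H2 [ii D _]iiT // mulr1 => E.
have kg : k * gamma (psi z) != 0 by apply: mulf_neq0; exact/eqP.
apply: (mulIf kg); rewrite E; ring.
Qed.

(** [k] is a quotient of two positive measures. The equality on relatively compact sets extends to
    Borel sets by [lam_le_compact], applied to [phi] with [c] and to [psi] with [c^-1]. *)
Lemma scale_real (k : C R) : k <> 0 -> (forall D : set X, bB D ->
    {ae lamY, forall z, T (ii D) z = k * gamma (psi z) * ii D (psi z)}) ->
  exists c : R, [/\ 0 < c, k = rc c & forall E : set X, borel E ->
    lamX E = (c%:E * lamY (psi @^-1` E))%E].
Proof.
move=> k0 Hk; have H := rl_scale k0 Hk.
have [V cV V0] := nonnull_compact X; have bV := compact_bB cV.
have r0 : 0 < rl V.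
  rewrite lt_def rl_ge0 andbT; apply/eqP => r0; apply: V0.
  by rewrite rlE // r0.
have r0' : 0 < rl (psi @^-1` V).
  rewrite lt_def rl_ge0 andbT; apply/eqP => r1; have := H V bV.
  by rewrite r1 rc0 mulr0 => -[] rV; rewrite rV ltxx in r0.
pose c := rl V / rl (psi @^-1` V); have c0 : 0 < c by rewrite divr_gt0.
have n0 : rc (rl (psi @^-1` V)) != 0 :> C R.
  by rewrite -cabs_gt0 cabs_rc normr_gt0 gt_eqF.
have kc : k = rc c.
  by apply: (mulIf n0); rewrite -H // -rcM /c divfK // gt_eqF.
have Hc (E : set X) : bB E -> lamX E = (c%:E * lamY (psi @^-1` E))%E.
  move=> bE; have bE' := preB bE; rewrite !rlE // -EFinM; congr EFin.
  by have := H E bE; rewrite kc -rcM => -[].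
exists c; split => // E mE; apply/eqP; rewrite eq_le; apply/andP; split.
  apply: (lam_le_compact phiK psiK phi_c psi_c c0) => // K cK.
  by rewrite Hc //; exact: compact_bB.
have mE' : borel (psi @^-1` E) by exact: (borel_comp (X := X) (Y := Y)).
have c1 : 0 < c^-1 by rewrite invr_gt0.
have := lam_le_compact psiK phiK psi_c phi_c c1 _ mE'.
have -> : phi @^-1` (psi @^-1` E) = E by apply/seteqP; split => x /=; rewrite phiK.
rewrite lee_pdivlMl //; apply => K cK; rewrite lee_pdivlMl //.
have cK' : compact (phi @^-1` K) := pre_compact locS psiK phiK cK.
rewrite (Hc _ (compact_bB cK')).
by have -> : psi @^-1` (phi @^-1` K) = K by apply/seteqP; split => y /=; rewrite psiK.
Qed.

(** [psi] pushes [lamY] to [c^-1] times [lamX], and the weight bound compares the integrands. The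
    explicit operator is thus bounded, as the density argument requires. *)
Lemma NN_psi (c M : R) f : 0 < c -> 0 <= M -> (forall E : set X, borel E ->
    lamX E = (c%:E * lamY (psi @^-1` E))%E) ->
  (forall x, cabs (gamma x) * wt (phi x) <= M * wt x) -> mm f ->
  (NN (fun y => gamma (psi y) * f (psi y))%R <= (M `^ p * c^-1)%:E * NN f)%E.
Proof.
move=> c0 M0 Hc HM mf; have p1 := walg_p X.
have mw := @measurable_wt R p X; have mw' := @measurable_wt R p Y.
have mpsi := continuous_Borel psi_c.
pose F (x : X) : \bar R := ((cabs (f x) * wt x) `^ p)%:E.
have mF : measurable_fun setT (F : Borel X -> \bar R) by exact: measurable_Np.
have F0 (x : X) : (0 <= F x)%E by rewrite lee_fin powR_ge0.
have push : (\int[lamY]_(y in [set: Borel Y]) F (psi y) =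
    (c^-1)%:E * \int[lamX]_(x in [set: Borel X]) F x)%E.
  have := @ge0_integral_pushforward _ _ (Borel Y) (Borel X) R psi mpsi lamY setT F
    measurableT mF (fun x _ => F0 x).
  rewrite preimage_setT => <-.
  have ci0 : 0 <= c^-1 by rewrite invr_ge0 ltW.
  have := @ge0_integral_mscale _ (Borel X) R lamX setT measurableT (NngNum ci0) F mF
    (fun x _ => F0 x).
  move=> /= <-; apply: eq_measure_integral => E mE _.
  by rewrite /= /mscale /= Hc // muleA -EFinM mulVf ?gt_eqF // mul1e.
have mg : mm (fun y => gamma (psi y) * f (psi y)).
  by apply: mmM; [exact: mm_psi | exact: mm_psi].
have Mp0 : 0 <= M `^ p by exact: powR_ge0.
rewrite /NN NpE [X in (_ <= X)%E](_ : _ = (M `^ p)%:E *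
    \int[lamY]_(y in [set: Borel Y]) F (psi y))%E; last first.
  by rewrite push NpE EFinM muleA.
have mFp : measurable_fun setT (fun y : Borel Y => F (psi y)).
  exact: (measurableT_comp mF mpsi).
rewrite -ge0_integralZl_EFin //.
apply: ge0_le_integral => //.
- by move=> y _; rewrite lee_fin powR_ge0.
- exact: measurable_Np.
- exact: measurable_funeM.
move=> y _; rewrite -EFinM lee_fin -powRM ?mulr_ge0 ?cabs_ge0 ?wt_ge0 //.
apply: le_powR => //; first by rewrite mulr_ge0 ?cabs_ge0 ?wt_ge0.
have := HM (psi y); rewrite psiK => H.
rewrite cabsM mulrAC mulrC [leRHS]mulrCA.
by apply: ler_wpM2l; first exact: cabs_ge0.
Qed.

Lemma standard_form : exists c : R, [/\ 0 < c,
  forall E : set X, borel E -> lamX E = (c%:E * lamY (psi @^-1` E))%E &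
  forall f, LL f -> {ae lamY, forall y, T f y = rc c * gamma (psi y) * f (psi y)}].
Proof.
have [k k0 Hk] := constant_exists; have [c [c0 kc Hc]] := scale_real k0 Hk.
exists c; split => //.
have [M M0 HM] := weight_bound T; have [M1 M10 B1] := wT_bd T.
pose A := cabs (- rc c : C R) `^ p * (M `^ p * c^-1).
have A0 : 0 <= A by rewrite mulr_ge0 ?mulr_ge0 ?powR_ge0 // invr_ge0 ltW.
pose B := 2 `^ p * (M1 + A).
have B0 : 0 <= B by rewrite mulr_ge0 ?powR_ge0 ?addr_ge0.
have B1' : 0 < B + 1 by rewrite ltr_wpDl.
apply: LL_induct => [K cK|f g Lf Lg Pf Pg|a f Lf Pf|f Lf H].
- by rewrite -kc; apply: Hk; exact: compact_bB.
- by apply: aeS3 (wTD T Lf Lg) Pf Pg => y -> -> ->; rewrite mulrDr.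
- by apply: aeS2 (wTZ T a Lf) Pf => y -> ->; ring.
have mf := LL_mm Lf; have mTf := LL_mm (wT_LL T Lf).
have mform h : mm h -> mm (fun y => gamma (psi y) * h (psi y)).
  by move=> mh; apply: mmM; exact: mm_psi.
have mr : mm (fun y => rc c * gamma (psi y) * f (psi y)).
  by under eq_fun do rewrite -mulrA; apply: mmZ; exact: mform.
have md : mm (fun y => T f y - rc c * gamma (psi y) * f (psi y)) by exact: mmB.
suff : {ae lamY, forall y, T f y - rc c * gamma (psi y) * f (psi y) = 0}.
  by apply: aeS => y /eqP; rewrite subr_eq0 => /eqP.
apply: NN_small0 => // e e0; pose e' := e / (B + 1).
have e0' : 0 < e' by rewrite divr_gt0.
have [g [Lg Pg Ng]] := H e' e0'; have Lfg := LLB Lf Lg; have mfg := LL_mm Lfg.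
have LT := wT_LL T Lfg; have mv := mform _ mfg.
have N1 : (NN (T (fun x => f x - g x)%R) <= (M1 * e')%:E)%E.
  by apply: le_trans (B1 _ Lfg) _; rewrite EFinM lee_wpmul2l // lee_fin.
have N2 : (NN (fun y => - rc c * (gamma (psi y) * (f (psi y) - g (psi y))))%R <= (A * e')%:E)%E.
  rewrite NNZ //.
  have := NN_psi c0 M0 Hc (fun x => HM _ _ _ (lawT x)) mfg => H2.
  have Ap : 0 <= M `^ p * c^-1 by rewrite mulr_ge0 ?powR_ge0 // invr_ge0 ltW.
  apply: (@le_trans _ _ ((cabs (- rc c : C R) `^ p)%:E * ((M `^ p * c^-1)%:E * e'%:E))%E).
    apply: lee_wpmul2l; first by rewrite lee_fin powR_ge0.
    by apply: le_trans H2 _; apply: lee_wpmul2l; rewrite ?lee_fin.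
  by rewrite -!EFinM lee_fin /A mulrA.
have N3 := NND_le (LL_mm LT) (mmZ (- rc c) mv) N1 N2.
rewrite (@eq_NN _ _ Y _ (fun y => T (fun x => f x - g x) y +
  - rc c * (gamma (psi y) * (f (psi y) - g (psi y))))) //; last first.
- by apply: aeS2 (wTB T Lf Lg) Pg => y -> ->; ring.
- by apply: mmD; [exact: LL_mm | exact: mmZ].
apply: le_trans N3 _; rewrite lee_fin -mulrDl mulrA -/B /e' mulrA ler_pdivrMr //.
by rewrite mulrC ler_wpM2l ?(ltW e0) // lerDl.
Qed.

End StandardForm.

(** * From norms to their [p]-th powers *)

Section NormComparison.
Variables (R : realType) (p : R) (X Y : walg p).

Lemma NN_bound (f : X -> C R) (g : Y -> C R) (K : R) : LL f -> LL g ->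
  normLp lam wt p g <= K * normLp lam wt p f -> (NN g <= (`|K| `^ p)%:E * NN f)%E.
Proof.
move=> Lf Lg; have [a a0 Ea] := LL_fin Lf; have [b b0 Eb] := LL_fin Lg.
have p1 := walg_p X; have p0 := p_gt0 X.
have nf : normLp lam wt p f = a `^ p^-1 by rewrite /normLp -[a]/(fine a%:E) -Ea /NN NpE.
have ng : normLp lam wt p g = b `^ p^-1 by rewrite /normLp -[b]/(fine b%:E) -Eb /NN NpE.
rewrite nf ng Ea Eb -EFinM lee_fin => Hn.
have H : b `^ p^-1 <= `|K| * a `^ p^-1.
  by apply: le_trans Hn _; rewrite ler_wpM2r ?powR_ge0 // ler_norm.
have := le_powR p1 (powR_ge0 _ _) H.
by rewrite !powRM ?powR_ge0 // -!powRrM mulVf ?gt_eqF // !powRr1.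
Qed.

End NormComparison.

(** * The standard isomorphism *)

Theorem theorem2p5 (R : realType)
  (G : ptopologicalType) (mul1 : G -> G -> G) (inv1 : G -> G) (e1 : G)
  (lam1 : {measure set (Borel G) -> \bar R}) (w1 : G -> R)
  (H : ptopologicalType) (mul2 : H -> H -> H) (inv2 : H -> H) (e2 : H)
  (lam2 : {measure set (Borel H) -> \bar R}) (w2 : H -> R)
  (p : R)
  (T : (G -> C R) -> (H -> C R)) :
  lc_group mul1 inv1 e1 -> left_haar mul1 lam1 -> weight mul1 e1 w1 ->
  lc_group mul2 inv2 e2 -> left_haar mul2 lam2 -> weight mul2 e2 w2 ->
  1 <= p ->
  Lp_conv_algebra lam1 mul1 inv1 w1 p ->
  Lp_conv_algebra lam2 mul2 inv2 w2 p ->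
  Lp_alg_iso lam1 lam2 mul1 inv1 w1 mul2 inv2 w2 p T ->
  Lp_bicontinuous lam1 lam2 mul1 inv1 w1 mul2 inv2 w2 p T ->
  Lp_biseparating lam1 lam2 mul1 inv1 w1 mul2 inv2 w2 p T ->
  exists (gamma : G -> C R) (phi : G -> H),
    standard_iso mul1 w1 mul2 w2 gamma phi /\
    is_T_std lam1 lam2 mul1 inv1 w1 mul2 inv2 w2 p T gamma phi.
Proof.
move=> g1 h1 wt1' g2 h2 wt2' p1 al1 al2 [[TL Tae TD] [TZ Tcv Tinj Tsurj]] [[K1 HK1] [K2 HK2]].
move=> [sep sepV].
pose X := WAlg g1 h1 wt1' p1 al1; pose Y := WAlg g2 h2 wt2' p1 al2.
have toX f : LL (X := X) f -> InLp lam1 w1 p f by move=> Lf; exact: (InLpE (X := X) f).2 Lf.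
have ofX f : InLp lam1 w1 p f -> LL (X := X) f by move=> Lf; exact: (InLpE (X := X) f).1 Lf.
have toY f : LL (X := Y) f -> InLp lam2 w2 p f by move=> Lf; exact: (InLpE (X := Y) f).2 Lf.
have ofY f : InLp lam2 w2 p f -> LL (X := Y) f by move=> Lf; exact: (InLpE (X := Y) f).1 Lf.
have eX (f g : G -> C R) : aeq lam1 f g <-> {ae lam1, forall x, f x = g x}.
  by split; apply: (aeS (X := X)) => x //; apply.
have eY (f g : H -> C R) : aeq lam2 f g <-> {ae lam2, forall x, f x = g x}.
  by split; apply: (aeS (X := Y)) => x //; apply.
have TLL f : LL (X := X) f -> LL (X := Y) (T f) by move=> /toX/TL/ofY.
unshelve epose (W := @WIso R p X Y T TLL _ _ _ _ _ _ _ _ _ _).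
- by move=> f g /toX Lf /toX Lg /eX E; apply/eY; exact: Tae.
- by move=> f g /toX Lf /toX Lg; apply/eY; exact: TD.
- by move=> a f /toX Lf; apply/eY; exact: TZ.
- by move=> f g /toX Lf /toX Lg; apply/eY; exact: Tcv.
- by move=> f g /toX Lf /toX Lg /eY E; apply/eX; exact: Tinj.
- by move=> h /toY/Tsurj[f /ofX Lf /eY E]; exists f.
- exists (`|K1| `^ p); first exact: powR_ge0.
  by move=> f Lf; apply: NN_bound => //; [exact: TLL | exact/HK1/toX].
- exists (`|K2| `^ p); first exact: powR_ge0.
  by move=> f Lf; apply: NN_bound => //; [exact: TLL | exact/HK2/toX].
- by move=> f g /toX Lf /toX Lg /eX E; apply/eY; exact: sep.
- by move=> f g /toX Lf /toX Lg /eY E; apply/eX; exact: sepV.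
have [S TS] := wiso_inv W.
have [phi Hphi] := choice (wT_core W); have [gamma Hg] := choice Hphi.
have [psi Hpsi] := choice (wT_core S); have [delta Hd] := choice Hpsi.
have locT x : localizes W x (phi x) by case: (Hg x).
have densT x : density_at W x (gamma x) by case: (Hg x).
have gamma0 x : gamma x <> 0 by case: (Hg x).
have lawT x : law W x (phi x) (gamma x) by case: (Hg x).
have locS y : localizes S y (psi y) by case: (Hd y).
have delta0 y : delta y <> 0 by case: (Hd y).
have lawS y : law S y (psi y) (delta y) by case: (Hd y).
have phiK := phiK TS gamma0 delta0 lawT lawS.
have psiK := psiK TS gamma0 delta0 lawT lawS.
have gd := gamma_delta TS gamma0 delta0 lawT lawS.
have gM := phi_gammaM gamma0 lawT.
have phic : continuous phi := phi_cont locT.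
have psic : continuous psi := phi_cont locS.
have [gc1 gc2] := gamma_cont densT.
have [M M0 HM] := weight_bound W; have [M' M0' HM'] := weight_bound S.
exists gamma, phi; split.
  split; split => //.
  - by move=> x y; have [] := gM x y.
  - by exists psi.
  - by move=> x; exact (cvg_pair (gc1 x) (gc2 x)).
  - by move=> x y; have [] := gM x y.
  (* The lower bound is the upper weight bound of the inverse, whose factor at [phi x] is the
     inverse of [gamma x]; adding 1 keeps the constant positive when [M'] is 0. *)
  have M1 : 0 < M' + 1 by rewrite ltr_wpDl.
  exists (M' + 1)^-1; first by rewrite invr_gt0.
  exists M => x.
  have wx : 0 < w1 x by exact: (@wt_gt0 R p X x).
  have wy : 0 < w2 (phi x) by exact: (@wt_gt0 R p Y (phi x)).
  apply/andP; split; last by rewrite ler_pdivrMr //; exact: HM (lawT x).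
  have gx : 0 < cabs (gamma x) by rewrite cabs_gt0; apply/eqP.
  have := HM' _ _ _ (lawS (phi x)); rewrite phiK /= => Hd'.
  have cgd : cabs (gamma x) * cabs (delta (phi x)) = 1 by rewrite -cabsM gd cabs1.
  rewrite ler_pdivlMr // ler_pdivrMl //.
  have := ler_wpM2l (ltW gx) Hd'; rewrite mulrA cgd mul1r => H1.
  apply: le_trans H1 _; rewrite mulrCA ler_wpM2r //; last by rewrite lerDl.
  by rewrite mulr_ge0 // ltW.
have [c [c0 Hc Hf]] := standard_form TS locT locS densT gamma0 delta0 lawT lawS.
exists psi => //; exists c; split => [E mE _|f /ofX Lf].
  by rewrite -(preE phiK psiK) Hc.
by apply/eY; exact: Hf.
Qed.
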